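(* Let $d\ge 1$, let $\alpha,\beta$ be positive constants, and let $\{X_t,t\ge 0\}$ be the super-Brownian motion on $\mathbb{R}^d$ corresponding to the operator $\frac12\Delta u+\beta u-\alpha u^2$. For every $\varepsilon$ with $0<\varepsilon<\beta$ and every $x\in\mathbb{R}^d$, $W_t(\lambda)$ converges uniformly in $\lambda\in\Lambda_\varepsilon$ as $t\to\infty$, $\mathbb{P}_{\delta_x}$-almost surely.
   Context: $M_F(\mathbb{R}^d)$ is the space of finite Borel measures on $\mathbb{R}^d$ with the topology of weak convergence, and $\langle\mu,f\rangle=\langle f,\mu\rangle=\int f\,d\mu$. Let $P_t$ be the transition semigroup of standard Brownian motion on $\mathbb{R}^d$ (generator $\frac12\Delta$) and $P_t^\beta=e^{\beta t}P_t$. The super-Brownian motion on $\mathbb{R}^d$ corresponding to the operator $\frac12\Delta u+\beta u-\alpha u^2$ is the time-homogeneous càdlàg $M_F(\mathbb{R}^d)$-valued Markov process $\{X_t,t\ge0\}$, with laws $\mathbb{P}_\mu$ for $\mu\in M_F(\mathbb{R}^d)$ (under $\mathbb{P}_\mu$, $X_0=\mu$), such that for every bounded non-negative Borel function $f$, $$\mathbb{E}_\mu[e^{-\langle f,X_t\rangle}]=e^{-\langle u(t,\cdot),\mu\rangle},$$ where $\mathbb{E}_\mu$ is expectation under $\mathbb{P}_\mu$ and $u$ is the unique solution of $u(t,x)+\int_0^t P^\beta_{t-s}(\alpha\, u(s,\cdot)^2)(x)\,ds=P_t^\beta f(x)$. $\delta_x$ is the unit mass at $x$. For $\lambda,x\in\mathbb{R}^d$,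 $\lambda x$ is the inner product, $\varphi_\lambda(x)=e^{i\lambda x}$, $\rho(\lambda)=\beta-\frac12|\lambda|^2$, and $W_t(\lambda)=e^{-\rho(\lambda)t}\langle X_t,\overline{\varphi_\lambda}\rangle$. For $0<\varepsilon<\beta$, $\Lambda_\varepsilon=\{\lambda\in\mathbb{R}^d: 2\rho(\lambda)-\beta\ge\varepsilon\}$. *)

(* Defs.v *)
From HB Require Import structures.
From mathcomp Require Import all_boot all_order all_algebra.
From mathcomp Require Import complex.
From mathcomp Require Import all_classical all_reals all_analysis.
From mathcomp Require Import measurable_realfun.

Set Implicit Arguments.
Unset Strict Implicit.
Unset Printing Implicit Defensive.

Import Order.TTheory GRing.Theory Num.Theory.
Import numFieldNormedType.Exports.

Local Open Scope classical_set_scope.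
Local Open Scope ring_scope.

Definition borel (T : ptopologicalType) : measurableType (@open T).-sigma :=
  g_sigma_algebraType (@open T).

Definition euclidean (R : realType) (d : nat) := borel 'rV[R]_d.

Definition inner (R : realType) (d : nat) (x y : 'rV[R]_d) : R :=
  \sum_(i < d) x 0 i * y 0 i.

Section finite_measures.
Variables (R : realType) (d : nat).

Definition fmeasure : Type := {finite_measure set (euclidean R d) -> \bar R}.

HB.instance Definition _ := gen_eqMixin fmeasure.
HB.instance Definition _ := gen_choiceMixin fmeasure.
HB.instance Definition _ := isPointed.Build fmeasure mzero.

(* [<mu, f>]; [Rintegral] returns a junk value when [f] is not integrable, so
   this is only used for bounded Borel [f]. *)
Definition pairing (mu : fmeasure) (f : 'rV[R]_d -> R) : R :=
  \int[(mu : {finite_measure set (euclidean R d) -> \bar R})]_x f x.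

Definition bounded_continuous : Type :=
  {f : 'rV[R]_d -> R | continuous f /\ bounded_fun f}.

HB.instance Definition _ := gen_eqMixin bounded_continuous.
HB.instance Definition _ := gen_choiceMixin bounded_continuous.

(* Weak convergence is pointwise convergence of [f |-> <mu, f>] over bounded
   continuous [f]. *)
Definition MF : ptopologicalType := initial_topology
  (fun mu : fmeasure =>
     (fun f => pairing mu (sval f)) : {ptws bounded_continuous -> R}).

Definition delta (x : 'rV[R]_d) : MF :=
  (\d_(x : euclidean R d) : {finite_measure set (euclidean R d) -> \bar R}).

End finite_measures.

Section brownian_semigroup.
Variable R : realType.

Local Notation Rm := (measurableTypeR R).

Lemma measurable_cons_tuple n :
  measurable_fun [set: Rm * n.-tuple Rm]
    (fun p => [tuple of p.1 :: p.2] : n.+1.-tuple Rm).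
Proof. exact: measurable_cons. Qed.

Definition cons_tuple n : {mfun (Rm * n.-tuple Rm)%type >-> n.+1.-tuple Rm} :=
  mfun_Sub (mem_set (@measurable_cons_tuple n)).

(* The law of [d] independent standard normal variables. *)
Fixpoint std_gaussian (d : nat) : probability (d.-tuple Rm) R :=
  match d with
  | 0 => \d_([tuple] : 0.-tuple Rm)
  | n.+1 => distribution (normal_prob (0 : R) 1 \x std_gaussian n)%E
              (cons_tuple n)
  end.

Variable d : nat.

(* [P_t f x] is the expectation of [f] at [x] plus [sqrt t] times a standard
   Gaussian vector. *)
Definition heat (t : R) (f : 'rV[R]_d -> \bar R) (x : 'rV[R]_d) : \bar R :=
  (\int[std_gaussian d]_z f (x + Num.sqrt t *: \row_i tnth z i)%R)%E.

Definition heat_growth (beta t : R) (f : 'rV[R]_d -> \bar R) (x : 'rV[R]_d) :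
  \bar R := ((expR (beta * t))%:E * heat t f x)%E.

End brownian_semigroup.

Section markov.
Variables (R : realType) (E : ptopologicalType).
Variables (dO : measure_display) (Omega : measurableType dO).
Variables (P : E -> probability Omega R) (X : R -> Omega -> E).

Definition cadlag (x : R -> E) : Prop :=
  forall t : R, 0 <= t ->
    (x @ t^'+ --> x t) /\ (0 < t -> exists l : E, x @ t^'- --> l).

(* the natural filtration at time [t] *)
Definition history (t : R) : set (set Omega) :=
  <<s [set A | exists (s : R) (B : set (borel E)),
        [/\ 0 <= s, s <= t, measurable B & A = X s @^-1` B]] >>.

Record homogeneous_markov : Prop := HomogeneousMarkov {
  markov_measurable : forall t : R, 0 <= t ->
    measurable_fun [set: Omega] (X t : Omega -> borel E);
  markov_start : forall x, {ae P x, forall w, X 0 w = x};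
  markov_kernel : forall (t : R) (B : set (borel E)), 0 <= t -> measurable B ->
    measurable_fun [set: borel E]
      ((fun x => P x (X t @^-1` B)) : borel E -> \bar R);
  markov_property : forall x (s t : R) A (B : set (borel E)),
    0 <= s -> 0 <= t ->
    history s A -> measurable B ->
    P x (A `&` X (s + t) @^-1` B)
    = (\int[P x]_(w in A) P (X s w) (X t @^-1` B))%E
}.

End markov.

Section super_brownian_motion.
Variables (R : realType) (d : nat) (alpha beta : R).

(* [u] is a non-negative Borel solution on [0, +oo[ of
   u(t,x) + \int_0^t P^beta_(t-s) (alpha u(s,.)^2) (x) ds = P^beta_t f (x);
   the values of [u] at negative times are irrelevant. *)
Definition mild_solution (f : 'rV[R]_d -> R) (u : R -> 'rV[R]_d -> R) : Prop :=
  [/\ forall (t : R) x, 0 <= t -> 0 <= u t x,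
      measurable_fun [set p : R * euclidean R d | 0 <= p.1]
        (fun p : R * euclidean R d => u p.1 p.2)
    & forall (t : R) x, 0 <= t ->
        ((u t x)%:E + \int[lebesgue_measure]_(s in `[0%R, t])
             heat_growth beta (t - s) (fun y => (alpha * u s y ^+ 2)%:E) x
         = heat_growth beta t (fun y => (f y)%:E) x)%E].

Definition unique_mild_solution (f : 'rV[R]_d -> R) (u : R -> 'rV[R]_d -> R) :
  Prop :=
  mild_solution f u /\
  forall v, mild_solution f v -> forall (t : R) x, 0 <= t -> v t x = u t x.

Variables (dO : measure_display) (Omega : measurableType dO).
Variables (P : MF R d -> probability Omega R) (X : R -> Omega -> MF R d).

Record super_brownian_motion : Prop := SuperBrownianMotion {
  sbm_markov : homogeneous_markov P X;
  sbm_cadlag : forall w, cadlag (X ^~ w);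
  sbm_laplace : forall f : 'rV[R]_d -> R,
    measurable_fun [set: euclidean R d] (f : euclidean R d -> R) ->
    bounded_fun f -> (forall x, 0 <= f x) ->
    exists2 u, unique_mild_solution f u &
      forall mu (t : R), 0 <= t ->
        \int[P mu]_w expR (- pairing (X t w) f) = expR (- pairing mu (u t))
}.

End super_brownian_motion.

(* [R[i]] seen as a closed field, which gives it its topology *)
Definition Cplx (R : realType) : numClosedFieldType := R[i].

Section additive_martingale.
Local Open Scope complex_scope.
Variables (R : realType) (d : nat).

Definition phi (lambda x : 'rV[R]_d) : R[i] :=
  cos (inner lambda x) +i* sin (inner lambda x).

Definition pairingC (mu : MF R d) (g : 'rV[R]_d -> R[i]) : R[i] :=
  pairing mu (fun x => complex.Re (g x))
  +i* pairing mu (fun x => complex.Im (g x)).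

Definition rho (beta : R) (lambda : 'rV[R]_d) : R :=
  beta - inner lambda lambda / 2.

Definition W (beta : R) (Omega : Type) (X : R -> Omega -> MF R d)
    (w : Omega) (t : R) (lambda : 'rV[R]_d) : Cplx R :=
  (expR (- rho beta lambda * t))%:C
  * pairingC (X t w) (fun x => (phi lambda x)^*).

Definition Lambda (beta eps : R) : set 'rV[R]_d :=
  [set lambda | eps <= 2 * rho beta lambda - beta].

End additive_martingale.

(* Main.v *)
(* For every frequency [l] the process [W_t(l)] is a martingale, because
   [exp(- rho(l) t) cos(l.y + a)] is space-time harmonic for [P^beta]. The
   second moment formula, read off the Laplace functional at small arguments,
   bounds the increments over [[n, n+1]] of the martingale attached to a
   space-time harmonic [H] by the values of [P^beta_r (H_r^2)].

   To get uniformity in [l], fix a sign vector and a mesh [2^-m] and expand the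
   wave at a grid frequency by telescoping in every coordinate: it is a sum of
   products of one-dimensional increments, each of [L^2] size of order
   [2^-m (n+1)], so the sum of the [L^1] norms of all martingale increments is
   at most [C (n+1)^d e^(- c n)] uniformly in [m]. That sum of absolute values
   is a submartingale; a maximal inequality, the limit in [m] and Borel-Cantelli
   control [W_t(l) - W_n(l)] at dyadic times and dyadic frequencies, and
   right-continuity in [t] and continuity in [l] extend this to all of them. *)
Require Import Defs.
From mathcomp Require Import all_boot all_order all_algebra.
From mathcomp Require Import complex finmap.
From mathcomp Require Import all_classical all_reals all_analysis.
From mathcomp Require Import measurable_realfun.
From mathcomp Require Import ring lra.

Set Implicit Arguments.
Unset Strict Implicit.
Unset Printing Implicit Defensive.

Import Order.TTheory GRing.Theory Num.Theory.
Import numFieldNormedType.Exports.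

Local Open Scope classical_set_scope.
Local Open Scope ring_scope.

(** * Gaussian integrals and Borel measurability *)

(** The region comes from an exponent count. For a wave of frequency [l], the semigroup contributes
    [exp(beta r)] to [P^beta_r (H_r^2)] and the square contributes [exp(- 2 rho(l) r)], so squared
    increments decay like [exp(- (2 rho(l) - beta) r)]. On [Lambda beta eps] this rate is at least
    [eps], which says exactly that the squared length of [l] is at most [kappa = beta - eps]. The
    obstacle is that a union bound over grid frequencies loses their number, of order [2^(m d)].
    Increments mixed over the coordinates repay it: each coordinate that moves has about [2^m]
    positions and contributes a factor of order [2^-m]. Outside the ball the decay fails, so
    increments there are set to zero. Shrinking coordinates towards 0 stays in the ball, so the
    telescoped sum of a frequency inside never meets them; signs are fixed first so that telescoping
    runs outwards from 0 in each orthant. The Laplace functional only speaks of non-negative test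
    functions; signed ones are reached by adding constants. *)

Section gaussian_characteristic_function.
Variable R : realType.
Local Notation mu := (@lebesgue_measure R).
Local Notation N01 := (normal_prob (0 : R) 1).
Local Notation pdf := (normal_pdf (0 : R) 1).

(** A Radon-Nikodym derivative is determined only almost everywhere; it agrees with the density
    because both have the same integral over every measurable set. *)
Lemma integral_normal_prob01 (f : R -> R) :
  measurable_fun setT f -> bounded_fun f ->
  \int[N01]_x f x = \int[mu]_x (f x * pdf x).
Proof.
move=> mf bf; rewrite /Rintegral; congr fine.
have mU := @measurableT _ (measurableTypeR R).
have finf : (N01).-integrable setT (EFin \o f).
  apply: measurable_bounded_integrable => //.
    by have /= -> := probability_setT N01; exact: ltry.
rewrite -(Radon_Nikodym_change_of_variables (normal_prob_dominates 0 1))//=.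
under [RHS]eq_integral do rewrite EFinM.
apply: ae_eq_integral => //.
- apply: emeasurable_funM; first exact/measurable_EFinP.
  apply: (measurable_int mu).
  by apply: Radon_Nikodym_integrable; exact: normal_prob_dominates.
- apply: emeasurable_funM; first exact/measurable_EFinP.
  by apply/measurable_EFinP; exact: measurable_normal_pdf.
- apply: ae_eqe_mul2l => /=.
  rewrite Radon_NikodymE//=; first exact: normal_prob_dominates.
  move=> abmu.
  case: cid => /= h [h1 h2 h3].
  apply: integral_ae_eq => //=.
  + by apply/measurable_funTS/measurableT_comp =>//; exact: measurable_normal_pdf.
  + by move=> E E01 mE; rewrite -h3.
Qed.

Lemma normal_pdf01E (z : R) : pdf z = normal_peak 1 * expR (- z ^+ 2 / 2).
Proof. by rewrite normal_pdfE ?oner_eq0// /normal_fun subr0 expr1n. Qed.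

Lemma is_derive_normal_pdf01 (z : R) : is_derive z 1 pdf (- z * pdf z).
Proof.
rewrite (_ : pdf = (fun z => normal_peak 1 * expR (- z ^+ 2 / 2))); last first.
  by apply/funext => y; exact: normal_pdf01E.
apply: is_derive_eq.
by rewrite /GRing.scale/=; field.
Qed.

(** Comparison with the Gaussian of standard deviation 2: the ratio of the exponentials is
    [expR (3 / 8 * z ^+ 2)], at least [1 + 3 / 8 * z ^+ 2], which exceeds [|z|]. It makes the first
    absolute moment integrable without computing it. *)
Lemma normM_normal_pdf01_le (z : R) :
  `|z| * pdf z <= 2 * normal_pdf 0 2 z.
Proof.
have n2 : (2 : R) != 0 by rewrite pnatr_eq0.
rewrite normal_pdf01E normal_pdfE // /normal_fun subr0.
have -> : normal_peak (2 : R) = normal_peak 1 / 2.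
  rewrite /normal_peak -invfM; congr (_^-1).
  rewrite (_ : 2 ^+ 2 * pi *+ 2 = (1 ^+ 2 * pi *+ 2) * 2 ^+ 2 :> R); last by ring.
  rewrite sqrtrM; last by rewrite mulrn_wge0 // mulr_ge0 // pi_ge0.
  by rewrite sqrtr_sqr ger0_norm.
rewrite [leRHS](_ : _ = normal_peak 1 * expR (- z ^+ 2 / (2 ^+ 2 *+ 2)));
  last by field.
rewrite mulrCA ler_wpM2l ?normal_peak_ge0//.
rewrite [in leRHS](_ : - z ^+ 2 / _ = 3 / 8 * z ^+ 2 + - z ^+ 2 / 2);
  last by field.
rewrite expRD ler_wpM2r ?expR_ge0//.
apply: le_trans (expR_ge1Dx _).
have := sqr_ge0 (`|z| - 2); rewrite sqrrB real_normK ?num_real//.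
have := sqr_ge0 z.
lra.
Qed.

Lemma integrable_normM_normal_pdf01 :
  mu.-integrable setT (fun z => (`|z| * pdf z)%:E).
Proof.
refine (@le_integrable _ _ R mu setT measurableT _ (fun z => (2%:E * (normal_pdf 0 2 z)%:E)%E) _ _ _).
- apply/measurable_EFinP/measurable_funM => //; exact: measurable_normal_pdf.
- move=> z _; rewrite -EFinM !abse_EFin lee_fin ger0_norm; last first.
    by rewrite mulr_ge0 // normal_pdf_ge0.
  by rewrite ger0_norm ?normM_normal_pdf01_le // mulr_ge0 // normal_pdf_ge0.
- apply: integrableZl => //; exact: integrable_normal_pdf.
Qed.

Lemma measurable_cos : measurable_fun setT (cos : R -> R).
Proof. by apply: continuous_measurable_fun; exact: continuous_cos. Qed.

Lemma measurable_sin : measurable_fun setT (sin : R -> R).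
Proof. by apply: continuous_measurable_fun; exact: continuous_sin. Qed.

Lemma measurable_cosD (a b : R) : measurable_fun setT (fun z => cos (a + b * z)).
Proof.
apply: measurableT_comp; first exact: measurable_cos.
by apply: measurable_funD => //; exact: measurable_funM.
Qed.

Lemma measurable_sinD (a b : R) : measurable_fun setT (fun z => sin (a + b * z)).
Proof.
apply: measurableT_comp; first exact: measurable_sin.
by apply: measurable_funD => //; exact: measurable_funM.
Qed.

Lemma cos_norm_le1 (z : R) : `|cos z| <= 1.
Proof. by rewrite ler_norml cos_geN1 cos_le1. Qed.

Lemma sin_norm_le1 (z : R) : `|sin z| <= 1.
Proof. by rewrite ler_norml sin_geN1 sin_le1. Qed.

(** Derivative of [stein_prim] below. Since that primitive vanishes at both infinities, the integral
    of this function over the line is 0, which is Stein's identity for the sine. *)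
Let stein_der (a b z : R) := z * sin (a + b * z) * pdf z - b * cos (a + b * z) * pdf z.

Let measurable_stein_der a b : measurable_fun setT (stein_der a b).
Proof.
apply: measurable_funB; apply: measurable_funM;
  try exact: measurable_normal_pdf; apply: measurable_funM => //.
- exact: measurable_sinD.
- exact: measurable_cosD.
Qed.

Lemma integrable_sinM_normal_pdf01 (a b : R) :
  mu.-integrable setT (fun z => (z * sin (a + b * z) * pdf z)%:E).
Proof.
refine (le_integrable measurableT _ _ integrable_normM_normal_pdf01).
- apply/measurable_EFinP/measurable_funM; last exact: measurable_normal_pdf.
  by apply: measurable_funM => //; exact: measurable_sinD.
- move=> z _; rewrite !abse_EFin lee_fin !normrM normr_id.
  rewrite ler_wpM2r // ler_piMr // ?sin_norm_le1 //.
Qed.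

Lemma integrable_cosM_normal_pdf01 (a b : R) :
  mu.-integrable setT (fun z => (cos (a + b * z) * pdf z)%:E).
Proof.
refine (le_integrable measurableT _ _ (integrable_normal_pdf 0 1)).
- apply/measurable_EFinP/measurable_funM; last exact: measurable_normal_pdf.
  exact: measurable_cosD.
- move=> z _; rewrite !abse_EFin lee_fin !normrM.
  by rewrite ler_piMl // cos_norm_le1.
Qed.

Lemma is_derive_sinD (a b z : R) :
  is_derive z 1 (fun z => sin (a + b * z)) (b * cos (a + b * z)).
Proof.
apply: is_derive_eq; rewrite /GRing.scale/= add0r; ring.
Qed.

Let integrable_stein_der a b : mu.-integrable setT (EFin \o stein_der a b).
Proof.
rewrite (_ : _ \o _ = (fun z => (z * sin (a + b * z) * pdf z)%:E) \-
    (fun z => b%:E * (cos (a + b * z) * pdf z)%:E))%E; last first.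
  by apply/funext => z /=; rewrite mulrA.
apply: integrableB => //; first exact: integrable_sinM_normal_pdf01.
apply: integrableZl => //; exact: integrable_cosM_normal_pdf01.
Qed.

Let stein_prim (a b z : R) := - (sin (a + b * z) * pdf z).

Let is_derive_stein_prim (a b z : R) :
  is_derive z 1 (stein_prim a b) (stein_der a b z).
Proof.
have d1 := is_derive_sinD a b z; have d2 := is_derive_normal_pdf01 z.
apply: is_derive_eq; rewrite /stein_der /GRing.scale/=; ring.
Qed.

Let stein_itv (a b : R) n : (0 < n)%N ->
  (\int[mu]_(z in `[(- n%:R)%R, n%:R]) (stein_der a b z)%:E =
  (stein_prim a b n%:R - stein_prim a b (- n%:R))%:E)%E.
Proof.
move=> n0.
have dK z : derivable (stein_prim a b) z 1.
  by have [] := is_derive_stein_prim a b z.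
have cK : continuous (stein_prim a b).
  by move=> z; apply/differentiable_continuous/derivable1_diffP.
rewrite (@continuous_FTC2 _ _ (stein_prim a b)) ?EFinB//.
- by rewrite gtrN // ltr0n.
- apply: continuous_subspaceT => z; apply: cvgB.
  + apply: cvgM; last by apply: continuous_normal_pdf; rewrite oner_eq0.
    apply: cvgM; first exact: cvg_id.
    have := is_derive_sinD a b z => -[+ _].
    by move/derivable1_diffP/differentiable_continuous.
  + apply: cvgM; last by apply: continuous_normal_pdf; rewrite oner_eq0.
    apply: cvgMl_tmp.
    apply: (@continuous_comp _ _ _ (fun z => a + b * z) cos).
      by apply: cvgD; [exact: cvg_cst|apply: cvgMl_tmp; exact: cvg_id].
    exact: continuous_cos.
- split => //.
  + exact: cvg_at_right_filter (cK _).
  + exact: cvg_at_left_filter (cK _).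
- move=> z _; rewrite derive1E.
  by have [_ ->] := is_derive_stein_prim a b z.
Qed.

Let cvg_stein_prim (a b s : R) : `|s| = 1 ->
  stein_prim a b (s * n%:R) @[n --> \oo] --> 0.
Proof.
move=> s1.
have e0 : normal_peak 1 * expR (- n%:R) @[n --> \oo] --> (0 : R).
  rewrite -(mulr0 (normal_peak 1)); apply: cvgMl_tmp; exact: cvgn_expR.
apply/norm_cvg0P; apply: (squeeze_cvgr _ (cvg_cst 0) e0).
near=> n; rewrite normr_ge0 /= normrN normrM.
apply: (@le_trans _ _ (pdf (s * n%:R))).
  by rewrite [X in _ * X]ger0_norm ?normal_pdf_ge0 // ler_piMl ?normal_pdf_ge0 // sin_norm_le1.
rewrite normal_pdf01E ler_wpM2l ?normal_peak_ge0 // ler_expR exprMn.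
rewrite -[s ^+ 2]real_normK ?num_real // s1 expr1n mul1r.
(* From 2 on, [n ^ 2 / 2] is at least [n], so the density at [n] is below a multiple of
   [expR (- n)]. *)
have n2 : (2 : R) <= n%:R by rewrite ler_nat; near: n; exact: nbhs_infty_ge.
nra.
Unshelve. all: by end_near. Qed.

Let stein_der_int (a b : R) : \int[mu]_z stein_der a b z = 0.
Proof.
have mI n : measurable (`[- n%:R, n%:R]%classic : set (measurableTypeR R)).
  exact: measurable_itv.
have h : (\int[mu]_z ((stein_der a b \_ `[- n%:R, n%:R]) z)%:E @[n --> \oo]
    --> \int[mu]_z (stein_der a b z)%:E)%E.
  apply: (@dominated_cvg _ _ _ mu setT _ _ _ (fun z => `|(stein_der a b z)%:E|%E)).
  - exact: measurableT.
  - move=> n; apply/measurable_EFinP.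
    apply: (iffLR (measurable_restrictT _ (mI n))).
    by apply: measurable_funTS; exact: measurable_stein_der.
  - move=> z _; apply: cvg_EFin; first exact: nearW.
    apply: cvg_near_cst; near=> n; rewrite /= patchE ifT //.
    rewrite inE /= in_itv /= -ler_norml.
    by near: n; exact: nbhs_infty_ger.
  - by [].
  - by apply: integrable_abse; exact: integrable_stein_der.
  - move=> n z _; rewrite lee_fin patchE; case: ifP => // _.
    by rewrite normr0.
have c := cvgB (cvg_stein_prim a b (normr1 _)) (cvg_stein_prim a b (normrN1 _)).
have h2 : ((\int[mu]_z ((stein_der a b \_ `[- n%:R, n%:R]) z)%:E)%E @[n --> \oo]
    --> (0 - 0)%R%:E)%E.
  have {}c := cvg_EFin (f := fun n => (stein_prim a b (1 * n%:R) -
    stein_prim a b (-1 * n%:R))%:E) (nearW _ (fun=> erefl)) (c _).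
  suff /near_eq_cvg/cvg_trans : \forall n \near \oo,
      (stein_prim a b (1 * n%:R) - stein_prim a b (-1 * n%:R))%:E =
      (\int[mu]_z ((stein_der a b \_ `[- n%:R, n%:R]) z)%:E)%E by (apply; exact: c).
  near=> n; rewrite mul1r mulN1r -stein_itv.
    rewrite [LHS]integral_mkcond; apply: eq_integral => z _.
    by rewrite restrict_EFin.
  by near: n; exact: nbhs_infty_gt.
rewrite /Rintegral (cvg_unique _ h h2) ?subr0 //.
Unshelve. all: by end_near. Qed.

Lemma integral_sinM_normal_pdf01 (a b : R) :
  \int[mu]_z (z * sin (a + b * z) * pdf z) =
  b * \int[mu]_z (cos (a + b * z) * pdf z).
Proof.
have ic := integrable_cosM_normal_pdf01 a b.
rewrite -RintegralZl //; apply/eqP; rewrite -subr_eq0 -RintegralB //.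
- rewrite -[eqbRHS](stein_der_int a b); apply/eqP.
  by apply: eq_Rintegral => z _; rewrite mulrA.
- exact: integrable_sinM_normal_pdf01.
- have := integrableZl measurableT b ic; exact: eq_integrable.
Qed.

Let cosint (a b : R) := \int[mu]_z (cos (a + b * z) * pdf z).

(** Differentiation under the integral, dominated by [|z| * pdf z], followed by Stein's identity. *)
Let is_derive_cosint (a b : R) : is_derive b 1 (cosint a) (- b * cosint a b).
Proof.
pose f (b z : R) := cos (a + b * z) * pdf z.
have df (b' z : R) : is_derive b' 1 (f ^~ z) (- (z * sin (a + b' * z) * pdf z)).
  rewrite /f; apply: is_derive_eq.
  by rewrite /GRing.scale/= add0r; ring.
have bI : `]b - 1, b + 1[%classic b.
  by rewrite /= in_itv/= ltrDl ltrBlDr ltrDl !ltr01.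
have d1 b' z : partial1of2 f b' z = - (z * sin (a + b' * z) * pdf z).
  by rewrite partial1of2E; have [_ ->] := df b' z.
have If b' : `]b - 1, b + 1[%classic b' -> mu.-integrable setT (EFin \o f b').
  by move=> _; exact: integrable_cosM_normal_pdf01.
have Df b' z : `]b - 1, b + 1[%classic b' -> setT z -> derivable (f ^~ z) b' 1.
  by move=> _ _; have [] := df b' z.
have G0 z : 0 <= `|z| * pdf z by rewrite mulr_ge0 // normal_pdf_ge0.
have Gb b' z : `]b - 1, b + 1[%classic b' -> setT z ->
    `|partial1of2 f b' z| <= `|z| * pdf z.
  move=> _ _; rewrite d1 normrN 2!normrM [X in _ * X]ger0_norm ?normal_pdf_ge0 //.
  by rewrite ler_wpM2r ?normal_pdf_ge0 // ler_piMr // sin_norm_le1.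
have mT := @measurableT _ (measurableTypeR R).
apply: DeriveDef.
  exact: (derivable_under_integral mT bI If Df G0
    integrable_normM_normal_pdf01 Gb).
have := differentiation_under_integral mT bI If Df G0
    integrable_normM_normal_pdf01 Gb.
rewrite derive1E => ->; rewrite mulNr -integral_sinM_normal_pdf01 -mulN1r.
rewrite -RintegralZl //; last exact: integrable_sinM_normal_pdf01.
by apply: eq_Rintegral => z _; rewrite d1 mulN1r.
Qed.

(** By the differential equation for [cosint], [expR (b ^+ 2 / 2) * cosint a b] has derivative 0 in
    [b]; its value at [b = 0] is [cos a]. Keeping a phase [a] covers both parts of the
    characteristic function with real integrals. *)
Lemma integral_cos_normal_prob01 (a b : R) :
  \int[N01]_z cos (a + b * z) = expR (- b ^+ 2 / 2) * cos a.
Proof.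
rewrite integral_normal_prob01; first last.
- by exists 1; split => // M M1 z _ /=; exact: le_trans (cos_norm_le1 _) (ltW M1).
- exact: measurable_cosD.
have h (b' : R) : is_derive b' 1 (fun b => expR (b ^+ 2 / 2) * cosint a b) 0.
  have := is_derive_cosint a b' => d.
  apply: is_derive_eq.
  by rewrite /GRing.scale/=; field.
have := is_derive_0_is_cst b 0 h; rewrite expr0n/= mul0r expR0 mul1r.
have -> : cosint a 0 = cos a.
  rewrite /cosint; under eq_Rintegral do rewrite mul0r addr0.
  rewrite RintegralZl//; last exact: integrable_normal_pdf.
  by rewrite /Rintegral integral_normal_pdf mulr1.
by move=> <-; rewrite mulrA -expRD -mulrDl addNr mul0r expR0 mul1r.
Qed.

End gaussian_characteristic_function.

Section bounded_functions.

(** [bounded_fun] is stated for all large enough bounds; this form hands over one constant to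
    compute with. *)
Definition bdd (R : realType) (T : Type) (f : T -> R) :=
  exists M, forall x, `|f x| <= M.

Lemma bdd_bounded_fun (R : realType) (T : Type) (f : T -> R) :
  bdd f -> bounded_fun f.
Proof.
move=> [M fM]; exists M; split; first by rewrite num_real.
by move=> x Mx t _ /=; exact: le_trans (fM t) (ltW Mx).
Qed.

Lemma bdd_integrable d (T : measurableType d) (R : realType)
    (mu : {finite_measure set T -> \bar R}) (f : T -> R) :
  measurable_fun setT f -> bdd f -> mu.-integrable setT (EFin \o f).
Proof.
move=> mf bf; apply: measurable_bounded_integrable => //.
- by rewrite -ge0_fin_numE // fin_num_measure.
- exact: bdd_bounded_fun.
Qed.

Lemma integral_bdd_fin_num d (T : measurableType d) (R : realType)
    (mu : {finite_measure set T -> \bar R}) (f : T -> R) :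
  measurable_fun setT f -> bdd f -> (\int[mu]_x (f x)%:E)%E \is a fin_num.
Proof.
by move=> mf bf; apply: integrable_fin_num => //; exact: bdd_integrable.
Qed.

Lemma Rintegral_bdd_le d (T : measurableType d) (R : realType)
    (mu : {finite_measure set T -> \bar R}) (f : T -> R) M :
  measurable_fun setT f -> (forall x, `|f x| <= M) ->
  `|\int[mu]_x f x| <= M * fine (mu setT).
Proof.
move=> mf bf; have If : mu.-integrable setT (EFin \o f).
  by apply: bdd_integrable => //; exists M.
apply: le_trans (le_normr_Rintegral measurableT If) _.
rewrite -Rintegral_cst //; apply: le_Rintegral => //.
- exact: integrable_norm.
- by apply: bdd_integrable => //; exists `|M|.
Qed.

Lemma Rintegral_probability_cst d (T : measurableType d) (R : realType)
    (P : probability T R) (c : R) : \int[P]_x c = c.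
Proof. by rewrite Rintegral_cst //= probability_setT mulr1. Qed.

Lemma Rintegral_probability_le d (T : measurableType d) (R : realType)
    (P : probability T R) (f : T -> R) M :
  measurable_fun setT f -> (forall x, `|f x| <= M) -> `|\int[P]_x f x| <= M.
Proof.
by move=> mf fM; have := Rintegral_bdd_le P mf fM; rewrite /= probability_setT mulr1.
Qed.

End bounded_functions.

Section borel_measurability.

Lemma continuous_borel_measurable (R : realType) (T : ptopologicalType)
    (f : T -> R) :
  continuous f -> measurable_fun setT (f : borel T -> R).
Proof.
move=> cf; apply: (measurability _ (RGenOpens.measurableE R)).
move=> _ [_ [a [b ->]] <-]; rewrite setTI; apply: sub_sigma_algebra.
move/continuousP : cf; apply; exact: interval_open.
Qed.

(** The Borel sets of the row space come from its topology, not from coordinates. Every open set is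
    a countable union of boxes with rational centre and radius [1 / (n + 1)], and the preimage of a
    box is a finite intersection of coordinate conditions. *)
Lemma measurable_fun_euclidean (R : realType) (d : nat) dT
    (T : measurableType dT) (F : T -> 'rV[R]_d) :
  (forall i, measurable_fun setT (fun t => F t 0 i)) ->
  measurable_fun setT (F : T -> euclidean R d).
Proof.
move=> mF.
apply: (@measurability _ _ _ (euclidean R d) setT F (@open 'rV[R]_d)) => //.
move=> _ [U oU <-]; rewrite setTI.
pose box (q : 'rV[rat]_d * nat) : set 'rV[R]_d :=
  [set y | forall i, `|ratr (q.1 0 i) - y 0 i| < q.2.+1%:R^-1].
pose B (q : 'rV[rat]_d * nat) : set T :=
  if `[< box q `<=` U >] then F @^-1` box q else set0.
have -> : F @^-1` U = \bigcup_q B q.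
  apply/seteqP; split => [t /= Ut|t [q _]]; last first.
    by rewrite /B; case: asboolP => // qU; exact: qU.
  have /nbhs_ballP[e /= e0 eU] := open_nbhs_nbhs (conj oU Ut).
  (* The factor 2 accounts for the distance from [F t] to the rational centre plus the radius of the
     box. *)
  have [n en] : exists n : nat, 2 / n.+1%:R < e.
    have [|n] := @ltr_add_invr R 0 (e / 2); first by rewrite divr_gt0.
    by rewrite add0r ltr_pdivlMr // mulrC => ?; exists n.
  have /choice[q hq] : forall i, exists q : rat, `|ratr q - F t 0 i| < n.+1%:R^-1.
    move=> i.
    have [q] : exists q, ratr q \in `](F t 0 i - n.+1%:R^-1), (F t 0 i + n.+1%:R^-1)[%R.
      by apply: rat_in_itvoo; rewrite ltrBlDr -addrA ltrDl addr_gt0 // invr_gt0.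
    rewrite in_itv/= => /andP[q1 q2]; exists q.
    by rewrite ltr_norml ltrBlDr (addrC _ (F t 0 i)) q2 ltrBrDr addrC q1.
  exists (\row_i q i, n) => //; rewrite /B; case: asboolP => [_ i /=|[]].
    by rewrite mxE.
  move=> y qy; apply: eU; split => // i j; rewrite (ord1 i) /ball /=.
  apply: lt_trans en.
  rewrite -(subrK (ratr (q j)) (F t 0 j)) -addrA.
  apply: le_lt_trans (ler_normD _ _) _; rewrite (mulrDl 1 1) mul1r ltrD //.
    by rewrite distrC.
  by have := qy j; rewrite mxE.
apply: countable_bigcupT_measurable => // q; rewrite /B; case: ifP => // _.
have -> : F @^-1` box q =
    \bigcap_(i in [set: 'I_d]) [set t | `|ratr (q.1 0 i) - F t 0 i| < q.2.+1%:R^-1].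
  by apply/seteqP; split => [t h i _|t h i]; [exact: h|exact: (h i)].
apply: fin_bigcap_measurable => // i _.
have mg : measurable_fun setT (fun t => `|ratr (q.1 0 i) - F t 0 i|).
  by apply: measurableT_comp => //; apply: measurable_funB.
rewrite -[X in measurable X]setTI.
rewrite (_ : [set t | _] = (fun t => `|ratr (q.1 0 i) - F t 0 i|) @^-1`
    `]-oo, q.2.+1%:R^-1[%classic); first exact: mg.
by apply/seteqP; split => t; rewrite /= in_itv.
Qed.

End borel_measurability.

(** * Iterated integrals and product formulas for the standard Gaussian law *)

Section std_gaussian.
Variable R : realType.
Local Notation Rm := (measurableTypeR R).
Local Notation N01 := (normal_prob (0 : R) 1).
Local Notation gamma := (std_gaussian R).

Lemma Rintegral_std_gaussianS n (f : n.+1.-tuple Rm -> R) :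
  measurable_fun setT f -> bdd f ->
  \int[gamma n.+1]_z f z = \int[N01]_z \int[gamma n]_zs f [tuple of z :: zs].
Proof.
move=> mf bf; rewrite /Rintegral; congr fine.
have mfc : measurable_fun setT (f \o @Defs.cons_tuple R n).
  by apply: measurableT_comp.
have bfc : bdd (f \o @Defs.cons_tuple R n) by case: bf => M fM; exists M => x; exact: fM.
have -> : gamma n.+1 = distribution (N01 \x gamma n)%E (@Defs.cons_tuple R n).
  by [].
have If : (N01 \x gamma n)%E.-integrable setT
    (EFin \o (f \o @Defs.cons_tuple R n)).
  apply: measurable_bounded_integrable => //; last exact: bdd_bounded_fun.
  rewrite -setXTT [ltLHS]product_measure1E // lte_mul_pinfty //.
    by rewrite fin_num_measure.
  by rewrite -ge0_fin_numE // fin_num_measure.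
rewrite integral_pushforward //; last exact/measurable_EFinP.
rewrite preimage_setT -integral12_prod_meas1 //.
apply: eq_integral => z _; rewrite /fubini_F /= fineK //.
apply: (@integral_bdd_fin_num _ _ _ (gamma n) (fun zs => f [tuple of z :: zs])).
  exact: (measurableT_comp mfc (pair1_measurable z)).
by case: bf => M fM; exists M => x; exact: fM.
Qed.

Lemma Rintegral_std_gaussian0 (f : 0.-tuple Rm -> R) :
  measurable_fun setT f -> \int[gamma 0]_z f z = f [tuple].
Proof.
move=> mf; rewrite /Rintegral integral_dirac //; last exact/measurable_EFinP.
by rewrite diracT mul1e.
Qed.

Lemma measurable_cos_tuple n (a : R) (b : 'I_n -> R) :
  measurable_fun setT (fun z : n.-tuple Rm => cos (a + \sum_i b i * tnth z i)).
Proof.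
apply: measurableT_comp; first exact: measurable_cos.
apply: measurable_funD => //; apply: measurable_sum => i.
by apply: measurable_funM => //; exact: measurable_tnth.
Qed.

(** Induction on the dimension: the first coordinate is absorbed into the phase for the inner
    integral, which is why [a] is arbitrary. *)
Lemma Rintegral_cos_std_gaussian n (a : R) (b : 'I_n -> R) :
  \int[gamma n]_z cos (a + \sum_i b i * tnth z i) =
  expR (- (\sum_i b i ^+ 2) / 2) * cos a.
Proof.
elim: n a b => [|n IH] a b.
  rewrite Rintegral_std_gaussian0; last exact: measurable_cos_tuple.
  by rewrite !big_ord0 addr0 oppr0 mul0r expR0 mul1r.
rewrite Rintegral_std_gaussianS; first last.
- by exists 1 => z; exact: cos_norm_le1.
- exact: measurable_cos_tuple.
under eq_Rintegral => z _.
  under eq_Rintegral => zs _.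
    rewrite big_ord_recl tnth0 addrA.
    under eq_bigr do rewrite tnthS.
    over.
  rewrite IH; over.
rewrite RintegralZl //; last first.
  apply: bdd_integrable; first exact: measurable_cosD.
  by exists 1 => z; exact: cos_norm_le1.
rewrite integral_cos_normal_prob01 mulrA -expRD big_ord_recl; congr (expR _ * _).
by field.
Qed.

Lemma bdd_prod n (T : Type) (g : 'I_n -> T -> R) :
  (forall i, bdd (g i)) -> bdd (fun x => \prod_i g i x).
Proof.
move=> /choice[M gM]; exists (\prod_i M i) => x; rewrite normr_prod.
by apply: ler_prod => i _; rewrite normr_ge0 gM.
Qed.

Lemma Rintegral_prod_std_gaussian n (g : 'I_n -> R -> R) :
  (forall i, measurable_fun setT (g i)) -> (forall i, bdd (g i)) ->
  \int[gamma n]_z (\prod_i g i (tnth z i)) = \prod_i \int[N01]_z g i z.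
Proof.
have mp k (h : 'I_k -> R -> R) : (forall i, measurable_fun setT (h i)) ->
    measurable_fun setT (fun z : k.-tuple Rm => \prod_i h i (tnth z i)).
  move=> mh; apply: measurable_prod => i _.
  apply: (measurableT_comp (mh i)); exact: measurable_tnth.
elim: n g => [|n IH] g mg bg.
  by rewrite Rintegral_std_gaussian0 ?big_ord0 //; exact: mp.
rewrite Rintegral_std_gaussianS; first last.
- apply: (@bdd_prod _ _ (fun i (z : n.+1.-tuple Rm) => g i (tnth z i))) => i.
  by case: (bg i) => M gM; exists M => z; exact: gM.
- exact: mp.
have mL i : measurable_fun setT (g (lift ord0 i)) by exact: mg.
have bL i : bdd (g (lift ord0 i)) by exact: bg.
under eq_Rintegral => z _.
  under eq_Rintegral => zs _.
    rewrite big_ord_recl tnth0.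
    under eq_bigr do rewrite tnthS.
    over.
  rewrite RintegralZl //; last first.
    apply: bdd_integrable; first exact: (mp _ (fun i => g (lift ord0 i))).
    apply: (@bdd_prod _ _ (fun i (z : n.-tuple Rm) => g (lift ord0 i) (tnth z i))).
    by move=> i; case: (bL i) => M gM; exists M => zs; exact: gM.
  rewrite (IH (fun i => g (lift ord0 i))) //; over.
rewrite RintegralZr ?big_ord_recl //.
exact: (@bdd_integrable _ (measurableTypeR R) R N01 _ (mg ord0) (bg ord0)).
Qed.

End std_gaussian.

(** * The Brownian semigroup and the pairing *)

Section growth_semigroup.
Variables (R : realType) (d : nat).
Local Notation Rm := (measurableTypeR R).
Local Notation gamma := (std_gaussian R d).
Local Notation E := (euclidean R d).
Implicit Types (f g : 'rV[R]_d -> R) (t s : R) (x : 'rV[R]_d).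

Definition gshift t x (z : d.-tuple Rm) : 'rV[R]_d :=
  x + Num.sqrt t *: \row_i tnth z i.

(** Real-valued form of [heat_growth]; [heat_growthE] identifies the two on bounded Borel
    functions. *)
Definition growth (beta t : R) f x : R :=
  expR (beta * t) * \int[gamma]_z f (gshift t x z).

Lemma measurable_coord dT (T : measurableType dT) (a : T -> E) i :
  measurable_fun setT a -> measurable_fun setT (fun p => (a p : 'rV_d) 0 i).
Proof.
move=> ma; apply: (measurableT_comp (f := fun x : E => (x : 'rV[R]_d) 0 i)) => //.
apply: (@continuous_borel_measurable R 'rV[R]_d (fun x => x 0 i)).
exact: coord_continuous.
Qed.

Lemma measurable_gshift dT (T : measurableType dT) (b : T -> R) (a : T -> E) :
  measurable_fun setT b -> measurable_fun setT a ->
  measurable_fun setT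
    (fun p : T * d.-tuple Rm => gshift (b p.1) (a p.1) p.2 : E).
Proof.
move=> mb ma; apply: measurable_fun_euclidean => i.
rewrite (_ : (fun _ => _) = fun p : T * d.-tuple Rm =>
    (a p.1 : 'rV_d) 0 i + Num.sqrt (b p.1) * tnth p.2 i); last first.
  by apply/funext => p; rewrite /gshift !mxE.
apply: measurable_funD.
  by apply: measurable_coord; exact: measurableT_comp.
apply: measurable_funM.
  apply: measurableT_comp; last exact: measurableT_comp.
  by apply: continuous_measurable_fun; exact: sqrt_continuous.
by apply: (measurableT_comp (@measurable_tnth _ _ _ i)).
Qed.

Lemma measurable_gshift1 t x : measurable_fun setT (gshift t x : d.-tuple Rm -> E).
Proof.
have h := @measurable_gshift _ Rm (cst t) (cst x) (measurable_cst _) (measurable_cst _).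
exact: (measurableT_comp h (pair1_measurable (0 : Rm))).
Qed.

Lemma measurable_gauss_mean dT (T : measurableType dT) (F : T -> d.-tuple Rm -> R) :
  (forall p z, 0 <= F p z) ->
  measurable_fun setT (fun q : T * d.-tuple Rm => F q.1 q.2) ->
  measurable_fun setT (fun p => \int[gamma]_z F p z).
Proof.
move=> F0 mF; apply: measurableT_comp => //.
apply: (@measurable_fun_fubini_tonelli_F _ _ _ _ _ gamma
  (fun q : T * d.-tuple Rm => (F q.1 q.2)%:E)).
- exact/measurable_EFinP.
- by move=> q; rewrite lee_fin.
Qed.

Section one_time.
Variables (beta t : R).

Lemma measurable_fun_gshift f x : measurable_fun setT (f : E -> R) ->
  measurable_fun setT (f \o gshift t x).
Proof. by move=> mf; apply: (measurableT_comp mf); exact: measurable_gshift1. Qed.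

Lemma integrable_gshift f x : measurable_fun setT (f : E -> R) -> bdd f ->
  gamma.-integrable setT (EFin \o (f \o gshift t x)).
Proof.
move=> mf [M fM]; apply: bdd_integrable; first exact: measurable_fun_gshift.
by exists M => z; exact: fM.
Qed.

Lemma heat_growthE f x : measurable_fun setT (f : E -> R) -> bdd f ->
  heat_growth beta t (fun y => (f y)%:E) x = (growth beta t f x)%:E.
Proof.
move=> mf bf; rewrite /heat_growth /growth EFinM /heat /Rintegral fineK //.
by apply: integrable_fin_num => //; exact: integrable_gshift.
Qed.

Lemma growth_ge0 f x : (forall y, 0 <= f y) -> 0 <= growth beta t f x.
Proof. by move=> f0; rewrite mulr_ge0 ?expR_ge0 //; exact: Rintegral_ge0. Qed.

Lemma growthD f g x : measurable_fun setT (f : E -> R) -> bdd f ->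
  measurable_fun setT (g : E -> R) -> bdd g ->
  growth beta t (fun y => f y + g y) x = growth beta t f x + growth beta t g x.
Proof.
move=> mf bf mg bg; rewrite /growth -mulrDr; congr (_ * _).
exact: (RintegralD measurableT (integrable_gshift x mf bf) (integrable_gshift x mg bg)).
Qed.

Lemma growthZ c f x : measurable_fun setT (f : E -> R) -> bdd f ->
  growth beta t (fun y => c * f y) x = c * growth beta t f x.
Proof.
move=> mf bf; rewrite /growth mulrCA; congr (_ * _).
exact: (RintegralZl c measurableT (integrable_gshift x mf bf)).
Qed.

Lemma growth_cst c x : growth beta t (fun=> c) x = c * expR (beta * t).
Proof.
rewrite /growth mulrC; congr (_ * _).
exact: Rintegral_probability_cst.
Qed.

Lemma growth_norm_le f M x : measurable_fun setT (f : E -> R) ->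
  (forall y, `|f y| <= M) -> `|growth beta t f x| <= expR (beta * t) * M.
Proof.
move=> mf fM; rewrite normrM ger0_norm ?expR_ge0 // ler_wpM2l ?expR_ge0 //.
exact: (Rintegral_probability_le gamma (measurable_fun_gshift x mf) (fun z => fM _)).
Qed.

End one_time.

(** Cosine waves are eigenfunctions of the semigroup: the Gaussian integral with coefficients
    [sqrt s * l_i] gives [exp(- s |l|^2 / 2)], and with [exp(beta s)] this is the factor in
    [rho]. *)
Lemma growth_cos (beta s a : R) (l x : 'rV[R]_d) : 0 <= s ->
  growth beta s (fun y => cos (inner l y + a)) x =
  expR (rho beta l * s) * cos (inner l x + a).
Proof.
move=> s0; rewrite /growth.
under eq_Rintegral => z _.
  rewrite (_ : _ + a = (inner l x + a) +
    \sum_i (Num.sqrt s * l 0 i) * tnth z i); last first.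
    rewrite /inner addrAC; congr (_ + _); rewrite -big_split /=.
    by apply: eq_bigr => i _; rewrite !mxE mulrDr mulrCA mulrA.
  over.
rewrite Rintegral_cos_std_gaussian mulrA -expRD; congr (expR _ * _).
under eq_bigr do rewrite exprMn sqr_sqrtr //.
rewrite -big_distrr /= /rho /inner.
under [in RHS]eq_bigr do rewrite -expr2.
by field.
Qed.

(** Time, base point and test function may all depend on the parameter, as in the integrands over
    [s] of the mild equation. Non-negativity lets Tonelli do the work. *)
Lemma measurable_growth (beta : R) dT (T : measurableType dT)
    (b : T -> R) (a : T -> E) (g : T -> 'rV[R]_d -> R) :
  measurable_fun setT b -> measurable_fun setT a ->
  measurable_fun setT (fun p : T * E => g p.1 p.2) ->
  (forall p y, 0 <= g p y) ->
  measurable_fun setT (fun p => growth beta (b p) (g p) (a p)).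
Proof.
move=> mb ma mg g0; apply: measurable_funM.
  by apply: measurableT_comp => //; exact: measurable_funM.
apply: measurable_gauss_mean => [p z|]; first exact: g0.
apply: (measurableT_comp mg (g := fun q : T * d.-tuple Rm =>
  (q.1, gshift (b q.1) (a q.1) q.2 : E))).
by apply: measurable_fun_pair => //; exact: measurable_gshift.
Qed.

End growth_semigroup.

Section pairing_lemmas.
Variables (R : realType) (d : nat).
Local Notation E := (euclidean R d).
Implicit Types (mu : MF R d) (f g : 'rV[R]_d -> R).

Definition cbdd f := continuous f /\ bdd f.

Lemma cbdd_measurable f : cbdd f -> measurable_fun setT (f : E -> R).
Proof. by move=> [cf _]; exact: continuous_borel_measurable. Qed.

Lemma pairing_integrable mu f : measurable_fun setT (f : E -> R) -> bdd f ->
  (mu : {finite_measure set E -> \bar R}).-integrable setT (EFin \o f).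
Proof. by move=> mf bf; exact: bdd_integrable. Qed.

Lemma pairingD mu f g : measurable_fun setT (f : E -> R) -> bdd f ->
  measurable_fun setT (g : E -> R) -> bdd g ->
  pairing mu (fun y => f y + g y) = pairing mu f + pairing mu g.
Proof.
by move=> mf bf mg bg; rewrite /pairing RintegralD //; exact: pairing_integrable.
Qed.

Lemma pairingZ mu c f : measurable_fun setT (f : E -> R) -> bdd f ->
  pairing mu (fun y => c * f y) = c * pairing mu f.
Proof.
by move=> mf bf; rewrite /pairing RintegralZl //; exact: pairing_integrable.
Qed.

Lemma pairing_ge0 mu f : (forall y, 0 <= f y) -> 0 <= pairing mu f.
Proof. by move=> f0; exact: Rintegral_ge0. Qed.

Lemma pairing_delta x f : measurable_fun setT (f : E -> R) ->
  pairing (delta x) f = f x.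
Proof.
move=> mf; rewrite /pairing /Rintegral integral_dirac //; last exact/measurable_EFinP.
by rewrite diracT mul1e.
Qed.

(** The topology of [MF] is initial for the map to the pointwise topology, and this function is one
    coordinate of that map. *)
Lemma pairing_continuous f : cbdd f -> continuous (fun mu : MF R d => pairing mu f).
Proof.
move=> [cf bf].
have h : continuous (fun g : {ptws bounded_continuous R d -> R} =>
    g (exist _ f (conj cf (bdd_bounded_fun bf)))).
  exact: proj_continuous.
pose F (mu : MF R d) : {ptws bounded_continuous R d -> R} :=
  (fun g : bounded_continuous R d => pairing mu (sval g)).
have hi : continuous F by exact: initial_continuous.
by move=> mu; exact: (cvg_comp _ _ (hi mu) (h (F mu))).
Qed.

Lemma pairing_measurable f : cbdd f ->
  measurable_fun setT ((fun mu => pairing mu f) : borel (MF R d) -> R).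
Proof.
move=> cf; apply: continuous_borel_measurable; exact: pairing_continuous.
Qed.

End pairing_lemmas.

(** * Moments from Laplace transforms *)

Section exponential_bounds.
Variable R : realType.
Implicit Types x : R.

Lemma is_derive_ge0_ge0 (f f' : R -> R) x :
  (forall y : R, is_derive y 1 f (f' y)) -> (forall y, 0 <= y -> 0 <= f' y) ->
  0 <= f 0 -> 0 <= x -> 0 <= f x.
Proof.
move=> df f'0 f0 x0.
have cf : {within `[0, x], continuous f}.
  apply: continuous_subspaceT => y.
  by apply/differentiable_continuous/derivable1_diffP; have [] := df y.
have [c] := MVT_segment x0 (fun y _ => df y) cf.
rewrite in_itv/= subr0 => /andP[c0 _] e.
by rewrite -(subrK (f 0) (f x)) e addr_ge0 // mulr_ge0 // f'0.
Qed.

Lemma expRN_le2 x : 0 <= x -> expR (- x) <= 1 - x + x ^+ 2 / 2.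
Proof.
move=> x0; rewrite -subr_ge0.
apply: (@is_derive_ge0_ge0 (fun x => 1 - x + x ^+ 2 / 2 - expR (- x))
  (fun x => expR (- x) - (1 - x))) => //.
- by move=> y; apply: is_derive_eq; rewrite /GRing.scale/=; field.
- by move=> y _; rewrite subr_ge0; exact: expR_ge1Dx.
Qed.

(** The derivative of the difference is the gap in [expRN_le2], whose own derivative is the gap in
    [1 - x <= expR (- x)]; each bound is integrated from 0. *)
Lemma expRN_ge3 x : 0 <= x -> 1 - x + x ^+ 2 / 2 - x ^+ 3 / 6 <= expR (- x).
Proof.
move=> x0; rewrite -subr_ge0.
apply: (@is_derive_ge0_ge0
  (fun x => expR (- x) - (1 - x + x ^+ 2 / 2 - x ^+ 3 / 6))
  (fun x => 1 - x + x ^+ 2 / 2 - expR (- x))) => //.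
- by move=> y; apply: is_derive_eq; rewrite /GRing.scale/=; field.
- by move=> y y0; rewrite subr_ge0; exact: expRN_le2.
- by rewrite oppr0 expR0; lra.
Qed.

Lemma cvg_harmonic_bound (a : R ^nat) (l K : R) :
  (forall n, `|a n - l| <= K * n.+1%:R^-1) -> a @ \oo --> l.
Proof.
move=> h; apply/subr_cvg0/norm_cvg0P.
have c : K * n.+1%:R^-1 @[n --> \oo] --> (0 : R).
  by rewrite -(mulr0 K); apply: cvgMl_tmp; exact: cvg_harmonic.
by apply: (squeeze_cvgr _ (cvg_cst 0) c); near=> n; rewrite normr_ge0 h.
Unshelve. all: by end_near. Qed.

End exponential_bounds.

Section laplace_moments.
Context dT (T : measurableType dT) (R : realType) (P : probability T R).

Lemma integral_lim_below (g : (T -> R)^nat) (G : T -> R) (a : R ^nat) (l : R) :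
  (forall n, measurable_fun setT (g n)) -> measurable_fun setT G ->
  (forall n w, 0 <= g n w <= G w) -> (forall w, g ^~ w @ \oo --> G w) ->
  (forall n, (\int[P]_w (g n w)%:E = (a n)%:E)%E) -> a @ \oo --> l ->
  (\int[P]_w (G w)%:E = l%:E)%E.
Proof.
move=> mg mG g0G gG ga al.
have ael : (a n)%:E @[n --> \oo] --> l%:E by apply: cvg_EFin => //; exact: nearW.
have G0 w : 0 <= G w by have /andP[] := g0G 0%N w; exact: le_trans.
apply/eqP; rewrite eq_le; apply/andP; split.
- have -> : (\int[P]_w (G w)%:E = \int[P]_w limn_einf (fun n => (g n w)%:E))%E.
    apply: eq_integral => w _; apply/esym.
    have h : (g n w)%:E @[n --> \oo] --> (G w)%:E.
      by apply: cvg_EFin; [exact: nearW|exact: gG].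
    by rewrite (cvg_limn_einf_sup h).1.
  apply: (@le_trans _ _ (limn_einf (fun n => \int[P]_w (g n w)%:E)%E)).
    apply: fatou => //.
    + by move=> n; exact/measurable_EFinP.
    + by move=> n w _; rewrite lee_fin; have /andP[] := g0G n w.
  by under eq_fun do rewrite ga; rewrite (cvg_limn_einf_sup ael).1.
- rewrite -(cvg_lim _ ael) //; apply: lime_le; first by apply/cvg_ex; exists l%:E.
  apply: nearW => n; rewrite -ga; apply: ge0_le_integral => //.
  + by move=> w _; rewrite lee_fin; have /andP[] := g0G n w.
  + exact/measurable_EFinP.
  + exact/measurable_EFinP.
  + by move=> w _; rewrite lee_fin; have /andP[] := g0G n w.
Qed.

Variables (Y : T -> R) (mY : measurable_fun setT Y) (Y0 : forall w, 0 <= Y w).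
Variables (v : R ^nat) (m : R).
Hypothesis v0 : forall n, 0 <= v n.
Hypothesis laplaceE : forall n,
  \int[P]_w expR (- (n.+1%:R^-1 * Y w)) = expR (- v n).

Let th n : R := n.+1%:R^-1.
Let th0 n : 0 < th n. Proof. by rewrite invr_gt0 ltr0n. Qed.
Let th1 n : th n <= 1. Proof. by rewrite invf_le1 ?ltr0n // ler1n. Qed.
Let thY0 n w : 0 <= th n * Y w. Proof. by rewrite mulr_ge0 // ltW. Qed.

Let mE n : measurable_fun setT (fun w => expR (- (th n * Y w))).
Proof.
apply: measurableT_comp => //; apply: measurableT_comp => //.
exact: measurable_funM.
Qed.

Let IE n : P.-integrable setT (fun w => (expR (- (th n * Y w)))%:E).
Proof.
apply: bdd_integrable; first exact: mE.
by exists 1 => w; rewrite ger0_norm ?expR_ge0 // expR_le1 oppr_le0.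
Qed.

Let P1 : (\int[P]_w 1%:E = 1)%E.
Proof. by rewrite integral_cst //= probability_setT mule1. Qed.

Let eE n : (\int[P]_w (expR (- (th n * Y w)))%:E = (expR (- v n))%:E)%E.
Proof.
by rewrite -laplaceE /Rintegral fineK //; apply: integrable_fin_num => //; exact: IE.
Qed.

(** With [th = 1 / (n + 1)], the quotient [(1 - expR (- th Y)) / th] lies between 0 and [Y] and
    tends to [Y]. Its mean is [(1 - expR (- v n)) / th], which tends to [m]. Finiteness of the mean
    is part of the conclusion. *)
Lemma laplace_mean (C : R) :
  (forall n, `|v n - n.+1%:R^-1 * m| <= C * n.+1%:R^-1 ^+ 2) ->
  (\int[P]_w (Y w)%:E = m%:E)%E.
Proof.
move=> vm.
apply: (@integral_lim_below (fun n w => (1 - expR (- (th n * Y w))) / th n) _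
  (fun n => (1 - expR (- v n)) / th n)).
- by move=> n; apply: measurable_funM => //; exact: measurable_funB.
- exact: mY.
- move=> n w; rewrite divr_ge0 ?(ltW (th0 _)) //=; last first.
    by rewrite subr_ge0 expR_le1 oppr_le0.
  rewrite ler_pdivrMr // [leRHS]mulrC.
  by have := expR_ge1Dx (- (th n * Y w)); lra.
- move=> w; apply: (@cvg_harmonic_bound _ _ _ (Y w ^+ 2 / 2)) => n.
  rewrite -/(th n); have := expR_ge1Dx (- (th n * Y w)).
  have := expRN_le2 (thY0 n w); set e := expR _; rewrite exprMn => e2 e1.
  rewrite (_ : _ - Y w = (1 - e - th n * Y w) / th n); last by field; rewrite gt_eqF.
  rewrite normrM normfV (gtr0_norm (th0 n)) ler_pdivrMr // ler0_norm; last by lra.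
  by lra.
- move=> n; under eq_integral do rewrite mulrC EFinM EFinB.
  rewrite integralZl //; last first.
    by apply: integrableB => //; exact: finite_measure_integrable_cst.
  rewrite integralB //; last exact: finite_measure_integrable_cst.
  by rewrite P1 eE -EFinB -EFinM mulrC.
(* [C] bounds [v n / th - m] up to a factor [th]; the other term is the Taylor remainder
   [v ^ 2 / (2 th)], with [v n <= th * (|m| + C)]. *)
- apply: (@cvg_harmonic_bound _ _ _ (C + (`|m| + C) ^+ 2 / 2)) => n.
  rewrite -/(th n); have {vm} := vm n; rewrite -/(th n) ler_norml => /andP[vm1 vm2].
  have := expR_ge1Dx (- v n); have := expRN_le2 (v0 n); set e := expR _ => e2 e1.
  rewrite (_ : _ - m = (1 - e - th n * m) / th n); last by field; rewrite gt_eqF.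
  rewrite normrM normfV (gtr0_norm (th0 n)) ler_pdivrMr // ler_norml.
  have C0 : 0 <= C.
    have : 0 <= C * th n ^+ 2 by lra.
    by rewrite pmulr_lge0 // exprn_gt0.
  have vle : v n <= th n * (`|m| + C).
    have := ler_norm m; have := th1 n; have := th0 n; nra.
  have v2 : v n ^+ 2 <= (th n * (`|m| + C)) ^+ 2.
    by rewrite ler_sqr ?nnegrE // (le_trans (v0 n)).
  rewrite exprMn in v2.
  by apply/andP; split; lra.
Qed.

(** Second-order version: [(expR (- th Y) - 1 + th Y) / th ^ 2] lies between 0 and [Y ^ 2 / 2] and
    tends to it. The known mean evaluates the linear term, and the expansion [v = th m - th ^ 2 k]
    leaves [kl + m ^ 2 / 2] in the limit. *)
Lemma laplace_second_moment (k : R ^nat) (kl K : R) :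
  (\int[P]_w (Y w)%:E = m%:E)%E -> 0 <= m ->
  (forall n, v n = n.+1%:R^-1 * m - n.+1%:R^-1 ^+ 2 * k n) ->
  (forall n, 0 <= k n) ->
  (forall n, `|k n - kl| <= K * n.+1%:R^-1) ->
  (\int[P]_w (Y w ^+ 2)%:E = (m ^+ 2 + 2 * kl)%:E)%E.
Proof.
move=> EY m0 vk k0 kK.
have IY : P.-integrable setT (EFin \o Y).
  apply/integrableP; split; first exact/measurable_EFinP.
  under eq_integral => w _ do rewrite /= ger0_norm //.
  by rewrite EY ltry.
suff EY2 : (\int[P]_w (Y w ^+ 2 / 2)%:E = (kl + m ^+ 2 / 2)%:E)%E.
  rewrite (_ : m ^+ 2 + _ = 2 * (kl + m ^+ 2 / 2)); last by field.
  rewrite EFinM -EY2 -ge0_integralZl //.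
  - by apply: eq_integral => w _; rewrite -EFinM; congr EFin; field.
  - by apply/measurable_EFinP; apply: measurable_funM => //; exact: measurable_funX.
  - by move=> w _; rewrite lee_fin divr_ge0 // sqr_ge0.
apply: (@integral_lim_below
    (fun n w => (expR (- (th n * Y w)) - 1 + th n * Y w) / th n ^+ 2) _
    (fun n => (expR (- v n) - 1 + th n * m) / th n ^+ 2)).
- move=> n; apply: measurable_funM => //; apply: measurable_funD => //.
    exact: measurable_funB.
  exact: measurable_funM.
- by apply: measurable_funM => //; exact: measurable_funX.
- move=> n w; rewrite divr_ge0 ?sqr_ge0 //=; last first.
    by have := expR_ge1Dx (- (th n * Y w)); lra.
  rewrite ler_pdivrMr ?exprn_gt0 //.
  have := expRN_le2 (thY0 n w); rewrite exprMn; lra.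
- move=> w; apply: (@cvg_harmonic_bound _ _ _ (Y w ^+ 3 / 6)) => n.
  rewrite -/(th n).
  have := expRN_le2 (thY0 n w); have := expRN_ge3 (thY0 n w).
  set e := expR _; rewrite !exprMn => e3 e2.
  rewrite (_ : _ - Y w ^+ 2 / 2 = (e - 1 + th n * Y w -
    th n ^+ 2 * Y w ^+ 2 / 2) / th n ^+ 2); last by field; rewrite gt_eqF.
  rewrite normrM normfV (ger0_norm (sqr_ge0 (th n))) ler_pdivrMr ?exprn_gt0 //.
  rewrite [leRHS](_ : _ = th n ^+ 3 * Y w ^+ 3 / 6); last by rewrite /=; field.
  by rewrite ler_norml; apply/andP; split; lra.
- move=> n; under eq_integral do rewrite mulrC EFinM EFinD EFinB.
  have I1 : P.-integrable setT (fun w => ((expR (- (th n * Y w)))%:E - 1%:E)%E).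
    by apply: integrableB => //; exact: finite_measure_integrable_cst.
  have I2 : P.-integrable setT (fun w => (th n * Y w)%:E).
    by have := integrableZl measurableT (th n) IY; exact: eq_integrable.
  rewrite integralZl //; last exact: integrableD.
  rewrite integralD // integralB //; last exact: finite_measure_integrable_cst.
  under [X in (_ + X)%E]eq_integral do rewrite EFinM.
  rewrite integralZl // EY P1 eE.
  by exact: (congr1 EFin (mulrC _ _)).
- pose B := kl + K.
  have kB n : k n <= B.
    have := kK n; rewrite -/(th n) ler_norml => /andP[_].
    have K0 : 0 <= K.
      by have := le_trans (normr_ge0 _) (kK n); rewrite -/(th n) pmulr_lge0.
    have := th1 n; rewrite /B; nra.
  apply: (@cvg_harmonic_bound _ _ _ (K + (2 * m * B + B ^+ 2) / 2 + m ^+ 3 / 6)) => n.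
  rewrite -/(th n).
  have := expRN_le2 (v0 n); have := expRN_ge3 (v0 n).
  have vE : v n = th n * m - th n ^+ 2 * k n by exact: vk.
  have vle : v n <= th n * m.
    by rewrite vE lerBlDr lerDl mulr_ge0 // sqr_ge0.
  have v3 : v n ^+ 3 <= th n ^+ 3 * m ^+ 3.
    by rewrite -exprMn lerXn2r ?nnegrE // (le_trans (v0 n)).
  move: (expR (- v n)) => e e3 e2.
  (* Three errors of order [th]: the convergence of [k n], the cubic Taylor remainder of the
     exponential, and the cross terms of [(th m - th ^ 2 k) ^ 2 / 2] beyond [th ^ 2 m ^ 2 / 2]. *)
  rewrite (_ : _ - (kl + _) = (k n - kl) + (e - (1 - v n + v n ^+ 2 / 2)) / th n ^+ 2 +
    th n * (th n * k n ^+ 2 - 2 * m * k n) / 2); last first.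
    by rewrite vE; field; rewrite gt_eqF.
  have h1 := kK n; rewrite -/(th n) in h1.
  have h2 : `|(e - (1 - v n + v n ^+ 2 / 2)) / th n ^+ 2| <= m ^+ 3 / 6 * th n.
    rewrite normrM normfV (ger0_norm (sqr_ge0 (th n))) ler_pdivrMr ?exprn_gt0 //.
    rewrite [leRHS](_ : _ = th n ^+ 3 * m ^+ 3 / 6); last by field.
    by rewrite ler_norml; apply/andP; split; lra.
  have h3 : `|th n * (th n * k n ^+ 2 - 2 * m * k n) / 2| <=
      (2 * m * B + B ^+ 2) / 2 * th n.
    have a1 : 0 <= th n * k n ^+ 2 by rewrite mulr_ge0 ?sqr_ge0 ?ltW.
    have a2 : th n * k n ^+ 2 <= B ^+ 2.
      apply: (@le_trans _ _ (k n ^+ 2)); first by rewrite ler_piMl ?sqr_ge0.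
      by rewrite ler_sqr ?nnegrE // (le_trans (k0 n)).
    have a3 : 0 <= m * k n by rewrite mulr_ge0.
    have a4 : m * k n <= m * B by rewrite ler_wpM2l.
    have a5 : `|th n * k n ^+ 2 - 2 * m * k n| <= 2 * m * B + B ^+ 2.
      by rewrite ler_norml; apply/andP; split; lra.
    rewrite !normrM (gtr0_norm (th0 n)) (@ger0_norm _ 2^-1) //.
    rewrite [leRHS](_ : _ = th n * (2 * m * B + B ^+ 2) / 2); last by field.
    by rewrite ler_wpM2r // ler_wpM2l // ltW.
  have := ler_normD (k n - kl + (e - (1 - v n + v n ^+ 2 / 2)) / th n ^+ 2)
    (th n * (th n * k n ^+ 2 - 2 * m * k n) / 2).
  have := ler_normD (k n - kl) ((e - (1 - v n + v n ^+ 2 / 2)) / th n ^+ 2).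
  lra.
Qed.

End laplace_moments.

(** * First and second moments of super-Brownian motion *)

Section segment_integrals.
Variables (R : realType) (t : R).
Hypothesis t0 : 0 <= t.
Local Notation mu := (@lebesgue_measure R).
Implicit Types f g : R -> R.

Let mI : measurable (`[0, t]%classic : set (measurableTypeR R)).
Proof. exact: measurable_itv. Qed.

Let muI : mu `[0, t] = t%:E.
Proof.
rewrite lebesgue_measure_itv /= lte_fin lt_neqAle t0 andbT EFinN sube0.
by case: eqVneq => [<-|].
Qed.

Lemma segment_integrable f M : measurable_fun setT f ->
  (forall s, 0 <= s <= t -> `|f s| <= M) ->
  mu.-integrable `[0, t] (EFin \o f).
Proof.
move=> mf fM; apply: measurable_bounded_integrable => //.
- by rewrite [X in (X < _)%E]muI ltry.
- exact: measurable_funTS.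
- exists M; split; first by rewrite num_real.
  by move=> z Mz s /=; rewrite in_itv/= => /fM h; exact: le_trans h (ltW Mz).
Qed.

Lemma segment_integral_le f M : measurable_fun setT f ->
  (forall s, 0 <= s <= t -> `|f s| <= M) ->
  `|\int[mu]_(s in `[0, t]) f s| <= M * t.
Proof.
move=> mf fM; have If := segment_integrable mf fM.
apply: le_trans (le_normr_Rintegral mI If) _.
apply: (@le_trans _ _ (\int[mu]_(s in `[0, t]) M)).
  apply: le_Rintegral => //; first exact: integrable_norm.
    by apply: (@segment_integrable (cst M) `|M|).
by rewrite Rintegral_cst // [X in fine X]muI.
Qed.

Lemma segment_integral_dist f g M N D :
  measurable_fun setT f -> (forall s, 0 <= s <= t -> `|f s| <= M) ->
  measurable_fun setT g -> (forall s, 0 <= s <= t -> `|g s| <= N) ->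
  (forall s, 0 <= s <= t -> `|f s - g s| <= D) ->
  `|\int[mu]_(s in `[0, t]) f s - \int[mu]_(s in `[0, t]) g s| <= D * t.
Proof.
move=> mf fM mg gN fgD; rewrite -RintegralB //; last 2 first.
- exact: segment_integrable fM.
- exact: segment_integrable gN.
by apply: segment_integral_le => //; exact: measurable_funB.
Qed.

(** Freezing time outside [[0, t]] turns integrands over the segment into functions measurable and
    bounded on the whole line, although a mild solution is controlled only at non-negative times. *)
Definition clamp (s : R) := Num.max 0 (Num.min t s).

Lemma clamp_itv s : 0 <= clamp s <= t.
Proof. by rewrite /clamp le_max lexx /= ge_max t0 ge_min lexx. Qed.

Lemma clampE s : 0 <= s <= t -> clamp s = s.
Proof.
by move=> /andP[s0 st]; rewrite /clamp (min_idPr st) (max_idPr s0).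
Qed.

Lemma measurable_clamp : measurable_fun setT clamp.
Proof. by apply: measurable_maxr => //; exact: measurable_minr. Qed.

End segment_integrals.

Section mild_solutions.
Variables (R : realType) (d : nat) (alpha beta : R).
Hypotheses (alpha0 : 0 <= alpha) (beta0 : 0 <= beta).
Local Notation mu := (@lebesgue_measure R).
Local Notation E := (euclidean R d).
Local Notation growth := (growth beta).

Variables (f : 'rV[R]_d -> R) (M : R).
Hypotheses (mf : measurable_fun setT (f : E -> R)) (fM : forall y, 0 <= f y <= M).

Let bf : bdd f.
Proof. by exists M => y; have /andP[f0 ?] := fM y; rewrite ger0_norm. Qed.

Lemma growth_itv (s t : R) x : 0 <= s <= t ->
  0 <= growth s f x <= expR (beta * t) * M.
Proof.
move=> /andP[s0 st]; rewrite growth_ge0; last by move=> y; have /andP[] := fM y.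
have M0 : 0 <= M by have /andP[f0 f1] := fM 0; exact: le_trans f1.
apply: le_trans (ler_norm _) _.
apply: (@le_trans _ _ (expR (beta * s) * M)).
  apply: growth_norm_le => // y.
  by have /andP[f0 ?] := fM y; rewrite ger0_norm.
by rewrite ler_wpM2r // ler_expR ler_wpM2l.
Qed.

Lemma measurable_growth_pair :
  measurable_fun setT (fun p : R * E => growth p.1 f p.2).
Proof.
apply: (@measurable_growth R d beta _ _ (fun p : R * E => p.1) (fun p : R * E => p.2)
  (fun _ => f)) => //.
- exact: measurable_fst.
- exact: measurable_snd.
- exact: (measurableT_comp mf measurable_snd).
- by move=> _ y; have /andP[] := fM y.
Qed.

Lemma measurable_growth_slice (s : R) : measurable_fun setT (growth s f : E -> R).
Proof. exact: (measurableT_comp measurable_growth_pair (pair1_measurable s)). Qed.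

Lemma bdd_growth (s : R) : 0 <= s -> bdd (growth s f).
Proof.
move=> s0; exists (expR (beta * s) * M) => y.
have /andP[h0 h1] := @growth_itv s s y (introT andP (conj s0 (lexx s))).
by rewrite ger0_norm.
Qed.

(** The limit, for test functions [th * f] with [th] tending to 0, of the reaction term divided by
    [th ^ 2]: the solution is replaced by its linear part [growth _ f]. *)
Definition lim_reaction t x s :=
  growth (t - clamp t s) (fun y => growth (clamp t s) f y ^+ 2) x.

Let B t := expR (beta * t) * M.

Lemma measurable_lim_reaction t x : 0 <= t -> measurable_fun setT (lim_reaction t x).
Proof.
move=> t0; apply: (@measurable_growth R d beta _ (measurableTypeR R)
  (fun s => t - clamp t s) (cst x) (fun s y => growth (clamp t s) f y ^+ 2)) => //.
- by apply: measurable_funB => //; exact: measurable_clamp.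
- apply: measurable_funX.
  apply: (measurableT_comp (measurable_growth_pair)
    (g := fun p : measurableTypeR R * E => (clamp t p.1, p.2))).
  apply: measurable_fun_pair => //.
  by apply: (measurableT_comp (measurable_clamp t)); exact: measurable_fst.
- by move=> s y; rewrite sqr_ge0.
Qed.

Lemma growth_sqr_bound t s y : 0 <= t -> `|growth (clamp t s) f y ^+ 2| <= B t ^+ 2.
Proof.
move=> t0; have /andP[u0 u1] := growth_itv y (clamp_itv t0 s).
by rewrite ger0_norm ?sqr_ge0 // ler_sqr ?nnegrE // (le_trans u0).
Qed.

Lemma measurable_growth_sqr t s :
  measurable_fun setT ((fun y => growth (clamp t s) f y ^+ 2) : E -> R).
Proof. by apply: measurable_funX; exact: (measurable_growth_slice). Qed.

Lemma expR_subclamp t s : 0 <= t -> expR (beta * (t - clamp t s)) <= expR (beta * t).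
Proof.
move=> t0; rewrite ler_expR ler_wpM2l // gerBl.
by have /andP[] := clamp_itv t0 s.
Qed.

Lemma lim_reaction_bound t x s : 0 <= t ->
  `|lim_reaction t x s| <= expR (beta * t) * B t ^+ 2.
Proof.
move=> t0.
apply: (@le_trans _ _ (expR (beta * (t - clamp t s)) * B t ^+ 2)).
  apply: growth_norm_le; first exact: measurable_growth_sqr.
  by move=> y; exact: growth_sqr_bound.
by rewrite ler_wpM2r ?sqr_ge0 // expR_subclamp.
Qed.

Section solution.
Variable u : R -> 'rV[R]_d -> R.
Hypothesis hu : mild_solution alpha beta f u.

Definition clamped (t s : R) (y : 'rV[R]_d) := u (clamp t s) y.
Local Notation U := clamped.

Lemma measurable_mild_clamp t : 0 <= t ->
  measurable_fun setT (fun p : R * E => U t p.1 p.2).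
Proof.
move=> t0; case: hu => _ mu0 _.
apply: (measurable_comp _ _ mu0 (g := fun p : R * E => (clamp t p.1, p.2))).
- rewrite (_ : [set p : R * E | 0 <= p.1] = fst @^-1` `[0%R, +oo[%classic); last first.
    by apply/seteqP; split => p; rewrite /= in_itv/= andbT.
  rewrite -[X in measurable X]setTI; apply: measurable_fst => //.
- by move=> _ [p _ <-] /=; have /andP[] := clamp_itv t0 p.1.
- apply: measurable_fun_pair => //.
  by apply: (measurableT_comp (measurable_clamp t)); exact: measurable_fst.
Qed.

Lemma measurable_mild_slice t : 0 <= t -> measurable_fun setT (u t : E -> R).
Proof.
move=> t0; have := measurableT_comp (measurable_mild_clamp t0) (pair1_measurable t).
by rewrite /comp /= /clamped clampE ?t0 ?lexx.
Qed.

Lemma mild_le_growth t x : 0 <= t -> u t x <= growth t f x.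
Proof.
move=> t0; case: hu => u0 _ /(_ t x t0).
rewrite heat_growthE // => h; rewrite -lee_fin -h leeDl //.
apply: integral_ge0 => s; rewrite /= in_itv/= => /andP[s0 _].
rewrite /heat_growth mule_ge0 ?lee_fin ?expR_ge0 // /heat; apply: integral_ge0 => z _.
by rewrite lee_fin mulr_ge0 // sqr_ge0.
Qed.

Lemma mild_itv (s t : R) x : 0 <= s <= t -> 0 <= u s x <= expR (beta * t) * M.
Proof.
move=> st; have /andP[s0 _] := st; case: hu => u0 _ _; rewrite u0 //=.
by apply: le_trans (mild_le_growth x s0) _; have /andP[] := growth_itv x st.
Qed.

Definition reaction t x (s : R) := growth (t - clamp t s) (fun y => U t s y ^+ 2) x.

Let measurable_mild_slice_clamp t s : 0 <= t -> measurable_fun setT (U t s : E -> R).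
Proof.
by move=> t0; exact: (measurableT_comp (measurable_mild_clamp t0) (pair1_measurable s)).
Qed.

Lemma measurable_reaction t x : 0 <= t -> measurable_fun setT (reaction t x).
Proof.
move=> t0; apply: (@measurable_growth R d beta _ (measurableTypeR R)
  (fun s => t - clamp t s) (cst x) (fun s y => U t s y ^+ 2)) => //.
- by apply: measurable_funB => //; exact: measurable_clamp.
- by apply: measurable_funX; exact: measurable_mild_clamp.
- by move=> s y; rewrite sqr_ge0.
Qed.

Let sqr_mild_bound t s y : 0 <= t -> `|U t s y ^+ 2| <= (expR (beta * t) * M) ^+ 2.
Proof.
move=> t0; have /andP[u0 u1] := mild_itv y (clamp_itv t0 s).
by rewrite ger0_norm ?sqr_ge0 // ler_sqr ?nnegrE // (le_trans u0).
Qed.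

Lemma reaction_bound t x s : 0 <= t ->
  0 <= reaction t x s <= expR (beta * t) * (expR (beta * t) * M) ^+ 2.
Proof.
move=> t0; rewrite growth_ge0 => [|y]; last by rewrite sqr_ge0.
apply: le_trans (ler_norm _) _.
apply: (@le_trans _ _ (expR (beta * (t - clamp t s)) * (expR (beta * t) * M) ^+ 2)).
  apply: growth_norm_le => [|y]; last exact: sqr_mild_bound.
  by apply: measurable_funX; exact: measurable_mild_slice_clamp.
rewrite ler_wpM2r ?sqr_ge0 // ler_expR ler_wpM2l // gerBl.
by have /andP[] := clamp_itv t0 s.
Qed.

Lemma mild_eq t x : 0 <= t ->
  growth t f x - u t x = alpha * \int[mu]_(s in `[0, t]) reaction t x s.
Proof.
move=> t0; case: hu => _ _ /(_ t x t0); rewrite heat_growthE // => h.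
have Ir := @segment_integrable R t t0 (reaction t x)
  (expR (beta * t) * (expR (beta * t) * M) ^+ 2) (measurable_reaction x t0).
apply: EFin_inj; rewrite EFinB -h addrAC -EFinB subrr add0e.
rewrite EFinM /Rintegral fineK; last first.
  apply: integrable_fin_num => //; apply: Ir => s _.
  by have /andP[r0 r1] := reaction_bound x s t0; rewrite ger0_norm.
rewrite -integralZl //; last first.
  apply: Ir => s _.
  by have /andP[r0 r1] := reaction_bound x s t0; rewrite ger0_norm.
apply: eq_integral => s; rewrite inE /= in_itv/= => sI.
rewrite -EFinM -growthZ; last 2 first.
- by apply: measurable_funX; exact: measurable_mild_slice_clamp.
- by exists ((expR (beta * t) * M) ^+ 2) => y; exact: sqr_mild_bound.
rewrite /clamped clampE // heat_growthE //.
- apply: measurable_funM => //; apply: measurable_funX.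
  by have := @measurable_mild_slice_clamp t s t0; rewrite /clamped clampE.
- exists (alpha * (expR (beta * t) * M) ^+ 2) => y.
  rewrite normrM ger0_norm // ler_wpM2l //.
  by have := @sqr_mild_bound t s y t0; rewrite /clamped clampE.
Qed.

(** The solution is at most linear in [M], hence the reaction is at most quadratic. For [th * f] the
    linearization error is therefore of order [th ^ 2], as the moment lemmas require. *)
Lemma mild_growth_dist t x : 0 <= t ->
  0 <= growth t f x - u t x <=
  alpha * (expR (beta * t) * expR (beta * t) ^+ 2 * t) * M ^+ 2.
Proof.
move=> t0; rewrite subr_ge0 mild_le_growth //= mild_eq // -mulrA ler_wpM2l //.
apply: le_trans (ler_norm _) _.
rewrite [leRHS](_ : _ = expR (beta * t) * (expR (beta * t) * M) ^+ 2 * t); last by ring.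
apply: segment_integral_le => // [|s _]; first exact: measurable_reaction.
by have /andP[r0 r1] := reaction_bound x s t0; rewrite ger0_norm.
Qed.

End solution.

End mild_solutions.

Section sbm_moments.
Variables (R : realType) (d : nat) (alpha beta : R).
Hypotheses (alpha0 : 0 <= alpha) (beta0 : 0 <= beta).
Context (dO : measure_display) (Omega : measurableType dO).
Variables (P : MF R d -> probability Omega R) (X : R -> Omega -> MF R d).
Hypothesis hX : super_brownian_motion alpha beta P X.
Local Notation E := (euclidean R d).
Local Notation growth := (growth beta).
Local Notation leb := (@lebesgue_measure R).

Lemma sbm_pairing_measurable t (f : 'rV[R]_d -> R) : 0 <= t -> cbdd f ->
  measurable_fun setT (fun w => pairing (X t w) f).
Proof.
move=> t0 cf; apply: (measurableT_comp (pairing_measurable cf)).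
exact: (markov_measurable (sbm_markov hX)).
Qed.

Section nonnegative_test_function.
Variables (f : 'rV[R]_d -> R) (M : R).
Hypotheses (cf : cbdd f) (fM : forall y, 0 <= f y <= M).

Let mf : measurable_fun setT (f : E -> R). Proof. exact: cbdd_measurable. Qed.
Let bf : bdd f. Proof. by case: cf. Qed.
Let M0 : 0 <= M. Proof. by have /andP[f0 f1] := fM 0; exact: le_trans f1. Qed.
Let th n : R := n.+1%:R^-1.
Let th0 n : 0 < th n. Proof. by rewrite invr_gt0 ltr0n. Qed.

Let mZ c : measurable_fun setT ((fun y => c * f y) : E -> R).
Proof. exact: measurable_funM. Qed.

Let fMZ n y : 0 <= th n * f y <= th n * M.
Proof.
have /andP[f0 f1] := fM y.
by rewrite mulr_ge0 ?(ltW (th0 n)) //= ler_wpM2l // ltW.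
Qed.

Let sbm_laplace_scaled : exists u : nat -> R -> 'rV[R]_d -> R, forall n,
  mild_solution alpha beta (fun y => th n * f y) (u n) /\
  forall mu (t : R), 0 <= t ->
    \int[P mu]_w expR (- (th n * pairing (X t w) f)) = expR (- pairing mu (u n t)).
Proof.
suff /choice[u hu] : forall n, exists u : R -> 'rV[R]_d -> R,
    mild_solution alpha beta (fun y => th n * f y) u /\
    forall mu (t : R), 0 <= t ->
      \int[P mu]_w expR (- (th n * pairing (X t w) f)) = expR (- pairing mu (u t)).
  by exists u.
move=> n.
have [||y|u [hu _] h] := sbm_laplace hX (f := fun y => th n * f y).
- exact: mZ.
- apply: bdd_bounded_fun; exists (th n * M) => y.
  by have /andP[h0 h1] := fMZ n y; rewrite ger0_norm.
- by have /andP[] := fMZ n y.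
- exists u; split => // mu t t0; rewrite -h //.
  by apply: eq_Rintegral => w _; rewrite pairingZ.
Qed.

Let growth_scaled n t x : growth t (fun y => th n * f y) x = th n * growth t f x.
Proof. exact: growthZ. Qed.

(** The log-Laplace exponent at [th * f] is [th * pairing mu (growth t f)] up to order [th ^ 2], by
    [mild_growth_dist] integrated against the finite measure [mu]. *)
Lemma sbm_mean (mu : MF R d) t : 0 <= t ->
  (\int[P mu]_w (pairing (X t w) f)%:E = (pairing mu (growth t f))%:E)%E.
Proof.
move=> t0; have [u hu] := sbm_laplace_scaled.
pose C := alpha * (expR (beta * t) * expR (beta * t) ^+ 2 * t) * M ^+ 2.
pose m1 := fine ((mu : {finite_measure set E -> \bar R}) setT).
apply: (@laplace_mean _ _ R (P mu) (fun w => pairing (X t w) f)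
  (sbm_pairing_measurable t0 cf) _ (fun n => pairing mu (u n t)) _ _ _ (C * m1)).
- by move=> w; apply: pairing_ge0 => y; have /andP[] := fM y.
- move=> n; have [[u0 _ _] _] := hu n; apply: pairing_ge0 => y; exact: u0.
- by move=> n; have [_ ->] := hu n.
move=> n; have [sn _] := hu n; rewrite -/(th n).
have ub := mild_growth_dist alpha0 beta0 (mZ _) (fMZ n) sn _ t0.
rewrite distrC -pairingZ; last 2 first.
- exact: (measurable_growth_slice beta mf fM t).
- exact: (bdd_growth beta0 mf fM).
rewrite (_ : _ - _ = \int[(mu : {finite_measure set E -> \bar R})]_y
   (th n * growth t f y - u n t y)); last first.
  rewrite /pairing RintegralB //; apply: pairing_integrable.
  - apply: measurable_funM => //; exact: (measurable_growth_slice beta mf fM t).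
  - have [B hB] := bdd_growth beta0 mf fM t0.
    by exists (`|th n| * B) => y; rewrite normrM ler_wpM2l.
  - exact: (measurable_mild_slice sn t0).
  - exists (expR (beta * t) * (th n * M)) => y.
    have tt : 0 <= t <= t by rewrite t0 lexx.
    have /andP[u0 u1] := mild_itv alpha0 beta0 (mZ _) (fMZ n) sn y tt.
    by rewrite ger0_norm.
apply: le_trans (Rintegral_bdd_le (M := C * th n ^+ 2) _ _ _) _.
- apply: measurable_funB; last exact: (measurable_mild_slice sn t0).
  apply: measurable_funM => //; exact: (measurable_growth_slice beta mf fM t).
- move=> y; rewrite -growth_scaled; have /andP[b0 b1] := ub y.
  by rewrite ger0_norm // /C -mulrA -exprMn [M * _]mulrC.
by rewrite mulrAC.
Qed.

Let B t := expR (beta * t) * M.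
Local Notation limr := (lim_reaction beta f).
Let C t := alpha * (expR (beta * t) * expR (beta * t) ^+ 2 * t) * M ^+ 2.

Let B0 t : 0 <= B t. Proof. by rewrite mulr_ge0 ?expR_ge0. Qed.

Let C0 t : 0 <= t -> 0 <= C t.
Proof. by move=> t0; rewrite !mulr_ge0 ?expR_ge0 ?sqr_ge0. Qed.

(** Rate of convergence of the rescaled reaction to [lim_reaction], uniform in [s], so that it
    survives the time integral. *)
Let reaction_cvg n u t x s : 0 <= t ->
  mild_solution alpha beta (fun y => th n * f y) u ->
  `|reaction beta u t x s / th n ^+ 2 - limr t x s| <=
  expR (beta * t) * (2 * B t * C t) * th n.
Proof.
move=> t0 hu.
have fMn := fMZ n; have mfn := mZ (th n).
have um : measurable_fun setT ((fun y => clamped u t s y ^+ 2) : E -> R).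
  apply: measurable_funX; rewrite /clamped.
  by apply: (measurable_mild_slice hu); have /andP[] := clamp_itv t0 s.
have ub y : `|clamped u t s y ^+ 2| <= (expR (beta * t) * (th n * M)) ^+ 2.
  have /andP[u0 u1] := mild_itv alpha0 beta0 mfn fMn hu y (clamp_itv t0 s).
  by rewrite ger0_norm ?sqr_ge0 // ler_sqr ?nnegrE // (le_trans u0).
rewrite distrC.
have msq := measurable_growth_sqr beta mf fM t s.
have -> : limr t x s - reaction beta u t x s / th n ^+ 2 =
    growth (t - clamp t s) (fun y => growth (clamp t s) f y ^+ 2 +
      (- (th n ^+ 2)^-1) * clamped u t s y ^+ 2) x.
  rewrite growthD ?growthZ //.
  - by rewrite /lim_reaction /reaction mulNr mulrC.
  - by exists ((expR (beta * t) * (th n * M)) ^+ 2).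
  - by exists (B t ^+ 2) => y; exact: (growth_sqr_bound beta0 mf fM).
  - exact: measurable_funM.
  - exists (th n ^- 2 * (expR (beta * t) * (th n * M)) ^+ 2) => y.
    rewrite normrM normrN (@ger0_norm _ (th n ^+ 2)^-1) ?invr_ge0 ?sqr_ge0 //.
    by rewrite ler_wpM2l ?invr_ge0 ?sqr_ge0.
apply: (@le_trans _ _ (expR (beta * (t - clamp t s)) * (2 * B t * C t * th n)));
  [apply: growth_norm_le|].
- by apply: measurable_funD => //; exact: measurable_funM.
- move=> y; set b := growth _ f y; set a := clamped u t s y.
  have ct := clamp_itv t0 s; have /andP[c0 c1] := ct.
  have /andP[b0 b1] : 0 <= b <= B t := growth_itv beta0 mf fM y ct.
  have /andP[a0 _] := mild_itv alpha0 beta0 mfn fMn hu y ct.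
  have /andP[] := mild_growth_dist alpha0 beta0 mfn fMn hu y c0.
  rewrite growth_scaled -/b -[u _ _]/a => ab abC.
  have {}abC : th n * b - a <= C t * th n ^+ 2.
    apply: le_trans abC _.
    rewrite exprMn [leLHS](_ : _ = C (clamp t s) * th n ^+ 2); last first.
      by rewrite /C; ring.
    rewrite ler_wpM2r ?sqr_ge0 // /C ler_wpM2r ?sqr_ge0 // ler_wpM2l //.
    have e1 : expR (beta * clamp t s) <= expR (beta * t).
      by rewrite ler_expR ler_wpM2l.
    apply: ler_pM => //; rewrite ?mulr_ge0 ?expR_ge0 ?sqr_ge0 //.
    by apply: ler_pM; rewrite ?expR_ge0 ?sqr_ge0 // ler_sqr ?nnegrE ?expR_ge0.
  (* Difference of squares: the first factor is bounded by [C t] through the linearization error,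
     and the second is at most [2 * B t * th n]. *)
  have e : b ^+ 2 + - (th n ^+ 2)^-1 * a ^+ 2 =
      (th n * b - a) / th n ^+ 2 * (th n * b + a).
    by field; rewrite gt_eqF.
  rewrite e normrM (_ : 2 * B t * C t * th n = C t * (2 * B t * th n)); last by ring.
  apply: ler_pM; rewrite ?normr_ge0 //.
    rewrite ger0_norm; last by rewrite divr_ge0 ?sqr_ge0.
    by rewrite ler_pdivrMr ?exprn_gt0.
  have tb0 : 0 <= th n * b by rewrite mulr_ge0 // ltW.
  rewrite ger0_norm ?addr_ge0 //.
  have : th n * b <= th n * B t by rewrite ler_wpM2l // ltW.
  lra.
- rewrite [leRHS](_ : _ = expR (beta * t) * (2 * B t * C t * th n)); last by ring.
  by rewrite ler_wpM2r ?expR_subclamp // !mulr_ge0 ?C0 // ltW.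
Qed.

(** From a unit mass the log-Laplace exponent is [u n t x] itself, and the mild equation writes it
    as [th * m - th ^ 2 * k n], with [k n] the rescaled reaction integral. *)
Lemma sbm_second_moment (x : 'rV[R]_d) t : 0 <= t ->
  (\int[P (delta x)]_w (pairing (X t w) f ^+ 2)%:E =
   (growth t f x ^+ 2 + 2 * (alpha * \int[leb]_(s in `[0%R, t])
      growth (t - s) (fun y => growth s f y ^+ 2) x))%:E)%E.
Proof.
move=> t0; have [u hu] := sbm_laplace_scaled.
have -> : \int[leb]_(s in `[0%R, t]) growth (t - s) (fun y => growth s f y ^+ 2) x =
    \int[leb]_(s in `[0%R, t]) limr t x s.
  apply: eq_Rintegral => s; rewrite inE /= in_itv/= => st.
  by rewrite /lim_reaction clampE.
have ux n : pairing (delta x) (u n t) = u n t x.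
  by apply: pairing_delta; exact: (measurable_mild_slice (hu n).1 t0).
have tt : 0 <= t <= t by rewrite t0 lexx.
have mr n : measurable_fun setT (fun s => reaction beta (u n) t x s / th n ^+ 2).
  apply: measurable_funM => //.
  exact: (measurable_reaction (hu n).1 x t0).
have rb n s : `|reaction beta (u n) t x s / th n ^+ 2| <=
   expR (beta * t) * (expR (beta * t) * (th n * M)) ^+ 2 / th n ^+ 2.
  rewrite normrM normfV (ger0_norm (sqr_ge0 (th n))) ler_wpM2r ?invr_ge0 ?sqr_ge0 //.
  have /andP[r0 r1] := reaction_bound alpha0 beta0 (mZ _) (fMZ n) (hu n).1 x s t0.
  by rewrite ger0_norm.
apply: (@laplace_second_moment _ _ R (P (delta x)) (fun w => pairing (X t w) f)
  (sbm_pairing_measurable t0 cf) _ (fun n => u n t x) _ _ _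
  (fun n => alpha * \int[leb]_(s in `[0%R, t]) (reaction beta (u n) t x s / th n ^+ 2))
  _ (alpha * (expR (beta * t) * (2 * B t * C t) * t))).
- by move=> w; apply: pairing_ge0 => y; have /andP[] := fM y.
- by move=> n; have [[u0 _ _] _] := hu n; exact: u0.
- by move=> n; rewrite -ux; have [_ ->] := hu n.
- by rewrite sbm_mean // pairing_delta //; exact: (measurable_growth_slice beta mf fM t).
- by have /andP[] := growth_itv beta0 mf fM x tt.
- move=> n.
  have eI : \int[leb]_(s in `[0%R, t]) reaction beta (u n) t x s = th n ^+ 2 *
      \int[leb]_(s in `[0%R, t]) (reaction beta (u n) t x s / th n ^+ 2).
    rewrite -RintegralZl //; last first.
      by apply: (segment_integrable t0 (mr n)) => s _; exact: rb.
    by apply: eq_Rintegral => s _; field; rewrite gt_eqF.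
  have := mild_eq alpha0 beta0 (mZ _) (fMZ n) (hu n).1 x t0.
  rewrite growth_scaled eI => e.
  transitivity (th n * growth t f x - (th n * growth t f x - u n t x)); first ring.
  by rewrite e (mulrCA alpha).
- move=> n; rewrite mulr_ge0 //; apply: Rintegral_ge0 => s _.
  by rewrite divr_ge0 ?sqr_ge0 // growth_ge0 // => y; rewrite sqr_ge0.
move=> n; rewrite -mulrBr normrM (ger0_norm alpha0) -mulrA ler_wpM2l // mulrAC.
apply: (segment_integral_dist t0 (mr n) (fun s _ => rb n s)
  (measurable_lim_reaction beta mf fM x t0)
  (fun s _ => lim_reaction_bound beta0 mf fM x s t0)) => s _.
exact: (reaction_cvg x s t0 (hu n).1).
Qed.

End nonnegative_test_function.
End sbm_moments.

Section reflection.
Variable R : realType.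
Local Notation mu := (@lebesgue_measure R).

(** By uniqueness it suffices to test half-open intervals; reflection moves the closed endpoint to
    the other side, which leaves the length unchanged. *)
Lemma lebesgue_measure_reflect (t : R) (A : set R) : measurable A ->
  pushforward mu ((fun s => t - s) : measurableTypeR R -> measurableTypeR R) A = mu A.
Proof.
have mr : measurable_fun setT ((fun s => t - s) : measurableTypeR R -> measurableTypeR R).
  exact: measurable_funB.
move=> mA; apply/esym/lebesgue_measure_unique => // _ [[a b] _ <-].
rewrite [RHS](_ : _ = mu `[t - b, t - a[%classic); last first.
  rewrite /= /pushforward; congr mu.
  by apply/seteqP; split => s; rewrite /= !in_itv/= => /andP[? ?]; apply/andP; split; lra.
rewrite !lebesgue_measure_itv /= !lte_fin ltrD2l ltrN2.
by case: ifP => // _; rewrite -!EFinB; congr EFin; ring.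
Qed.

Lemma integral_reflect (t : R) (f : R -> R) :
  measurable_fun setT f -> (forall s, 0 <= f s) ->
  \int[mu]_(s in `[0, t]) f (t - s) = \int[mu]_(s in `[0, t]) f s.
Proof.
move=> mf f0; rewrite /Rintegral; congr fine.
have mr : measurable_fun setT ((fun s => t - s) : measurableTypeR R -> measurableTypeR R).
  exact: measurable_funB.
have mI : measurable (`[0, t]%classic : set (measurableTypeR R)).
  exact: measurable_itv.
transitivity (\int[pushforward mu
    ((fun s => (t - s)%R) : measurableTypeR R -> measurableTypeR R)]_(s in `[0%R, t]) (f s)%:E)%E.
  rewrite ge0_integral_pushforward //.
  - congr (integral _ _ _); apply/seteqP.
    by split => s; rewrite /= !in_itv/= => /andP[a b]; apply/andP; split; lra.
  - by apply/measurable_EFinP; exact: measurable_funTS.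
  - by move=> s _; rewrite lee_fin.
by apply: eq_measure_integral => A mA _; exact: lebesgue_measure_reflect.
Qed.

End reflection.

(** * Moments for signed test functions *)

Section signed_moments.
Variables (R : realType) (d : nat) (alpha beta : R).
Hypotheses (alpha0 : 0 <= alpha) (beta0 : 0 <= beta).
Context (dO : measure_display) (Omega : measurableType dO).
Variables (P : MF R d -> probability Omega R) (X : R -> Omega -> MF R d).
Hypothesis hX : super_brownian_motion alpha beta P X.
Local Notation E := (euclidean R d).
Local Notation growth := (growth beta).
Local Notation leb := (@lebesgue_measure R).

Lemma ge0_integrable_fin dT (S : measurableType dT)
    (mu : {measure set S -> \bar R}) (g : S -> R) (l : R) :
  measurable_fun setT g -> (forall w, 0 <= g w) ->
  (\int[mu]_w (g w)%:E = l%:E)%E -> mu.-integrable setT (EFin \o g).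
Proof.
move=> mg g0 e; apply/integrableP; split; first exact/measurable_EFinP.
by under eq_integral => w _ do rewrite /= ger0_norm //; rewrite e ltry.
Qed.

Lemma cbddD_cst (f : 'rV[R]_d -> R) c : cbdd f -> cbdd (fun y => f y + c).
Proof.
move=> [cf [M fM]]; split.
  by move=> y; exact: (cvgD (cf y) (cvg_cst c)).
exists (M + `|c|) => y; apply: le_trans (ler_normD _ _) _.
by rewrite lerD2r.
Qed.

Lemma cbdd_cst c : cbdd (fun _ : 'rV[R]_d => c).
Proof. by split; [exact: cst_continuous|exists `|c|]. Qed.

Section shift.
Variables (f : 'rV[R]_d -> R) (M : R).
Hypotheses (cf : cbdd f) (fM : forall y, `|f y| <= M).

Let M0 : 0 <= M. Proof. exact: le_trans (normr_ge0 _) (fM 0). Qed.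

Let fc (k : R) y : M <= k -> 0 <= f y + k <= M + k.
Proof. by move=> kM; have := fM y; rewrite ler_norml => /andP[? ?]; apply/andP; lra. Qed.

Let pairing_cst_add (mu : MF R d) k :
  pairing mu (fun y => f y + k) = pairing mu f + pairing mu (fun=> k).
Proof.
have [_ bf] := cf; have [_ bk] := cbdd_cst k.
by apply: pairingD => //; exact: cbdd_measurable.
Qed.

Let kM (k : R) (k0 : 0 <= k) : forall y : 'rV[R]_d, 0 <= (fun=> k) y <= k.
Proof. by move=> y; rewrite k0 lexx. Qed.

Let growth_cst_add (s : R) y (k : R) : growth s (fun y => f y + k) y = growth s f y + k * expR (beta * s).
Proof.
have [_ bf] := cf; have [_ bk] := cbdd_cst k.
by rewrite growthD ?growth_cst //; exact: cbdd_measurable.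
Qed.

Let Y t (g : 'rV[R]_d -> R) w := pairing (X t w) g.

Let Ishift (mu : MF R d) t k : 0 <= t -> M <= k ->
  (P mu).-integrable setT (EFin \o Y t (fun y => f y + k)).
Proof.
move=> t0 kM'; have cfk := cbddD_cst k cf.
apply: (ge0_integrable_fin _ _ (sbm_mean alpha0 beta0 hX cfk (fun y => fc y kM') mu t0)).
- exact: (sbm_pairing_measurable hX t0 cfk).
- by move=> w; apply: pairing_ge0 => y; have /andP[] := fc y kM'.
Qed.

Let Icst (mu : MF R d) t k : 0 <= t -> 0 <= k ->
  (P mu).-integrable setT (EFin \o Y t (fun=> k)).
Proof.
move=> t0 k0; have ck := cbdd_cst k.
apply: (ge0_integrable_fin _ _ (sbm_mean alpha0 beta0 hX ck (kM k0) mu t0)).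
- exact: (sbm_pairing_measurable hX t0 ck).
- by move=> w; apply: pairing_ge0.
Qed.

Let Yshift t k : Y t f = (fun w => Y t (fun y => f y + k) w - Y t (fun=> k) w).
Proof. by apply/funext => w; rewrite /Y pairing_cst_add addrK. Qed.

Lemma sbm_pairing_integrable (mu : MF R d) t : 0 <= t ->
  (P mu).-integrable setT (EFin \o (fun w => pairing (X t w) f)).
Proof.
move=> t0; rewrite -/(Y t f) (Yshift t M).
by have := integrableB measurableT (Ishift mu t0 (lexx M)) (Icst mu t0 M0); exact: eq_integrable.
Qed.

(* Squares for a signed [f] are reduced to those for [f + M], [M], [f + 2 M] >= 0. *)
Let Ysqr t : (fun w => Y t f w ^+ 2) = (fun w =>
  2 * Y t (fun y => f y + M) w ^+ 2 + 2 * Y t (fun=> M) w ^+ 2 -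
  Y t (fun y => f y + 2 * M) w ^+ 2).
Proof.
apply/funext => w; rewrite /Y !pairing_cst_add.
rewrite pairingZ //; first ring.
by exists `|M|.
Qed.

Let S (g : 'rV[R]_d -> R) t x := growth t g x ^+ 2 +
  2 * (alpha * \int[leb]_(s in `[0%R, t]) growth (t - s) (fun y => growth s g y ^+ 2) x).

Let Ishift2 (x : 'rV[R]_d) t k : 0 <= t -> M <= k ->
  (P (delta x)).-integrable setT (EFin \o (fun w => Y t (fun y => f y + k) w ^+ 2)) /\
  \int[P (delta x)]_w (Y t (fun y => f y + k) w ^+ 2) = S (fun y => f y + k) t x.
Proof.
move=> t0 kM'; have cfk := cbddD_cst k cf.
have h := sbm_second_moment alpha0 beta0 hX cfk (fun y => fc y kM') x t0.
split; last by rewrite /Rintegral h.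
apply: (ge0_integrable_fin _ _ h).
- by apply: measurable_funX; exact: (sbm_pairing_measurable hX t0 cfk).
- by move=> w; rewrite sqr_ge0.
Qed.

Let Icst2 (x : 'rV[R]_d) t k : 0 <= t -> 0 <= k ->
  (P (delta x)).-integrable setT (EFin \o (fun w => Y t (fun=> k) w ^+ 2)) /\
  \int[P (delta x)]_w (Y t (fun=> k) w ^+ 2) = S (fun=> k) t x.
Proof.
move=> t0 k0; have ck := cbdd_cst k.
have h := sbm_second_moment alpha0 beta0 hX ck (kM k0) x t0.
split; last by rewrite /Rintegral h.
apply: (ge0_integrable_fin _ _ h).
- by apply: measurable_funX; exact: (sbm_pairing_measurable hX t0 ck).
- by move=> w; rewrite sqr_ge0.
Qed.

Let M2 : M <= 2 * M. Proof. by have := M0; lra. Qed.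

Lemma sbm_pairing_sqr_integrable (x : 'rV[R]_d) t : 0 <= t ->
  (P (delta x)).-integrable setT (EFin \o (fun w => pairing (X t w) f ^+ 2)).
Proof.
move=> t0; rewrite (Ysqr t).
have [I1 _] := Ishift2 x t0 (lexx M); have [I2 _] := Icst2 x t0 M0.
have [I3 _] := Ishift2 x t0 M2.
have J1 := integrableZl measurableT 2 I1; have J2 := integrableZl measurableT 2 I2.
by have := integrableB measurableT (integrableD measurableT J1 J2) I3; exact: eq_integrable.
Qed.

(** Both sides are quadratic in [f]. The identity behind [Ysqr] therefore holds for the right-hand
    side too, and the claim follows from the three non-negative cases. *)
Lemma sbm_Rsecond_moment (x : 'rV[R]_d) t : 0 <= t ->
  \int[P (delta x)]_w (pairing (X t w) f ^+ 2) =
  growth t f x ^+ 2 + 2 * (alpha * \int[leb]_(s in `[0%R, t])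
      growth (t - s) (fun y => growth s f y ^+ 2) x).
Proof.
move=> t0; rewrite [LHS](_ : _ = \int[P (delta x)]_w
  (2 * Y t (fun y => f y + M) w ^+ 2 + 2 * Y t (fun=> M) w ^+ 2 -
  Y t (fun y => f y + 2 * M) w ^+ 2)); last first.
  by apply: eq_Rintegral => w _; exact: (congr1 (@^~ w) (Ysqr t)).
have [I1 e1] := Ishift2 x t0 (lexx M); have [I2 e2] := Icst2 x t0 M0.
have [I3 e3] := Ishift2 x t0 M2.
have J1 := integrableZl measurableT 2 I1; have J2 := integrableZl measurableT 2 I2.
rewrite (RintegralB measurableT (integrableD measurableT J1 J2) I3).
rewrite (RintegralD measurableT J1 J2) (RintegralZl 2 measurableT I1).
rewrite (RintegralZl 2 measurableT I2) e1 e2 e3 -[RHS]/(S f t x).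
have mk k : measurable_fun setT ((fun y => f y + k) : E -> R).
  by have := cbddD_cst k cf; exact: cbdd_measurable.
have mc : measurable_fun setT ((fun=> M) : E -> R) by [].
have f1 y := fc y (lexx M); have f2 := kM M0; have f3 y := fc y M2.
have LE (g : 'rV[R]_d -> R) : \int[leb]_(s in `[0%R, t])
    growth (t - s) (fun y => growth s g y ^+ 2) x =
    \int[leb]_(s in `[0%R, t]) lim_reaction beta g t x s.
  apply: eq_Rintegral => s; rewrite inE /= in_itv/= => st.
  by rewrite /lim_reaction clampE.
have SE g : S g t x = growth t g x ^+ 2 +
    2 * (alpha * \int[leb]_(s in `[0%R, t]) lim_reaction beta g t x s).
  exact: (congr1 (fun I => growth t g x ^+ 2 + 2 * (alpha * I)) (LE g)).
(* The quadratic identity is first proved for the integrand at each time, where it reduces to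
   linearity of the semigroup and the value of [growth] on constants. *)
have rs s : lim_reaction beta f t x s =
    2 * lim_reaction beta (fun y => f y + M) t x s +
    2 * lim_reaction beta (fun=> M) t x s -
    lim_reaction beta (fun y => f y + 2 * M) t x s.
  rewrite /lim_reaction.
  have q1 := measurable_growth_sqr beta (mk M) f1 t s.
  have q2 := measurable_growth_sqr beta mc f2 t s.
  have q3 := measurable_growth_sqr beta (mk (2 * M)) f3 t s.
  have b1 : bdd (fun y => growth (clamp t s) (fun y => f y + M) y ^+ 2).
    eexists => y; exact: (growth_sqr_bound beta0 (mk M) f1 s y t0).
  have b2 : bdd (fun y : 'rV[R]_d => growth (clamp t s) (fun=> M) y ^+ 2).
    exists ((expR (beta * t) * M) ^+ 2) => y.
    exact: (@growth_sqr_bound _ _ _ beta0 (fun=> M) M mc f2 t s y t0).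
  have b3 : bdd (fun y => growth (clamp t s) (fun y => f y + 2 * M) y ^+ 2).
    eexists => y; exact: (growth_sqr_bound beta0 (mk (2 * M)) f3 s y t0).
  have mZ c (g : 'rV[R]_d -> R) : measurable_fun setT (g : E -> R) ->
    measurable_fun setT ((fun y => c * g y) : E -> R) by move=> mg; exact: measurable_funM.
  have bZ c (g : 'rV[R]_d -> R) : bdd g -> bdd (fun y => c * g y).
    by move=> [B gB]; exists (`|c| * B) => y; rewrite normrM ler_wpM2l.
  have bD (g h : 'rV[R]_d -> R) : bdd g -> bdd h -> bdd (fun y => g y + h y).
    move=> [B gB] [C hC]; exists (B + C) => y.
    by apply: le_trans (ler_normD _ _) _; exact: lerD.
  rewrite -[X in _ = _ + X]mulN1r -!growthZ // -!growthD //; try by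
    [apply: bZ|apply: mZ|apply: bD; apply: bZ|apply: measurable_funD; apply: mZ].
  apply: (congr1 (fun h => growth (t - clamp t s) h x)); apply/funext => y.
  rewrite !growth_cst_add growth_cst; ring.
have IL (g : 'rV[R]_d -> R) K : measurable_fun setT (g : E -> R) ->
    (forall y, 0 <= g y <= K) ->
    leb.-integrable `[0%R, t] (EFin \o lim_reaction beta g t x).
  move=> mg gK; apply: (segment_integrable t0) => [|s _].
    exact: (measurable_lim_reaction beta mg gK).
  exact: (lim_reaction_bound beta0 mg gK).
have mI : measurable (`[0, t]%classic : set (measurableTypeR R)).
  exact: measurable_itv.
have L1 := IL _ _ (mk M) f1; have L2 := IL _ _ mc f2.
have L3 := IL _ _ (mk (2 * M)) f3.
have K1 := integrableZl mI 2 L1; have K2 := integrableZl mI 2 L2.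
pose J g := \int[leb]_(s in `[0%R, t]) lim_reaction beta g t x s.
have SJ g : S g t x = growth t g x ^+ 2 + 2 * (alpha * J g) by exact: SE.
have JE : J f = 2 * J (fun y => f y + M) + 2 * J (fun=> M) - J (fun y => f y + 2 * M).
  transitivity (\int[leb]_(s in `[0%R, t])
     (2 * lim_reaction beta (fun y => f y + M) t x s +
      2 * lim_reaction beta (fun=> M) t x s -
      lim_reaction beta (fun y => f y + 2 * M) t x s)).
    by apply: eq_Rintegral => s _; exact: rs.
  rewrite (RintegralB mI (integrableD mI K1 K2) L3).
  by rewrite (RintegralD mI K1 K2) (RintegralZl 2 mI L1) (RintegralZl 2 mI L2).
rewrite !SJ JE; move: (J _) (J _) (J _) => i1 i2 i3.
by rewrite !growth_cst_add growth_cst; ring.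
Qed.

End shift.
End signed_moments.

(** * Martingales and a maximal inequality *)

Section simple_function_arguments.
Context dT (T : measurableType dT) dS (S : measurableType dS) (R : realType).
Implicit Types (Z : T -> S).
Import HBNNSimple.

Lemma integral_nnsfun_comp (m : {finite_measure set T -> \bar R}) (D : set T) Z
    (g : {nnsfun S >-> R}) :
  measurable D -> measurable_fun setT Z ->
  (\int[m]_(w in D) (g (Z w))%:E =
   \sum_(k \in range g) k%:E * m (D `&` Z @^-1` (g @^-1` [set k])))%E.
Proof.
move=> mD mZ.
have mgk k : measurable (g @^-1` [set k]) by exact: measurable_sfunP.
have mB k : measurable (Z @^-1` (g @^-1` [set k])).
  by rewrite -[X in measurable X]setTI; exact: mZ.
under eq_integral do rewrite fimfunE -fsumEFin //.
rewrite ge0_integral_fsum //; last 2 first.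
- move=> k; apply/measurable_EFinP/measurable_funM => //.
  apply: measurable_funTS; apply: (measurableT_comp _ mZ).
  exact: measurable_indic.
- by move=> k w _; rewrite EFinM nnfun_muleindic_ge0.
apply: eq_fsbigr => k _.
rewrite (_ : (fun w => _) = (fun w => k%:E * (\1_(Z @^-1` (g @^-1` [set k])) w)%:E)%E); last first.
  by apply/funext => w; rewrite EFinM.
rewrite integralZl //; last first.
  apply: (integrableS measurableT) => //.
  exact: integrable_indic.
by rewrite integral_indic // setIC.
Qed.

(** Orthogonality of [D] to indicators of [Z]-events extends to simple functions of [Z].
    Approximants from below then pass to [g], dominated by [|g (Z w) * D w|], so [g] itself may be
    unbounded. *)
Lemma integral_comp_mul_eq0 (m : {finite_measure set T -> \bar R}) Z (D : T -> R)
    (g : S -> R) :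
  measurable_fun setT Z -> m.-integrable setT (EFin \o D) ->
  (forall B, measurable B -> \int[m]_(w in Z @^-1` B) D w = 0) ->
  measurable_fun setT g -> (forall y, 0 <= g y) ->
  m.-integrable setT (EFin \o (fun w => g (Z w) * D w)) ->
  \int[m]_w (g (Z w) * D w) = 0.
Proof.
move=> mZ ID D0 mg g0 Ig.
have meg : measurable_fun setT (EFin \o g) by exact/measurable_EFinP.
pose a := nnsfun_approx measurableT meg.
have ZB B : measurable B -> measurable (Z @^-1` B).
  by move=> mB; rewrite -[X in measurable X]setTI; exact: mZ.
have a0 n : (\int[m]_w (a n (Z w) * D w)%:E = 0)%E.
  have mB k : measurable (Z @^-1` (a n @^-1` [set k])).
    by apply: ZB; exact: measurable_sfunP.
  have Ik k : m.-integrable setT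
      (fun w => (\1_(Z @^-1` (a n @^-1` [set k])) w * D w)%:E).
    refine (le_integrable measurableT _ _ ID).
    - apply/measurable_EFinP/measurable_funM => //.
      by have /integrableP[/measurable_EFinP] := ID.
    - move=> w _; rewrite /= lee_fin normrM ler_piMl // indicE.
      by case: (_ \in _); rewrite ?normr1 ?normr0.
  rewrite (_ : (fun w => _) = (fun w => \sum_(k <- fset_set (range (a n)))
      (k%:E * (\1_(Z @^-1` (a n @^-1` [set k])) w * D w)%:E))%E); last first.
    apply/funext => w; rewrite fimfunE fsbig_finite //= mulr_suml -sumEFin.
    by apply: eq_bigr => k _; rewrite -mulrA.
  rewrite integral_sum //; last by move=> k; exact: integrableZl.
  rewrite big1 // => k _; rewrite integralZl //.
  have -> : (\int[m]_w (\1_(Z @^-1` (a n @^-1` [set k])) w * D w)%:E = 0)%E.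
    rewrite (_ : (fun w => _) = (EFin \o D) \_ (Z @^-1` (a n @^-1` [set k]))).
      rewrite -integral_mkcond; have : \int[m]_(w in Z @^-1` (a n @^-1` [set k])) D w = 0.
        by apply: D0; exact: measurable_sfunP.
      rewrite /Rintegral => /eqP; rewrite fine_eq0 => [/eqP //|].
      by apply: integrable_fin_num => //; apply: (integrableS measurableT).
    apply/funext => w; rewrite patchE indicE; case: ifP => _.
      by rewrite mul1r.
    by rewrite mul0r.
  by rewrite mule0.
have an w n : `|a n (Z w) * D w| <= `|g (Z w) * D w|.
  rewrite !normrM ler_wpM2r // !ger0_norm // -lee_fin /a nnsfun_approxE.
  by apply: le_approx => // y _; rewrite lee_fin.
have mD : measurable_fun setT D by have /integrableP[/measurable_EFinP] := ID.
have c : (\int[m]_w (a n (Z w) * D w)%:E)%E @[n --> \oo] -->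
    (\int[m]_w (g (Z w) * D w)%:E)%E.
  apply: (@dominated_cvg _ _ _ m setT _ _ _ (fun w => `|(g (Z w) * D w)%:E|%E)).
  - exact: measurableT.
  - move=> n; apply/measurable_EFinP/measurable_funM => //.
    exact: measurableT_comp.
  - move=> w _; apply: cvg_EFin; first exact: nearW.
    apply: cvgM; last exact: cvg_cst.
    have := @cvg_nnsfun_approx _ _ _ _ measurableT _ meg (fun y _ => _) (Z w) I.
    by move=> /(_ (fun y => g0 y)) /fine_cvgP[].
  - by [].
  - exact: integrable_abse.
  - by move=> n w _; rewrite lee_fin.
have c0 : (\int[m]_w (a n (Z w) * D w)%:E)%E @[n --> \oo] --> 0%E.
  by under eq_fun do rewrite a0; exact: cvg_cst.
by rewrite /Rintegral (cvg_unique _ c c0).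
Qed.

End simple_function_arguments.

Section markov_integrals.
Variables (R : realType) (E : ptopologicalType).
Context (dO : measure_display) (Omega : measurableType dO).
Variables (P : E -> probability Omega R) (X : R -> Omega -> E).
Hypothesis hM : homogeneous_markov P X.
Import HBNNSimple.

Lemma history_measurable (t : R) A : history X t A -> measurable A.
Proof.
apply: smallest_sub; first exact: sigma_algebra_measurable.
move=> _ [s [B [s0 st mB ->]]]; rewrite -[X in measurable X]setTI.
exact: (markov_measurable hM).
Qed.

(** The Markov property is given for events; simple functions and two monotone limits, inside and
    outside the kernel, carry it to non-negative functions without integrability. *)
Lemma markov_integral (x : E) (s t : R) A (g : borel E -> R) :
  0 <= s -> 0 <= t -> history X s A ->
  measurable_fun setT g -> (forall y, 0 <= g y) ->
  (\int[P x]_(w in A) (g (X (s + t) w))%:E =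
   \int[P x]_(w in A) \int[P (X s w)]_w' (g (X t w'))%:E)%E.
Proof.
move=> s0 t0 hA mg g0.
have mA := history_measurable hA.
have st0 : 0 <= s + t by rewrite addr_ge0.
have meg : measurable_fun setT (EFin \o g) by exact/measurable_EFinP.
pose a := nnsfun_approx measurableT meg.
have mX r : 0 <= r -> measurable_fun setT (X r : Omega -> borel E).
  by move=> r0; exact: (markov_measurable hM).
have a0 n y : (0 <= (a n y)%:E)%E by rewrite lee_fin.
have homoa y : {homo (fun n => (a n y)%:E) : n k / (n <= k)%N >-> (n <= k)%E}.
  by move=> n k nk; rewrite lee_fin; exact/lefP/nd_nnsfun_approx.
have alim y : limn (fun n => (a n y)%:E) = (g y)%:E.
  by apply/cvg_lim => //; apply: cvg_nnsfun_approx => // z _; rewrite lee_fin.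
have ma n : measurable_fun setT (fun y : borel E => (a n y)%:E) by exact/measurable_EFinP.
pose K n (y : borel E) := (\int[P y]_w' (a n (X t w'))%:E)%E.
have KE n y : K n y = (\sum_(k \in range (a n)) k%:E * P y (X t @^-1` (a n @^-1` [set k])))%E.
  rewrite /K (integral_nnsfun_comp (P y) (a n) measurableT (mX _ t0)).
  by apply: eq_fsbigr => k _; rewrite setTI.
have mk n k : measurable (a n @^-1` [set k]) by exact: measurable_sfunP.
have mPk n k : measurable_fun setT
    (fun y : borel E => k%:E * P y (X t @^-1` (a n @^-1` [set k])))%E.
  by apply: measurable_funeM; exact: (markov_kernel hM).
have mK n : measurable_fun setT (K n).
  rewrite (_ : K n = (fun y => \sum_(k \in range (a n)) k%:E *
    P y (X t @^-1` (a n @^-1` [set k])))%E); last by apply/funext => y; exact: KE.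
  exact: emeasurable_fsum.
have K0 n y : (0 <= K n y)%E by exact: integral_ge0.
have Knd y : {homo (K ^~ y) : n k / (n <= k)%N >-> (n <= k)%E}.
  move=> n k nk; apply: ge0_le_integral => //.
  - exact: (measurableT_comp (ma n) (mX _ t0)).
  - exact: (measurableT_comp (ma k) (mX _ t0)).
  - by move=> w _; exact: homoa.
have Klim y : limn (K ^~ y) = (\int[P y]_w' (g (X t w'))%:E)%E.
  rewrite -monotone_convergence //.
  - by apply: eq_integral => w _; rewrite alim.
  - by move=> n; exact: (measurableT_comp (ma n) (mX _ t0)).
have LE n : (\int[P x]_(w in A) (a n (X (s + t) w))%:E = \int[P x]_(w in A) K n (X s w))%E.
  rewrite (integral_nnsfun_comp (P x) (a n) mA (mX _ st0)).
  under [RHS]eq_integral do rewrite KE.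
  have mc k : measurable_fun A
      (fun w => k%:E * P (X s w) (X t @^-1` (a n @^-1` [set k])))%E.
    by apply: measurable_funTS; exact: (measurableT_comp (mPk n k) (mX _ s0)).
  rewrite ge0_integral_fsum //; last first.
    (* Non-negativity is required at every real [k]; a negative [k] is not a value of the
       approximant, so its preimage is empty and the term is 0. *)
    move=> k w _; have [k0|k0] := leP 0 k; first by rewrite mule_ge0.
    rewrite (_ : _ @^-1` [set k] = set0) ?preimage_set0 ?measure0 ?mule0 //.
    apply/seteqP; split => // y /= ay; have : 0 <= a n y by [].
    by rewrite ay leNgt k0.
  apply: eq_fsbigr => k _.
  rewrite integralZl //; last first.
    refine (le_integrable mA _ _ (finite_measure_integrable_cst (P x) 1 mA)).
      apply: measurable_funTS.
      exact: (measurableT_comp (markov_kernel hM t0 (mk n k)) (mX _ s0)).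
    move=> w _ /=; rewrite gee0_abs // normr1; apply: probability_le1.
    by rewrite -[X in measurable X]setTI; exact: (mX _ t0).
  by congr (_ * _)%E; exact: (markov_property hM).
have -> : (\int[P x]_(w in A) (g (X (s + t) w))%:E =
    limn (fun n => \int[P x]_(w in A) (a n (X (s + t) w))%:E))%E.
  rewrite -monotone_convergence //.
  - by apply: eq_integral => w _; rewrite alim.
  - by move=> n; apply: measurable_funTS; exact: (measurableT_comp (ma n) (mX _ st0)).
transitivity (limn (fun n => \int[P x]_(w in A) K n (X s w)))%E.
  by apply: congr_lim; apply/funext => n; exact: LE.
rewrite -monotone_convergence //.
- by apply: eq_integral => w _; exact: Klim.
- by move=> n; apply: measurable_funTS; exact: (measurableT_comp (mK n) (mX _ s0)).
Qed.

End markov_integrals.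

Section harmonic_martingales.
Variables (R : realType) (d : nat) (alpha beta : R).
Hypotheses (alpha0 : 0 <= alpha) (beta0 : 0 <= beta).
Context (dO : measure_display) (Omega : measurableType dO).
Variables (P : MF R d -> probability Omega R) (X : R -> Omega -> MF R d).
Hypothesis hX : super_brownian_motion alpha beta P X.
Local Notation E := (euclidean R d).
Local Notation growth := (growth beta).
Local Notation leb := (@lebesgue_measure R).

(** Bounds are asked only on bounded time intervals: a wave of high frequency has negative [rho] and
    grows exponentially in time. *)
Record harmonic (H : R -> 'rV[R]_d -> R) : Prop := Harmonic {
  harmonic_cbdd : forall t, cbdd (H t);
  harmonic_measurable : measurable_fun setT (fun p : R * E => H p.1 p.2);
  harmonic_bdd : forall T, exists M, forall t y, 0 <= t <= T -> `|H t y| <= M;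
  harmonic_eq : forall s t y, 0 <= s -> 0 <= t -> growth s (H (t + s)) y = H t y
}.

Variables (H : R -> 'rV[R]_d -> R).
Hypothesis hH : harmonic H.

Definition mart t w := pairing (X t w) (H t).

Lemma measurable_mart t : 0 <= t -> measurable_fun setT (mart t).
Proof. by move=> t0; exact: (sbm_pairing_measurable hX t0 (harmonic_cbdd hH t)). Qed.

Lemma mart_integrable mu t : 0 <= t -> (P mu).-integrable setT (EFin \o mart t).
Proof.
move=> t0; have cf := harmonic_cbdd hH t; have [_ [M fM]] := cf.
exact: (sbm_pairing_integrable alpha0 beta0 hX cf fM).
Qed.

Lemma mart_sqr_integrable x t : 0 <= t ->
  (P (delta x)).-integrable setT (EFin \o (fun w => mart t w ^+ 2)).
Proof.
move=> t0; have cf := harmonic_cbdd hH t; have [_ [M fM]] := cf.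
exact: (sbm_pairing_sqr_integrable alpha0 beta0 hX cf fM).
Qed.

Let markov_pairing mu s t A (g : 'rV[R]_d -> R) K : 0 <= s -> 0 <= t ->
  history X s A -> cbdd g -> (forall y, 0 <= g y <= K) ->
  \int[P mu]_(w in A) pairing (X (s + t) w) g =
  \int[P mu]_(w in A) pairing (X s w) (growth t g).
Proof.
move=> s0 t0 hA cg gK; rewrite /Rintegral; congr fine.
rewrite (markov_integral (sbm_markov hX) mu s0 t0 hA (pairing_measurable cg)).
  by apply: eq_integral => w _; exact: (sbm_mean alpha0 beta0 hX cg gK).
by move=> m; apply: pairing_ge0 => y; have /andP[] := gK y.
Qed.

(** The Markov property and the mean formula apply to the non-negative functions [H (s + t) + M] and
    [M]; harmonicity identifies the image of the first, and subtraction removes the shift. *)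
Lemma mart_history mu s t A : 0 <= s -> 0 <= t -> history X s A ->
  \int[P mu]_(w in A) mart (s + t) w = \int[P mu]_(w in A) mart s w.
Proof.
move=> s0 t0 hA; have st0 : 0 <= s + t by rewrite addr_ge0.
have mA := history_measurable (sbm_markov hX) hA.
have cf := harmonic_cbdd hH (s + t); have [_ [M fM]] := cf.
have M0 : 0 <= M by exact: le_trans (normr_ge0 _) (fM 0).
(* The semigroup multiplies constants by [expR (beta * t)], so this is what the shift [M] becomes
   after time [t]. *)
pose c : R := M * expR (beta * t).
have fc y : 0 <= H (s + t) y + M <= M + M.
  by have := fM y; rewrite ler_norml => /andP[? ?]; apply/andP; lra.
have ck k := @cbdd_cst R d k.
have e1 := markov_pairing mu s0 t0 hA (cbddD_cst M cf) fc.
have e2 := markov_pairing mu (g := fun=> M) s0 t0 hA (ck M)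
  (fun=> introT andP (conj M0 (lexx M))).
have ms : measurable_fun setT (H (s + t) : E -> R) by exact: cbdd_measurable.
have cs := harmonic_cbdd hH s; have [_ bs] := cs.
have gE : growth t (fun y => H (s + t) y + M) = (fun y => H s y + c).
  apply/funext => y; rewrite growthD ?growth_cst ?(harmonic_eq hH) //.
    by case: cf.
  by exists `|M|.
have gM : growth t (fun=> M) = (fun _ : 'rV[R]_d => c).
  by apply/funext => y; exact: growth_cst.
rewrite gE in e1; rewrite gM in e2.
have IA (Y : Omega -> R) : (P mu).-integrable setT (EFin \o Y) ->
  (P mu).-integrable A (EFin \o Y) by apply: integrableS.
have Ic r k : 0 <= r -> (P mu).-integrable A (EFin \o (fun w => pairing (X r w) (fun=> k))).
  by move=> r0; apply: IA; exact: (sbm_pairing_integrable alpha0 beta0 hX (ck k) (fun=> lexx `|k|)).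
have IH r : 0 <= r -> (P mu).-integrable A (EFin \o mart r).
  by move=> r0; apply: IA; exact: mart_integrable.
have split r k : 0 <= r -> \int[P mu]_(w in A) pairing (X r w) (fun y => H r y + k) =
    \int[P mu]_(w in A) mart r w + \int[P mu]_(w in A) pairing (X r w) (fun=> k).
  move=> r0; rewrite -(RintegralD mA (IH _ r0) (Ic _ k r0)).
  apply: eq_Rintegral => w _; apply: pairingD.
  - exact: (cbdd_measurable (harmonic_cbdd hH r)).
  - by have [] := harmonic_cbdd hH r.
  - exact: measurable_cst.
  - by exists `|k|.
rewrite (split _ _ st0) (split _ _ s0) e2 in e1.
exact: addIr e1.
Qed.

Section increments.
Variable x : 'rV[R]_d.
Local Notation Q := (P (delta x)).

Lemma mart_mul_integrable s t : 0 <= s -> 0 <= t ->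
  Q.-integrable setT (EFin \o (fun w => mart s w * mart t w)).
Proof.
move=> s0 t0.
have := integrableD measurableT (mart_sqr_integrable x s0) (mart_sqr_integrable x t0).
move=> I; refine (le_integrable measurableT _ _ I).
  by apply/measurable_EFinP/measurable_funM; exact: measurable_mart.
move=> w _; rewrite /= lee_fin normrM.
rewrite [leRHS]ger0_norm ?addr_ge0 ?sqr_ge0 //.
rewrite -(real_normK (num_real (mart s w))) -(real_normK (num_real (mart t w))).
have := sqr_ge0 (`|mart s w| - `|mart t w|); have := sqr_ge0 (`|mart s w| + `|mart t w|).
rewrite sqrrB sqrrD; lra.
Qed.

(** The increment integrates to 0 over every event of [X s], and [mart s] is a function of [X s].
    Positive and negative parts are treated separately because [integral_comp_mul_eq0] needs a
    sign. *)
Lemma mart_orthogonal s t : 0 <= s -> 0 <= t ->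
  \int[Q]_w (mart s w * (mart (s + t) w - mart s w)) = 0.
Proof.
move=> s0 t0; have st0 : 0 <= s + t by rewrite addr_ge0.
pose D w := mart (s + t) w - mart s w.
pose h (m : MF R d) := pairing m (H s).
have mh : measurable_fun setT (h : borel (MF R d) -> R).
  exact: (pairing_measurable (harmonic_cbdd hH s)).
have mX : measurable_fun setT (X s : Omega -> borel (MF R d)).
  exact: (markov_measurable (sbm_markov hX)).
have ID : Q.-integrable setT (EFin \o D).
  by have := integrableB measurableT (mart_integrable (delta x) st0)
    (mart_integrable (delta x) s0); exact: eq_integrable.
have IhD : Q.-integrable setT (EFin \o (fun w => h (X s w) * D w)).
  have := integrableB measurableT (mart_mul_integrable s0 st0) (mart_mul_integrable s0 s0).
  by apply: eq_integrable => // w _; rewrite /D /= mulrBr.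
have D0 (B : set (borel (MF R d))) : measurable B -> \int[Q]_(w in X s @^-1` B) D w = 0.
  move=> mB; have hA : history X s (X s @^-1` B).
    by apply: sub_sigma_algebra; exists s, B.
  have mA := history_measurable (sbm_markov hX) hA.
  rewrite RintegralB // ?mart_history ?subrr //.
  - by apply: (integrableS measurableT) => //; exact: mart_integrable.
  - by apply: (integrableS measurableT) => //; exact: mart_integrable.
have part (g : MF R d -> R) : measurable_fun setT (g : borel (MF R d) -> R) ->
    (forall m, 0 <= g m) -> (forall m, g m <= `|h m|) ->
    Q.-integrable setT (EFin \o (fun w => g (X s w) * D w)) /\
    \int[Q]_w (g (X s w) * D w) = 0.
  move=> mg g0 gh.
  have Ig : Q.-integrable setT (EFin \o (fun w => g (X s w) * D w)).
    refine (le_integrable measurableT _ _ IhD).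
      apply/measurable_EFinP/measurable_funM.
        exact: (measurableT_comp mg mX).
      by have /integrableP[/measurable_EFinP] := ID.
    by move=> w _; rewrite /= lee_fin !normrM ler_wpM2r // ger0_norm.
  split => //; exact: (integral_comp_mul_eq0 mX ID D0 mg g0 Ig).
have [|m|m|I1 e1] := part (fun m => Num.max (h m) 0).
- by apply: measurable_maxr.
- by rewrite le_max lexx orbT.
- by rewrite ge_max ler_norm normr_ge0.
have [|m|m|I2 e2] := part (fun m => Num.max (- h m) 0).
- by apply: measurable_maxr => //; exact: measurableT_comp.
- by rewrite le_max lexx orbT.
- by rewrite ge_max -normrN ler_norm normr_ge0.
transitivity (\int[Q]_w (Num.max (h (X s w)) 0 * D w - Num.max (- h (X s w)) 0 * D w)).
  apply: eq_Rintegral => w _; rewrite -mulrBl; congr (_ * _).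
  rewrite /mart -/(h (X s w)); case: (leP 0 (h (X s w))) => hw.
    by rewrite (max_idPr _) ?subr0 // oppr_le0.
  by rewrite (max_idPl _) ?oppr_ge0 ?sub0r ?opprK // ltW.
by rewrite (RintegralB measurableT I1 I2) e1 e2 subrr.
Qed.

(** Multiplied by [2 * alpha], this is the density in time of the second moment of [mart]. *)
Definition mart_rate r := growth r (fun y => H r y ^+ 2) x.
Local Notation v := mart_rate.

Lemma measurable_mart_rate : measurable_fun setT v.
Proof.
apply: (@measurable_growth R d beta _ (measurableTypeR R) id (cst x)
  (fun r y => H r y ^+ 2)) => //.
- by apply: measurable_funX; exact: (harmonic_measurable hH).
- by move=> r y; rewrite sqr_ge0.
Qed.

Lemma mart_rate_ge0 r : 0 <= v r.
Proof. by apply: growth_ge0 => y; rewrite sqr_ge0. Qed.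

Lemma mart_rate_bdd T : 0 <= T -> exists M, forall r, 0 <= r <= T -> `|v r| <= M.
Proof.
move=> T0; have [M HM] := harmonic_bdd hH T.
exists (expR (beta * T) * M ^+ 2) => r rT; have /andP[r0 rle] := rT.
apply: (@le_trans _ _ (expR (beta * r) * M ^+ 2)).
  apply: growth_norm_le => [|y].
    by apply: measurable_funX; exact: (cbdd_measurable (harmonic_cbdd hH r)).
  rewrite ger0_norm ?sqr_ge0 // -(real_normK (num_real (H r y))).
  by rewrite ler_sqr ?nnegrE ?HM // (le_trans _ (HM _ y rT)).
by rewrite ler_wpM2r ?sqr_ge0 // ler_expR ler_wpM2l.
Qed.

(** Harmonicity turns [growth s (H t)] into [H (t - s)], so the integrand of the moment formula is
    the rate at [t - s]; reversing time puts it at [s]. *)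
Lemma mart_second_moment t : 0 <= t ->
  \int[Q]_w (mart t w ^+ 2) = H 0 x ^+ 2 + 2 * (alpha * \int[leb]_(s in `[0%R, t]) v s).
Proof.
move=> t0; have cf := harmonic_cbdd hH t; have [_ [M fM]] := cf.
rewrite (sbm_Rsecond_moment alpha0 beta0 hX cf fM x t0).
have gE s y : 0 <= s <= t -> growth s (H t) y = H (t - s) y.
  move=> /andP[s0 st]; rewrite -[in H t](subrK s t) (harmonic_eq hH) //.
  by rewrite subr_ge0.
congr (_ ^+ 2 + 2 * (alpha * _)).
  by rewrite -[in RHS](subrr t); apply: gE; rewrite t0 lexx.
rewrite -(integral_reflect t measurable_mart_rate mart_rate_ge0).
apply: eq_Rintegral => s; rewrite inE /= in_itv/= => st.
rewrite /mart_rate; apply: (congr1 (fun h => growth (t - s) h x)); apply/funext => y.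
by congr (_ ^+ 2); exact: gE.
Qed.

(** By orthogonality the squared increment has mean equal to the difference of second moments, that
    is [2 * alpha] times the integral of the rate over the interval. *)
Lemma mart_increment_sqr s t V : 0 <= s -> 0 <= t ->
  (forall r, s <= r <= s + t -> v r <= V) ->
  \int[Q]_w ((mart (s + t) w - mart s w) ^+ 2) <= 2 * (alpha * (V * t)).
Proof.
move=> s0 t0 vV; have st0 : 0 <= s + t by rewrite addr_ge0.
have I1 := mart_sqr_integrable x st0; have I2 := mart_sqr_integrable x s0.
have I3 : Q.-integrable setT (EFin \o (fun w => mart s w * (mart (s + t) w - mart s w))).
  have := integrableB measurableT (mart_mul_integrable s0 st0) (mart_mul_integrable s0 s0).
  by apply: eq_integrable => // w _; rewrite /= mulrBr.
have -> : \int[Q]_w ((mart (s + t) w - mart s w) ^+ 2) =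
    \int[Q]_w (mart (s + t) w ^+ 2) - \int[Q]_w (mart s w ^+ 2).
  rewrite -(RintegralB measurableT I1 I2).
  transitivity (\int[Q]_w (mart (s + t) w ^+ 2 - mart s w ^+ 2 -
      2 * (mart s w * (mart (s + t) w - mart s w)))).
    by apply: eq_Rintegral => w _; ring.
  rewrite (RintegralB measurableT (integrableB measurableT I1 I2)
    (integrableZl measurableT 2 I3)).
  by rewrite (RintegralZl 2 measurableT I3) mart_orthogonal // mulr0 subr0.
rewrite !mart_second_moment // opprD addrACA subrr add0r -!mulrBr.
rewrite ler_wpM2l // ler_wpM2l //.
have [M vM] := mart_rate_bdd st0.
have Iv : leb.-integrable `[0, (s + t)] (EFin \o v).
  exact: (segment_integrable st0 measurable_mart_rate vM).
rewrite Rintegral_itvB ?bnd_simp ?lerDl //.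
have mI : measurable (`]s, (s + t)]%classic : set (measurableTypeR R)).
  exact: measurable_itv.
have muI : leb `]s, (s + t)] = t%:E.
  rewrite lebesgue_measure_itv /= lte_fin ltrDl.
  case: ltP => [_|t0']; first by rewrite -EFinB addrC addKr.
  by congr EFin; apply/eqP; rewrite eq_le t0.
apply: (@le_trans _ _ (\int[leb]_(r in `]s, (s + t)]) V)).
  apply: le_Rintegral => //.
  - apply: (integrableS _ _ _ Iv) => //.
    by move=> r; rewrite /= !in_itv/= => /andP[sr ->]; rewrite (le_trans s0) // ltW.
  - apply: measurable_bounded_integrable => //.
      by rewrite [X in (X < _)%E]muI ltry.
    exists `|V|; split; first by rewrite num_real.
    by move=> z Vz r _ /=; exact: ltW.
  - by move=> r; rewrite /= in_itv/= => /andP[sr rt]; apply: vV; rewrite rt ltW.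
by rewrite Rintegral_cst // [X in fine X]muI.
Qed.

Lemma mart_increment_norm s t V eta : 0 <= s -> 0 <= t -> 0 < eta ->
  (forall r, s <= r <= s + t -> v r <= V) -> 2 * (alpha * (V * t)) <= eta ^+ 2 ->
  (\int[Q]_w (`|mart (s + t) w - mart s w|%:E) <= eta%:E)%E.
Proof.
move=> s0 t0 eta0 vV Veta; have st0 : 0 <= s + t by rewrite addr_ge0.
have IM := mart_mul_integrable s0 st0.
have I1 := mart_sqr_integrable x st0; have I2 := mart_sqr_integrable x s0.
have ID2 : Q.-integrable setT (EFin \o (fun w => (mart (s + t) w - mart s w) ^+ 2)).
  have := integrableB measurableT (integrableD measurableT I1 I2)
    (integrableZl measurableT 2 IM).
  by apply: eq_integrable => // w _; congr EFin; rewrite /=; ring.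
have mD : measurable_fun setT (fun w => mart (s + t) w - mart s w).
  by apply: measurable_funB; exact: measurable_mart.
have J1 := integrableZl measurableT (2 * eta)^-1 ID2.
have Jc : Q.-integrable setT (EFin \o (fun=> eta / 2)).
  exact: (finite_measure_integrable_cst Q (eta / 2) measurableT).
(* Pointwise [|D| <= D ^ 2 / (2 eta) + eta / 2] replaces Cauchy-Schwarz; the two terms contribute at
   most [eta / 2] each. *)
apply: (@le_trans _ _ (\int[Q]_w (((2 * eta)^-1 * (mart (s + t) w - mart s w) ^+ 2) + eta / 2)%:E)%E).
  apply: ge0_le_integral => //.
  - by apply/measurable_EFinP; exact: measurableT_comp.
  - apply/measurable_EFinP; apply: measurable_funD => //; apply: measurable_funM => //.
    exact: measurable_funX.
  - move=> w _; rewrite lee_fin -(real_normK (num_real (_ - _))).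
    set n := `|_|; rewrite -subr_ge0.
    rewrite (_ : _ - n = (n - eta) ^+ 2 / (2 * eta)); last by field; rewrite gt_eqF.
    by rewrite divr_ge0 ?sqr_ge0 // mulr_ge0 // ltW.
have E2 := mart_increment_sqr s0 t0 vV.
rewrite -[leLHS]fineK; last exact: (integrable_fin_num measurableT (integrableD measurableT J1 Jc)).
rewrite lee_fin -[leLHS]/(\int[Q]_w ((2 * eta)^-1 * (mart (s + t) w - mart s w) ^+ 2 + eta / 2)).
rewrite (RintegralD measurableT J1 Jc) (RintegralZl _ measurableT ID2).
rewrite Rintegral_probability_cst.
apply: (@le_trans _ _ ((2 * eta)^-1 * eta ^+ 2 + eta / 2)).
  rewrite lerD2r ler_wpM2l ?invr_ge0 ?mulr_ge0 ?(ltW eta0) //.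
  exact: le_trans E2 Veta.
by rewrite [leLHS](_ : _ = eta) //; field; rewrite gt_eqF.
Qed.

End increments.
End harmonic_martingales.

Section maximal_inequality.
Variables (R : realType) (d : nat) (alpha beta : R).
Hypotheses (alpha0 : 0 <= alpha) (beta0 : 0 <= beta).
Context (dO : measure_display) (Omega : measurableType dO).
Variables (P : MF R d -> probability Omega R) (X : R -> Omega -> MF R d).
Hypothesis hX : super_brownian_motion alpha beta P X.
Local Notation mart := (mart X).
Variable mu : MF R d.
Local Notation Q := (P mu).

(** The sample space with the history up to [t] as its sigma-algebra, so that being adapted is
    ordinary measurability. *)
Definition historyT (t : R) : measurableType _ := g_sigma_algebraType
  [set A : set Omega | exists (s : R) (B : set (borel (MF R d))),
        [/\ 0 <= s, s <= t, measurable B & A = X s @^-1` B]].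

Lemma historyT_mart (H : R -> 'rV[R]_d -> R) (r t : R) : harmonic beta H ->
  0 <= r -> r <= t -> measurable_fun setT (mart H r : historyT t -> R).
Proof.
move=> hH r0 rt.
have mX : measurable_fun setT (X r : historyT t -> borel (MF R d)).
  move=> _ B mB; rewrite setTI; apply: sub_sigma_algebra.
  by exists r, B.
exact: (measurableT_comp (pairing_measurable (harmonic_cbdd hH r)) mX).
Qed.

Section one_martingale.
Variable H : R -> 'rV[R]_d -> R.
Hypothesis hH : harmonic beta H.
Variable s : R.
Hypothesis s0 : 0 <= s.

Definition mincr t w := mart H t w - mart H s w.

Lemma mincr_integrable t : 0 <= t -> Q.-integrable setT (EFin \o mincr t).
Proof.
move=> t0; have := integrableB measurableT (mart_integrable alpha0 beta0 hX hH mu t0)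
  (mart_integrable alpha0 beta0 hX hH mu s0); exact: eq_integrable.
Qed.

Lemma measurable_mincr t : 0 <= t -> measurable_fun setT (mincr t).
Proof. by move=> t0; have /integrableP[/measurable_EFinP] := mincr_integrable t0. Qed.

Lemma historyT_mincr r t : s <= t -> 0 <= r -> r <= t ->
  measurable_fun setT (mincr r : historyT t -> R).
Proof. by move=> st r0 rt; apply: measurable_funB; exact: historyT_mart. Qed.

(** Submartingale property of the absolute increment: [A] is split by the sign of the increment at
    time [t]. On each piece the absolute value is a constant sign times the martingale, whose
    integral is unchanged at [T] and bounded by that of its absolute value. *)
Lemma mincr_norm_history_le t T A : s <= t -> t <= T -> history X t A ->
  (\int[Q]_(w in A) `|mincr t w|%:E <= \int[Q]_(w in A) `|mincr T w|%:E)%E.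
Proof.
move=> st tT hA; have t0 : 0 <= t by exact: le_trans st.
have T0 : 0 <= T by exact: le_trans tT.
have It := mincr_integrable t0; have IT := mincr_integrable T0.
have mt := measurable_mincr t0; have mT := measurable_mincr T0.
have signed (B : set Omega) (sg : R) : history X t B ->
    (forall w, B w -> `|mincr t w| = sg * mincr t w) -> `|sg| = 1 ->
    (\int[Q]_(w in B) `|mincr t w|%:E <= \int[Q]_(w in B) `|mincr T w|%:E)%E.
  move=> hB Bsg sg1; have mB := history_measurable (sbm_markov hX) hB.
  have IB (Y : Omega -> R) : Q.-integrable setT (EFin \o Y) ->
      Q.-integrable B (EFin \o Y) by apply: integrableS.
  have IM r : 0 <= r -> Q.-integrable B (EFin \o mart H r).
    by move=> r0; apply: IB; exact: (mart_integrable alpha0 beta0 hX hH).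
  have eB : \int[Q]_(w in B) mincr t w = \int[Q]_(w in B) mincr T w.
    have Tt0 : 0 <= T - t by rewrite subr_ge0.
    have e := mart_history alpha0 beta0 hX hH mu t0 Tt0 hB.
    rewrite (RintegralB mB (IM _ t0) (IM _ s0)) (RintegralB mB (IM _ T0) (IM _ s0)).
    by rewrite -e [t + _]addrC subrK.
  rewrite -(fineK (integrable_fin_num mB (integrable_norm (IB _ IT)))).
  rewrite -(fineK (integrable_fin_num mB (integrable_norm (IB _ It)))) lee_fin.
  rewrite -[leLHS]/(\int[Q]_(w in B) `|mincr t w|) -[leRHS]/(\int[Q]_(w in B) `|mincr T w|).
  have -> : \int[Q]_(w in B) `|mincr t w| = \int[Q]_(w in B) (sg * mincr t w).
    by apply: eq_Rintegral => w; rewrite inE => /Bsg.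
  rewrite (RintegralZl _ mB (IB _ It)) eB -(RintegralZl _ mB (IB _ IT)).
  apply: le_Rintegral => //.
  - by have := integrableZl mB sg (IB _ IT); exact: eq_integrable.
  - exact: (integrable_norm (IB _ IT)).
  - by move=> w _; rewrite (le_trans (ler_norm _)) // normrM sg1 mul1r.
have hp : history X t (A `&` [set w | 0 <= mincr t w]).
  apply: (@measurableI _ (historyT t)) => //.
  have := historyT_mincr st t0 (lexx t).
  move=> /(_ measurableT `[0%R, +oo[%classic (measurable_itv _)); rewrite setTI.
  by congr measurable; apply/seteqP; split => w; rewrite /= in_itv/= andbT.
have hn : history X t (A `&` [set w | mincr t w < 0]).
  apply: (@measurableI _ (historyT t)) => //.
  have := historyT_mincr st t0 (lexx t).
  move=> /(_ measurableT `]-oo, 0%R[%classic (measurable_itv _)); rewrite setTI.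
  by congr measurable; apply/seteqP; split => w; rewrite /= in_itv/=.
have AE : A = (A `&` [set w | 0 <= mincr t w]) `|` (A `&` [set w | mincr t w < 0]).
  rewrite -setIUr (_ : _ `|` _ = setT) ?setIT //.
  by apply/seteqP; split => // w _ /=; case: (leP 0 (mincr t w)); [left|right].
have dis : [disjoint A `&` [set w | 0 <= mincr t w] & A `&` [set w | mincr t w < 0]].
  apply/disj_setPS => w [[_ /= a1] [_ /= a2]].
  by have := le_lt_trans a1 a2; rewrite ltxx.
have mp := history_measurable (sbm_markov hX) hp.
have mn := history_measurable (sbm_markov hX) hn.
have eU r : measurable_fun setT (mincr r) -> (\int[Q]_(w in A) `|mincr r w|%:E =
    \int[Q]_(w in A `&` [set w | (0 <= mincr t w)%R]) `|mincr r w|%:E +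
    \int[Q]_(w in A `&` [set w | (mincr t w < 0)%R]) `|mincr r w|%:E)%E.
  move=> mr; rewrite {1}AE ge0_integral_setU //.
  apply/measurable_EFinP; apply: measurableT_comp => //; exact: measurable_funTS.
rewrite (eU t) // (eU T) //; apply: leeD.
- apply: (signed _ 1 hp) => [w [_ /= h]|]; last by rewrite normr1.
  by rewrite mul1r ger0_norm.
- apply: (signed _ (-1) hn) => [w [_ /= h]|]; last by rewrite normrN1.
  by rewrite mulN1r ltr0_norm.
Qed.

End one_martingale.

Section family.
Variables (I : finType) (H : I -> R -> 'rV[R]_d -> R).
Hypothesis hH : forall i, harmonic beta (H i).
Variables (s h : R) (K : nat).
Hypotheses (s0 : 0 <= s) (h0 : 0 <= h).

Definition mincr_sum t w := \sum_i `|mincr (H i) s t w|.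

Let tk k : R := s + k%:R * h.
Let stk k : s <= tk k. Proof. by rewrite lerDl mulr_ge0. Qed.
Let tk0 k : 0 <= tk k. Proof. exact: le_trans (stk k). Qed.
Let tk_homo k l : (k <= l)%N -> tk k <= tk l.
Proof. by move=> kl; rewrite lerD2l ler_wpM2r // ler_nat. Qed.

Lemma measurable_mincr_sum t : 0 <= t -> measurable_fun setT (mincr_sum t).
Proof.
move=> t0; apply: measurable_sum => i.
by apply: measurableT_comp => //; exact: measurable_mincr.
Qed.

Let F (a : R) k := [set w | a <= mincr_sum (tk k) w].

Let hF a k l : (k <= l)%N -> history X (tk l) (F a k).
Proof.
move=> kl; have m : measurable_fun setT (mincr_sum (tk k) : historyT (tk l) -> R).
  apply: measurable_sum => i; apply: measurableT_comp => //.
  by apply: historyT_mincr => //; exact: tk_homo.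
have := m measurableT `[a, +oo[%classic (measurable_itv _); rewrite setTI.
by congr measurable; apply/seteqP; split => w; rewrite /= in_itv/= andbT.
Qed.

(** Doob's argument for the sum of absolute increments: the event splits according to the first grid
    time at which the level is reached, and on each piece the submartingale property moves to the
    final time. *)
Lemma maximal_inequality (a : R) : 0 < a ->
  (a%:E * Q [set w | exists2 k, (k <= K)%N & (a <= mincr_sum (s + k%:R * h) w)%R] <=
   \int[Q]_w (mincr_sum (s + K%:R * h) w)%:E)%E.
Proof.
move=> a0.
(* [seqDU (F a) k] is the event that the level is reached at step [k] and at no earlier step, so it
   is known at time [tk k]. *)
have hD k : history X (tk k) (seqDU (F a) k).
  apply: (@measurableD _ (historyT (tk k))); first exact: (hF a (leqnn k)).
  apply: (@bigsetU_measurable _ (historyT (tk k))) => j _.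
  by apply: hF; exact: ltnW.
have mD k : measurable (seqDU (F a) k).
  exact: (history_measurable (sbm_markov hX) (hD k)).
have -> : [set w | exists2 k, (k <= K)%N & a <= mincr_sum (s + k%:R * h) w] =
    \big[setU/set0]_(k < K.+1) seqDU (F a) k.
  rewrite -bigsetU_seqDU; apply/seteqP; split => w.
    move=> [k kK aw]; rewrite -bigcup_mkord; exists k => //=.
  by rewrite -bigcup_mkord => -[k /= kK aw]; exists k.
rewrite (measure_bigsetU Q mD (@trivIset_seqDU _ (F a))).
rewrite ge0_sume_distrr //.
have mN t : 0 <= t -> measurable_fun setT (fun w => (mincr_sum t w)%:E).
  by move=> t0; apply/measurable_EFinP; exact: measurable_mincr_sum.
have N0 t w : (0 <= (mincr_sum t w)%:E)%E by rewrite lee_fin sumr_ge0.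
apply: (@le_trans _ _ (\sum_(k < K.+1) \int[Q]_(w in seqDU (F a) k) (mincr_sum (tk K) w)%:E)%E).
  apply: lee_sum => k _.
  apply: (@le_trans _ _ (\int[Q]_(w in seqDU (F a) k) (mincr_sum (tk k) w)%:E)%E).
    rewrite -integral_cst //; apply: ge0_le_integral => //.
    - by move=> w _; rewrite lee_fin ltW.
    - by apply: measurable_funTS; exact: mN.
    - by move=> w [Fw _]; rewrite lee_fin.
  have eS t : 0 <= t -> (\int[Q]_(w in seqDU (F a) k) (mincr_sum t w)%:E =
      \sum_i \int[Q]_(w in seqDU (F a) k) `|mincr (H i) s t w|%:E)%E.
    move=> t0; under eq_integral do rewrite -sumEFin.
    rewrite ge0_integral_sum // => i; apply/measurable_EFinP; apply: measurableT_comp => //.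
    by apply: measurable_funTS; exact: measurable_mincr.
  rewrite !eS //; apply: lee_sum => i _.
  apply: mincr_norm_history_le => //; apply: tk_homo; rewrite -ltnS; exact: ltn_ord.
rewrite -(big_mkord xpredT (fun k => \int[Q]_(w in seqDU (F a) k) (mincr_sum (tk K) w)%:E)%E).
rewrite -ge0_integral_bigsetU //.
- apply: ge0_subset_integral => //.
  + by apply: bigsetU_measurable => k _.
  + exact: mN.
- exact: iota_uniq.
- by apply: sub_trivIset (@trivIset_seqDU _ (F a)).
- by apply: measurable_funTS; exact: mN.
Qed.

End family.
End maximal_inequality.

(** * Dyadic increments in the frequency *)

Section trigonometric_harmonics.
Variables (R : realType) (d : nat) (beta : R).
Local Notation E := (euclidean R d).

Lemma continuous_sumr (T : topologicalType) (I : finType) (f : I -> T -> R) :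
  (forall i, continuous (f i)) -> continuous (fun y => \sum_i f i y).
Proof.
move=> fc y; apply: (cvg_big add_continuous) => i _; exact: fc.
Qed.

Lemma inner_continuous (l : 'rV[R]_d) : continuous (inner l).
Proof.
apply: continuous_sumr => i y.
apply: (@cvgM _ _ (nbhs y) _ (fun=> l 0 i) (fun z : 'rV[R]_d => z 0 i)).
  exact: cvg_cst.
exact: coord_continuous.
Qed.

Lemma cos_inner_cbdd (l : 'rV[R]_d) (a : R) : cbdd (fun y => cos (inner l y + a)).
Proof.
split; last by exists 1 => y; exact: cos_norm_le1.
move=> y; apply: (@continuous_comp _ _ _ (fun y => inner l y + a) cos).
  apply: (@cvgD _ _ _ (nbhs y) _ (inner l) (fun=> a)); first exact: inner_continuous.
  exact: cvg_cst.
exact: continuous_cos.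
Qed.

Section finite_sum.
Variables (I : finType) (C : I -> R) (L : I -> 'rV[R]_d) (a : R).

Definition trig_sum (t : R) (y : 'rV[R]_d) : R :=
  \sum_i C i * (expR (- rho beta (L i) * t) * cos (inner (L i) y + a)).

Lemma trig_sum_cbdd t : cbdd (trig_sum t).
Proof.
split.
  apply: continuous_sumr => i y; apply: (@cvgM _ _ (nbhs y) _ (fun=> C i)); first exact: cvg_cst.
  apply: (@cvgM _ _ (nbhs y) _ (fun=> expR _)); first exact: cvg_cst.
  have [h _] := cos_inner_cbdd (L i) a.
  exact: h.
exists (\sum_i `|C i| * expR (- rho beta (L i) * t)) => y.
apply: le_trans (ler_norm_sum _ _ _) _; apply: ler_sum => i _.
rewrite normrM ler_wpM2l // normrM ger0_norm ?expR_ge0 // ler_piMr ?expR_ge0 //.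
exact: cos_norm_le1.
Qed.

(** The factor [exp(- rho (t + s))] meets the eigenvalue [exp(rho s)] of [growth_cos]; linearity
    does the rest. *)
Lemma harmonic_trig_sum : harmonic beta trig_sum.
Proof.
split.
- exact: trig_sum_cbdd.
- apply: measurable_sum => i; apply: measurable_funM => //; apply: measurable_funM.
    by apply: measurableT_comp => //; apply: measurable_funM => //; exact: measurable_fst.
  apply: (measurableT_comp (cbdd_measurable (cos_inner_cbdd (L i) a))).
  exact: measurable_snd.
- move=> T; exists (\sum_i `|C i| * expR (`|rho beta (L i)| * T)) => t y /andP[t0 tT].
  apply: le_trans (ler_norm_sum _ _ _) _; apply: ler_sum => i _.
  rewrite normrM ler_wpM2l // normrM ger0_norm ?expR_ge0 //.
  apply: (@le_trans _ _ (expR (- rho beta (L i) * t))).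
    by rewrite ler_piMr ?expR_ge0 // cos_norm_le1.
  rewrite ler_expR (@le_trans _ _ (`|rho beta (L i)| * t)) //.
    by rewrite ler_wpM2r // -normrN ler_norm.
  by rewrite ler_wpM2l.
- move=> s t y s0 t0; rewrite /trig_sum.
  have mc (l : 'rV[R]_d) : measurable_fun setT ((fun y => cos (inner l y + a)) : E -> R).
    exact: (cbdd_measurable (cos_inner_cbdd l a)).
  have bc (l : 'rV[R]_d) : bdd (fun y => cos (inner l y + a)) by have [] := cos_inner_cbdd l a.
  rewrite /growth.
  have -> : \int[std_gaussian R d]_z (\sum_i C i * (expR (- rho beta (L i) * (t + s)) *
        cos (inner (L i) (gshift s y z) + a))) =
      \sum_i C i * (expR (- rho beta (L i) * (t + s)) *
        \int[std_gaussian R d]_z cos (inner (L i) (gshift s y z) + a)).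
    have Ic i := integrable_gshift s y (mc (L i)) (bc (L i)).
    have I1 i := integrableZl measurableT (C i * expR (- rho beta (L i) * (t + s))) (Ic i).
    rewrite /Rintegral.
    under eq_integral do rewrite -sumEFin.
    rewrite integral_sum //; last first.
      by move=> i; have := I1 i; apply: eq_integrable => // z _; rewrite /= mulrA.
    rewrite -sum_fine; last first.
      move=> i _; apply: integrable_fin_num => //.
      by have := I1 i; apply: eq_integrable => // z _; rewrite /= mulrA.
    apply: eq_bigr => i _; rewrite mulrA.
    rewrite -[RHS](RintegralZl _ measurableT (Ic i)).
    by apply: eq_Rintegral => z _; rewrite /= mulrA.
  rewrite big_distrr /=; apply: eq_bigr => i _.
  rewrite mulrCA; congr (_ * _); rewrite mulrCA -[X in _ * X]/(growth beta s
    (fun y => cos (inner (L i) y + a)) y) growth_cos // mulrA -expRD.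
  by congr (expR _ * _); ring.
Qed.

End finite_sum.
End trigonometric_harmonics.

Section one_dimensional_increments.
Variable R : realType.
Local Notation N01 := (normal_prob (0 : R) 1).
Local Open Scope complex_scope.
Implicit Types (t l y delta s : R).

(** The squared modulus as a real number; the norm of [R[i]] takes values in [R[i]]. *)
Definition sqn (z : R[i]) : R := complex.Re z ^+ 2 + complex.Im z ^+ 2.

Lemma sqnM z w : sqn (z * w) = sqn z * sqn w.
Proof. by case: z => a b; case: w => a' b'; rewrite /sqn /=; ring. Qed.

Lemma sqn_prod (I : finType) (z : I -> R[i]) : sqn (\prod_i z i) = \prod_i sqn (z i).
Proof.
apply: (big_morph sqn); first exact: sqnM.
by rewrite /sqn /= expr1n expr0n /= addr0.
Qed.

(* [e^(l^2 t / 2 - i l y)], up to the factor [e^(- beta t)] the one-dimensional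
   space-time harmonic function of frequency [l] *)
Definition cexp t l y : R[i] :=
  (expR (l ^+ 2 * t / 2))%:C * (cos (l * y) -i* sin (l * y)).

(** Index 0 carries the value at frequency 0, which is 1, rather than a difference, so that partial
    sums recover the wave itself. *)
Definition dexp (s delta : R) (k : nat) t y : R[i] :=
  if k is k'.+1 then cexp t (s * (k%:R * delta)) y - cexp t (s * (k'%:R * delta)) y
  else 1.

Lemma cexp0 t y : cexp t 0 y = 1.
Proof.
by rewrite /cexp expr0n /= !mul0r expR0 cos0 sin0 mul1r; apply/eqP; rewrite eq_complex /= oppr0 !eqxx.
Qed.

Lemma dexp_telescope s delta (m : nat) t y :
  \sum_(k < m.+1) dexp s delta k t y = cexp t (s * (m%:R * delta)) y.
Proof.
elim: m => [|m IH]; first by rewrite big_ord_recl big_ord0 addr0 /= mul0r mulr0 cexp0.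
by rewrite big_ord_recr /= IH addrC subrK.
Qed.

(** Law of cosines: the squared modulus depends on [y] only through one cosine, to which the
    Gaussian integral applies. *)
Lemma sqn_cexpB t l l' y : sqn (cexp t l y - cexp t l' y) =
  expR (l ^+ 2 * t / 2) ^+ 2 + expR (l' ^+ 2 * t / 2) ^+ 2 -
  2 * (expR (l ^+ 2 * t / 2) * expR (l' ^+ 2 * t / 2)) * cos ((l - l') * y).
Proof.
rewrite mulrBl cosB /sqn /cexp /=.
move: (cos2Dsin2 (l * y)) (cos2Dsin2 (l' * y)).
move: (expR (l ^+ 2 * t / 2)) (expR (l' ^+ 2 * t / 2)) => A B.
move: (cos (l * y)) (sin (l * y)) (cos (l' * y)) (sin (l' * y)) => c1 s1 c2 s2 h1 h2.
transitivity (A ^+ 2 * (c1 ^+ 2 + s1 ^+ 2) + B ^+ 2 * (c2 ^+ 2 + s2 ^+ 2) -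
  2 * (A * B) * (c1 * c2 + s1 * s2)); first by ring.
by rewrite h1 h2 !mulr1.
Qed.

Lemma cos_ge_1subsqr (z : R) : 1 - cos z <= z ^+ 2 / 2.
Proof.
wlog z0 : z / 0 <= z.
  move=> h; have [/h//|/ltW z0] := leP 0 z.
  by rewrite -cosN -sqrrN; apply: h; rewrite oppr_ge0.
have sin_le (y : R) : 0 <= y -> 0 <= y - sin y.
  apply: (@is_derive_ge0_ge0 _ (fun y => y - sin y) (fun y => 1 - cos y)).
  - by move=> u _; rewrite subr_ge0 cos_le1.
  - by rewrite sin0 subrr.
have : 0 <= z ^+ 2 / 2 - (1 - cos z).
  apply: (@is_derive_ge0_ge0 _ (fun z => z ^+ 2 / 2 - (1 - cos z)) (fun y => y - sin y)) z0.
  - by move=> u; apply: is_derive_eq; rewrite /GRing.scale/=; field.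
  - exact: sin_le.
  - by rewrite cos0 subrr subr0 expr0n mul0r.
by rewrite subr_ge0.
Qed.

Lemma integral_sqn_cexpB t l l' x : 0 <= t ->
  \int[N01]_z sqn (cexp t l (x + Num.sqrt t * z) - cexp t l' (x + Num.sqrt t * z)) =
  expR (l ^+ 2 * t / 2) ^+ 2 + expR (l' ^+ 2 * t / 2) ^+ 2 -
  2 * (expR (l ^+ 2 * t / 2) * expR (l' ^+ 2 * t / 2)) *
    (expR (- ((l - l') ^+ 2 * t) / 2) * cos ((l - l') * x)).
Proof.
move=> t0.
set A := expR (l ^+ 2 * t / 2); set B := expR (l' ^+ 2 * t / 2).
transitivity (\int[N01]_z ((A ^+ 2 + B ^+ 2) +
    - (2 * (A * B)) * cos ((l - l') * x + ((l - l') * Num.sqrt t) * z))).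
  apply: eq_Rintegral => z _; rewrite sqn_cexpB -/A -/B mulNr.
  by congr (_ - _ * cos _); ring.
have Ic : N01.-integrable setT (fun z => (cos ((l - l') * x + ((l - l') * Num.sqrt t) * z))%:E).
  apply: (@bdd_integrable _ (measurableTypeR R) R N01); first exact: measurable_cosD.
  by exists 1 => z; exact: cos_norm_le1.
have mT := @measurableT _ (measurableTypeR R).
have Ik : N01.-integrable setT (EFin \o cst (A ^+ 2 + B ^+ 2)).
  exact: (@finite_measure_integrable_cst _ (measurableTypeR R) R N01).
rewrite (RintegralD mT Ik (integrableZl mT (- (2 * (A * B))) Ic)).
rewrite (RintegralZl _ mT Ic) integral_cos_normal_prob01 exprMn sqr_sqrtr //.
by rewrite (@Rintegral_probability_cst _ (measurableTypeR R)) mulNr.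
Qed.

(** A frequency step of size [delta] changes the amplitude at relative rate [r t] and the phase at
    rate [|y|], where [y] has mean square [x ^ 2 + t]. These are the three terms bounded by
    [b ^ 2]. *)
Lemma integral_sqn_dexp_le s delta (k : nat) t x b r : 0 <= t -> `|s| = 1 -> 0 <= delta ->
  0 <= b -> k%:R * delta <= r -> r ^+ 2 * t ^+ 2 + x ^+ 2 + t <= b ^+ 2 ->
  \int[N01]_z sqn (dexp s delta k t (x + Num.sqrt t * z)) <=
  expR ((k%:R * delta) ^+ 2 * t) * (if k == 0%N then 1 else (delta * b) ^+ 2).
Proof.
move=> t0 s1 delta0 b0 kr hb.
case: k kr => [_|k kr] /=.
  rewrite mul0r expr0n /= mul0r expR0 mulr1 /sqn /=.
  rewrite (@Rintegral_probability_cst _ (measurableTypeR R)).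
  by rewrite expr1n expr0n /= addr0.
rewrite integral_sqn_cexpB //.
have ss : s ^+ 2 = 1 by rewrite -real_normK ?num_real // s1 expr1n.
rewrite -mulrBr -natr1.
rewrite -natr1 in kr.
set l1 := (k%:R + 1) * delta; set l0 := k%:R * delta.
have l00 : 0 <= l0 by rewrite mulr_ge0.
have l10 : 0 <= l1 by rewrite mulr_ge0 ?addr_ge0.
have l01 : l1 - l0 = delta by rewrite /l1 /l0; ring.
rewrite l01 ![(s * _) ^+ 2]exprMn !ss !mul1r.
set A := expR (l1 ^+ 2 * t / 2); set B := expR (l0 ^+ 2 * t / 2).
have A0 : 0 < A := expR_gt0 _.
have B0 : 0 < B := expR_gt0 _.
have A2 : A ^+ 2 = expR (l1 ^+ 2 * t).
  by rewrite -expRM_natl; congr expR; field.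
have l2 : l0 ^+ 2 <= l1 ^+ 2 by rewrite ler_sqr ?nnegrE //; lra.
have BA : B <= A by rewrite ler_expR ler_wpM2r // ler_wpM2r.
(* [B / A] is [expR (- (l1 ^ 2 - l0 ^ 2) t / 2)], and [(l1 ^ 2 - l0 ^ 2) / 2] is at most
   [l1 * delta]. *)
have AB : A - B <= A * (l1 * delta * t).
  have -> : B = A * expR (- ((l1 ^+ 2 - l0 ^+ 2) * t / 2)).
    by rewrite -expRD; congr expR; field.
  rewrite -[X in X - _]mulr1 -mulrBr ler_wpM2l ?(ltW A0) //.
  have := expR_ge1Dx (- ((l1 ^+ 2 - l0 ^+ 2) * t / 2)).
  have h : (l1 ^+ 2 - l0 ^+ 2) * t / 2 <= l1 * delta * t.
    rewrite -l01 -subr_ge0.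
    rewrite (_ : _ - _ = (l1 - l0) ^+ 2 * t / 2); last by field.
    by rewrite divr_ge0 // mulr_ge0 ?sqr_ge0.
  lra.
set c := cos _; set e := expR (- (delta ^+ 2 * t) / 2).
have c1 : 1 - c <= delta ^+ 2 * x ^+ 2 / 2.
  apply: le_trans (cos_ge_1subsqr _) _.
  by rewrite exprMn exprMn ss mul1r.
have e1 : 1 - e <= delta ^+ 2 * t / 2.
  by have := expR_ge1Dx (- (delta ^+ 2 * t) / 2); rewrite -/e mulNr; lra.
have e0 : 0 < e := expR_gt0 _.
have el1 : e <= 1.
  by rewrite expR_le1 mulNr oppr_le0 divr_ge0 // mulr_ge0 ?sqr_ge0.
have cl1 : c <= 1 := cos_le1 _.
have ec : 1 - e * c <= delta ^+ 2 * (x ^+ 2 + t) / 2.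
  rewrite (_ : 1 - e * c = (1 - e) + e * (1 - c)); last by ring.
  have : e * (1 - c) <= 1 - c by rewrite ler_piMl ?subr_ge0.
  lra.
have ec0 : 0 <= 1 - e * c.
  have : e * c <= e by rewrite ler_piMr // ltW.
  lra.
(* Separates the amplitude change from the phase change; each is of order [delta ^ 2]. *)
rewrite (_ : _ - _ = (A - B) ^+ 2 + 2 * (A * B) * (1 - e * c)); last by ring.
have h1 : (A - B) ^+ 2 <= A ^+ 2 * (r ^+ 2 * t ^+ 2 * delta ^+ 2).
  apply: (@le_trans _ _ ((A * (l1 * delta * t)) ^+ 2)).
    rewrite ler_sqr ?nnegrE ?subr_ge0 //.
    by rewrite mulr_ge0 ?(ltW A0) // !mulr_ge0.
  rewrite (_ : (A * (l1 * delta * t)) ^+ 2 = A ^+ 2 * (l1 ^+ 2 * t ^+ 2 * delta ^+ 2)); last by ring.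
  rewrite ler_wpM2l ?sqr_ge0 // ler_wpM2r ?sqr_ge0 // ler_wpM2r ?sqr_ge0 //.
  by rewrite ler_sqr ?nnegrE // (le_trans _ kr).
have h2 : 2 * (A * B) * (1 - e * c) <= A ^+ 2 * (delta ^+ 2 * (x ^+ 2 + t)).
  apply: (@le_trans _ _ (2 * (A * A) * (1 - e * c))).
    by rewrite ler_wpM2r // ler_wpM2l // ler_wpM2l // ltW.
  rewrite -expr2 mulrAC mulrC ler_wpM2l ?sqr_ge0 //.
  by rewrite mulrC; lra.
rewrite -A2 exprMn.
have h3 : A ^+ 2 * (delta ^+ 2 * (r ^+ 2 * t ^+ 2 + x ^+ 2 + t)) <= A ^+ 2 * (delta ^+ 2 * b ^+ 2).
  by rewrite ler_wpM2l ?sqr_ge0 // ler_wpM2l ?sqr_ge0.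
apply: le_trans h3.
rewrite (_ : A ^+ 2 * (delta ^+ 2 * (r ^+ 2 * t ^+ 2 + x ^+ 2 + t)) =
  A ^+ 2 * (r ^+ 2 * t ^+ 2 * delta ^+ 2) + A ^+ 2 * (delta ^+ 2 * (x ^+ 2 + t))); last by ring.
exact: lerD.
Qed.

End one_dimensional_increments.

Section product_increments.
Variables (R : realType) (d : nat) (beta : R).
Local Notation E := (euclidean R d).
Local Notation N01 := (normal_prob (0 : R) 1).
Local Open Scope complex_scope.
Implicit Types (t : R) (y : 'rV[R]_d).

Definition wave (l : 'rV[R]_d) (a t : R) (y : 'rV[R]_d) : R :=
  expR (- rho beta l * t) * cos (inner l y + a).

(* The imaginary part is again a cosine, shifted by [pi / 2]. *)
Definition phase (b : bool) : R := if b then pi / 2 else 0.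
Definition part (b : bool) (z : R[i]) : R := if b then complex.Im z else complex.Re z.

Lemma partD b : {morph part b : z w / z + w}.
Proof. by case: b => -[? ?] [? ?]. Qed.

Lemma part0 b : part b 0 = 0. Proof. by case: b. Qed.

Lemma part_real b (c : R) z : part b (c%:C * z) = c * part b z.
Proof. by case: b; case: z => ? ? /=; rewrite mul0r ?subr0 ?addr0. Qed.

Lemma part_sqr_le b z : part b z ^+ 2 <= sqn z.
Proof. by rewrite /sqn; case: b; rewrite ?lerDl ?lerDr sqr_ge0. Qed.

Let cis (a : R) : R[i] := cos a -i* sin a.

Let cisD a b : cis (a + b) = cis a * cis b.
Proof. by rewrite /cis cosD sinD; apply/eqP; rewrite eq_complex /=; apply/andP; split; apply/eqP; ring. Qed.

Let cis0 : cis 0 = 1.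
Proof. by rewrite /cis cos0 sin0 oppr0. Qed.

Lemma prod_cexp (l y : 'rV[R]_d) t :
  \prod_j cexp t (l 0 j) (y 0 j) =
  (expR (inner l l * t / 2))%:C * (cos (inner l y) -i* sin (inner l y)).
Proof.
rewrite /cexp big_split /=; congr (_ * _).
  rewrite -(rmorph_prod (real_complex R)) /=; congr (_%:C).
  rewrite -(big_morph _ (@expRD R) (@expR0 R)); congr expR.
  rewrite /inner -mulrA mulr_suml; apply: eq_bigr => i _.
  by rewrite expr2 mulrA.
by rewrite -[RHS]/(cis _) /inner (big_morph _ cisD cis0).
Qed.

Lemma part_prod_cexp b (l y : 'rV[R]_d) t :
  expR (- beta * t) * part b (\prod_j cexp t (l 0 j) (y 0 j)) = wave l (phase b) t y.
Proof.
rewrite prod_cexp part_real mulrA -expRD /wave; congr (_ * _).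
  by congr expR; rewrite /rho; field.
by case: b => /=; rewrite ?addr0 // cosDpihalf.
Qed.

Variables (sg : 'I_d -> R) (delta : R).

Definition freq (k : 'I_d -> nat) : 'rV[R]_d := \row_j (sg j * ((k j)%:R * delta)).

Definition prod_incr (k : 'I_d -> nat) t y : R[i] :=
  \prod_j dexp (sg j) delta (k j) t (y 0 j).

(** [true] selects the upper endpoint of an increment and [false] the lower one, with sign [-1]. At
    [k = 0] the lower term gets coefficient 0, since [down 0 false] is again 0 and would cancel the
    value 1. *)
Let coef (k : nat) (b : bool) : R := if b then 1 else - (k != 0%N)%:R.
Let down (k : nat) (b : bool) : nat := if b then k else k.-1.

Let dexpE (s : R) (k : nat) t (y : R) :
  dexp s delta k t y = \sum_(b : bool) (coef k b)%:C * cexp t (s * ((down k b)%:R * delta)) y.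
Proof.
rewrite big_bool /= mul1r; case: k => [|k] /=.
  by rewrite oppr0 !mul0r addr0 mulr0 cexp0.
by rewrite (_ : (- 1)%:C = -1) ?mulN1r //; apply/eqP; rewrite eq_complex /= oppr0 !eqxx.
Qed.

Lemma prod_incr_expand (k : 'I_d -> nat) t y :
  prod_incr k t y = \sum_(f : {ffun 'I_d -> bool})
    (\prod_j coef (k j) (f j))%:C *
    \prod_j cexp t (freq (fun j => down (k j) (f j)) 0 j) (y 0 j).
Proof.
rewrite /prod_incr; under eq_bigr do rewrite dexpE.
rewrite bigA_distr_bigA; apply: eq_bigr => f _.
rewrite big_split /= (rmorph_prod (real_complex R)); congr (_ * _).
by apply: eq_bigr => j _; rewrite mxE.
Qed.

(* [c] switches the increment off when its frequency leaves the ball *)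
Definition incr (c : R) (k : 'I_d -> nat) (b : bool) t y : R :=
  c * (expR (- beta * t) * part b (prod_incr k t y)).

(** Expanding the product over coordinates gives a signed sum of waves indexed by the choice of an
    endpoint in each coordinate, hence a [trig_sum]. *)
Lemma harmonic_incr c k b : harmonic beta (incr c k b).
Proof.
suff -> : incr c k b = trig_sum beta
    (fun f : {ffun 'I_d -> bool} => c * \prod_j coef (k j) (f j))
    (fun f => freq (fun j => down (k j) (f j))) (phase b).
  exact: harmonic_trig_sum.
apply/funext => t; apply/funext => y.
rewrite /incr prod_incr_expand (big_morph _ (partD b) (part0 b)) !big_distrr /=.
apply: eq_bigr => f _; rewrite part_real -mulrA; congr (_ * _).
by rewrite mulrCA part_prod_cexp.
Qed.

(** Each factor on the right telescopes in its own coordinate; distributing the product over these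
    sums gives the box of multi-indices below [m]. *)
Lemma sum_prod_incr K (m : 'I_d -> 'I_K.+1) t y :
  \sum_(k : {ffun 'I_d -> 'I_K.+1} | [forall j, (k j <= m j)%N]) prod_incr (fun j => k j) t y =
  \prod_j cexp t (freq (fun j => m j) 0 j) (y 0 j).
Proof.
transitivity (\prod_(j < d) \sum_(k < K.+1 | (k <= m j)%N) dexp (sg j) delta k t (y 0 j)).
  rewrite bigA_distr_big_dep; apply: eq_bigl => k.
  by apply/forallP/familyP => h j; have := h j; rewrite ?inE.
apply: eq_bigr => j _; rewrite mxE -dexp_telescope.
by rewrite (big_ord_widen K.+1 (fun k => dexp (sg j) delta k t (y 0 j))).
Qed.

End product_increments.

Section increment_rate.
Variables (R : realType) (d : nat) (beta : R).
Local Notation E := (euclidean R d).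
Local Notation N01 := (normal_prob (0 : R) 1).
Local Open Scope complex_scope.

(** An affine function of one cosine is visibly measurable and bounded, so nothing more about [dexp]
    is needed for integrability. *)
Let sqn_dexpE (s delta : R) k t : exists a b c : R,
  (fun y => sqn (dexp s delta k t y)) = (fun y => a + b * cos (c * y)).
Proof.
case: k => [|k] /=.
  by exists 1, 0, 0; apply/funext => y; rewrite /sqn /= mul0r addr0 expr1n expr0n addr0.
do 3 eexists; apply/funext => y; rewrite sqn_cexpB -mulNr; reflexivity.
Qed.

Lemma measurable_sqn_dexp (s delta : R) k t x u :
  measurable_fun setT (fun z : R => sqn (dexp s delta k t (x + u * z))).
Proof.
have [a [b [c e]]] := sqn_dexpE s delta k t.
rewrite (_ : (fun z => _) = (fun z => a + b * cos (c * x + (c * u) * z))); last first.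
  apply/funext => z; have := congr1 (fun f => f (x + u * z)) e => /= ->.
  by rewrite mulrDr mulrA.
by apply: measurable_funD => //; apply: measurable_funM => //; exact: measurable_cosD.
Qed.

Lemma bdd_sqn_dexp (s delta : R) k t x u :
  bdd (fun z : R => sqn (dexp s delta k t (x + u * z))).
Proof.
have [a [b [c e]]] := sqn_dexpE s delta k t.
exists (`|a| + `|b|) => z; have := congr1 (fun f => f (x + u * z)) e => /= ->.
apply: le_trans (ler_normD _ _) _; rewrite lerD2l normrM ler_piMr //.
exact: cos_norm_le1.
Qed.

Variables (sg : 'I_d -> R) (delta : R).
Hypotheses (sg1 : forall j, `|sg j| = 1) (delta0 : 0 <= delta).

(** The modulus is multiplicative and the Gaussian coordinates are independent. This is the reason
    for passing from a real or imaginary part, which does not factor, to the squared modulus. *)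
Lemma Rintegral_sqn_prod_incr (k : 'I_d -> nat) t x :
  \int[std_gaussian R d]_z sqn (prod_incr sg delta k t (gshift t x z)) =
  \prod_j \int[N01]_z sqn (dexp (sg j) delta (k j) t (x 0 j + Num.sqrt t * z)).
Proof.
rewrite -Rintegral_prod_std_gaussian.
- apply: eq_Rintegral => z _; rewrite /prod_incr sqn_prod; apply: eq_bigr => j _.
  by rewrite /gshift !mxE.
- by move=> j; exact: measurable_sqn_dexp.
- by move=> j; exact: bdd_sqn_dexp.
Qed.

Definition weight (b : R) (k : nat) : R := if k == 0%N then 1 else delta * b.

Lemma weight_gt0 b k : 0 < delta -> 0 < b -> 0 < weight b k.
Proof. by move=> d0 b0; rewrite /weight; case: eqP => // _; rewrite mulr_gt0. Qed.

(** Exponent count: [beta] from the semigroup, [- 2 * beta] from the squared normalization, and the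
    squared frequency, at most [kappa], from the coordinates. An increment that is switched off has
    rate 0. *)
Lemma mart_rate_incr (c : bool) (k : 'I_d -> nat) (ph : bool) (x : 'rV[R]_d) r kappa rad b :
  0 <= r -> 0 <= b -> (c -> \sum_j ((k j)%:R * delta) ^+ 2 <= kappa) ->
  (forall j, (k j)%:R * delta <= rad) ->
  (forall j, rad ^+ 2 * r ^+ 2 + x 0 j ^+ 2 + r <= b ^+ 2) ->
  mart_rate beta (incr beta sg delta c%:R k ph) x r <=
  expR (- (beta - kappa) * r) * \prod_j weight b (k j) ^+ 2.
Proof.
move=> r0 b0 hc krad hb.
have W0 : 0 <= \prod_j weight b (k j) ^+ 2 by apply: prodr_ge0 => j _; rewrite sqr_ge0.
case: c hc => [/(_ isT) hk|_]; last first.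
  rewrite /mart_rate (_ : (fun y => _) = fun=> 0); last first.
    by apply/funext => y; rewrite /incr mul0r expr0n.
  by rewrite growth_cst mul0r mulr_ge0 ?expR_ge0.
rewrite /mart_rate /growth.
have cH := harmonic_cbdd (harmonic_incr beta sg delta 1 k ph) r.
have ig : (std_gaussian R d).-integrable setT
    (EFin \o (fun z => sqn (prod_incr sg delta k r (gshift r x z)))).
  pose g j z := sqn (dexp (sg j) delta (k j) r (x 0 j + Num.sqrt r * z)).
  have gE z : sqn (prod_incr sg delta k r (gshift r x z)) = \prod_j g j (tnth z j).
    by rewrite /prod_incr sqn_prod; apply: eq_bigr => j _; rewrite /gshift !mxE.
  apply: bdd_integrable.
    rewrite (_ : (fun z => _) = fun z => \prod_j g j (tnth z j)); last exact/funext.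
    apply: measurable_prod => j _.
    by apply: (measurableT_comp (measurable_sqn_dexp _ _ _ _ _ _)); exact: measurable_tnth.
  have [M gM] : bdd (fun z => \prod_j (fun j z => g j (tnth z j)) j z).
    apply: bdd_prod => j; have [M gM] := bdd_sqn_dexp (sg j) delta (k j) r (x 0 j) (Num.sqrt r).
    by exists M => z; exact: gM.
  by exists M => z; rewrite gE; exact: gM.
have iH : (std_gaussian R d).-integrable setT
    (EFin \o (fun z => incr beta sg delta 1 k ph r (gshift r x z) ^+ 2)).
  have [_ [M HM]] := cH.
  apply: (@integrable_gshift _ _ r (fun y => incr beta sg delta 1 k ph r y ^+ 2) x).
    by apply: measurable_funX; exact: (cbdd_measurable cH).
  by exists (M ^+ 2) => y; rewrite normrX ler_sqr ?nnegrE ?HM // (le_trans _ (HM y)).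
apply: (@le_trans _ _ (expR (- beta * r) *
    \prod_j (expR (((k j)%:R * delta) ^+ 2 * r) * weight b (k j) ^+ 2))).
  apply: (@le_trans _ _ (expR (- beta * r) *
    \int[std_gaussian R d]_z sqn (prod_incr sg delta k r (gshift r x z)))).
    rewrite (_ : expR (- beta * r) = expR (beta * r) * expR (- beta * r) ^+ 2); last first.
      by rewrite -expRM_natl -expRD; congr expR; ring.
    rewrite -mulrA ler_wpM2l ?expR_ge0 //.
    rewrite -(RintegralZl _ measurableT ig).
    apply: le_Rintegral => //; first exact: (integrableZl measurableT _ ig).
    move=> z _; rewrite /incr mul1r exprMn ler_wpM2l ?sqr_ge0 //.
    exact: part_sqr_le.
  rewrite Rintegral_sqn_prod_incr ler_wpM2l ?expR_ge0 //.
  apply: ler_prod => j _; apply/andP; split.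
    by apply: Rintegral_ge0 => z _; rewrite /sqn addr_ge0 ?sqr_ge0.
  rewrite /weight (fun_if (fun z => z ^+ 2)) expr1n.
  exact: (integral_sqn_dexp_le r0 (sg1 j) delta0 b0 (krad j) (hb j)).
rewrite big_split /= mulrA ler_wpM2r // -(big_morph _ (@expRD R) (@expR0 R)) -expRD ler_expR.
rewrite -mulr_suml -mulrDl ler_wpM2r // opprB addrC lerD2r.
exact: hk.
Qed.

End increment_rate.

(** * The maximal increment over a grid *)

Section pairing_sums.
Variables (R : realType) (d : nat).

Lemma pairing_sum (mu : MF R d) (I : finType) (A : pred I) (f : I -> 'rV[R]_d -> R) :
  (forall i, cbdd (f i)) ->
  pairing mu (fun y => \sum_(i | A i) f i y) = \sum_(i | A i) pairing mu (f i).
Proof.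
move=> cf.
have mf i : measurable_fun setT (f i : euclidean R d -> R) by exact: cbdd_measurable (cf i).
have If i := pairing_integrable mu (mf i) (proj2 (cf i)).
rewrite /pairing /Rintegral.
under eq_integral do rewrite -sumEFin.
rewrite integral_sum //.
rewrite -sum_fine // => i _; apply: integrable_fin_num => //; exact: If.
Qed.

End pairing_sums.

Section grid_increments.
Variables (R : realType) (d : nat) (alpha beta kappa : R).
Hypotheses (alpha0 : 0 < alpha) (beta0 : 0 <= beta) (kappa_beta : kappa <= beta).
Context (dO : measure_display) (Omega : measurableType dO).
Variables (P : MF R d -> probability Omega R) (X : R -> Omega -> MF R d).
Hypothesis hX : super_brownian_motion alpha beta P X.
Variables (x : 'rV[R]_d) (rad : nat).
Variables (sg : 'I_d -> R) (sg1 : forall j, `|sg j| = 1).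
Variable m : nat.
Let alpha0' : 0 <= alpha := ltW alpha0.

Let mesh : R := (2 ^ m)%:R^-1.
Let K := (rad * 2 ^ m)%N.
Local Notation grid_index := {ffun 'I_d -> 'I_K.+1}.

Let mesh0 : 0 < mesh. Proof. by rewrite invr_gt0 ltr0n expn_gt0. Qed.

Let Kmesh : K%:R * mesh = rad%:R.
Proof. by rewrite /K /mesh natrM mulfK // pnatr_eq0 expn_eq0. Qed.

(** Stated on indices alone: the signs have modulus 1, so every orthant has the same admissible
    indices. *)
Definition in_ball (k : 'I_d -> nat) : bool := \sum_j ((k j)%:R * mesh) ^+ 2 <= kappa.

Definition grid_incr (i : grid_index * bool) : R -> 'rV[R]_d -> R :=
  incr beta sg mesh (in_ball (fun j => i.1 j))%:R (fun j => i.1 j) i.2.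

Lemma harmonic_grid_incr i : harmonic beta (grid_incr i).
Proof. exact: harmonic_incr. Qed.

Lemma in_ball_le (k l : 'I_d -> nat) :
  (forall j, (k j <= l j)%N) -> in_ball l -> in_ball k.
Proof.
move=> kl; apply: le_trans; apply: ler_sum => j _.
by rewrite ler_sqr ?nnegrE ?mulr_ge0 // ?(ltW mesh0) // ler_wpM2r ?(ltW mesh0) // ler_nat.
Qed.

(** All indices below an admissible one are admissible by [in_ball_le], so none of the increments in
    the telescoped sum has been switched off. *)
Lemma mart_grid (l : 'I_d -> 'I_K.+1) b t w : in_ball (fun j => l j) ->
  mart X (wave beta (freq sg mesh (fun j => l j)) (phase R b)) t w =
  \sum_(k : grid_index | [forall j, (k j <= l j)%N]) mart X (grid_incr (k, b)) t w.
Proof.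
move=> lb; rewrite /mart -pairing_sum; last by move=> i; exact: harmonic_cbdd (harmonic_grid_incr _) t.
congr (pairing _ _); apply/funext => y.
rewrite -part_prod_cexp -sum_prod_incr (big_morph _ (partD b) (part0 R b)) big_distrr /=.
apply: eq_bigr => k /forallP kl.
rewrite /grid_incr /incr /=.
by rewrite (@in_ball_le (fun j => k j) (fun j => l j)) // mul1r.
Qed.

(** The right-hand side does not depend on [l] or [b]: here control of one sum becomes uniform
    control over the grid frequencies in the ball. *)
Lemma wave_incr_le_sum (l : 'I_d -> 'I_K.+1) b s t w : in_ball (fun j => l j) ->
  `|mart X (wave beta (freq sg mesh (fun j => l j)) (phase R b)) t w -
    mart X (wave beta (freq sg mesh (fun j => l j)) (phase R b)) s w| <=
  mincr_sum X grid_incr s t w.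
Proof.
move=> lb; rewrite !mart_grid // -sumrB.
apply: le_trans (ler_norm_sum _ _ _) _.
rewrite /mincr_sum -(pair_bigA _ (fun k b => `|mincr X (grid_incr (k, b)) s t w|)) /=.
apply: (@le_trans _ _ (\sum_(k : grid_index) `|mincr X (grid_incr (k, b)) s t w|)).
  by rewrite big_mkcond /=; apply: ler_sum => k _; case: ifP.
apply: ler_sum => k _.
by rewrite big_bool /=; case: b {lb}; rewrite ?lerDl ?lerDr.
Qed.

(** Chosen so that [slope * (n + 1)] can serve as [b] in [mart_rate_incr] for all coordinates and
    all times in [[n, n + 1]]. *)
Definition slope : R := rad%:R + 1 + \sum_j `|x 0 j|.

(** The leading 2 counts real and imaginary parts. The base of the power is the sum of the weights
    in one coordinate, [1 + K * mesh * slope * (n + 1)]; as [K * mesh = rad], the mesh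
    disappears. *)
Definition mean_bound (n : nat) : R :=
  2 * (Num.sqrt (2 * alpha) * expR (- (beta - kappa) / 2 * n%:R)) *
  (1 + rad%:R * (slope * n.+1%:R)) ^+ d.

Let slope_ge1 : 1 <= slope.
Proof. by rewrite /slope addrAC lerDr addr_ge0 // sumr_ge0. Qed.

Let rate_le n i (r : R) : n%:R <= r <= n%:R + 1 ->
  mart_rate beta (grid_incr i) x r <=
  expR (- (beta - kappa) * n%:R) *
  \prod_j weight mesh (slope * n.+1%:R) (i.1 j) ^+ 2.
Proof.
move=> /andP[nr rn]; have r0 : 0 <= r by exact: le_trans nr.
have slope0 : 0 <= slope by rewrite (le_trans _ slope_ge1).
apply: (@le_trans _ _ (expR (- (beta - kappa) * r) *
    \prod_j weight mesh (slope * n.+1%:R) (i.1 j) ^+ 2)); last first.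
  rewrite ler_wpM2r //; first by apply: prodr_ge0 => j _; rewrite sqr_ge0.
  by rewrite ler_expR !mulNr lerN2 ler_wpM2l // subr_ge0.
apply: (@mart_rate_incr _ _ beta _ _ sg1 (ltW mesh0) (in_ball (fun j => i.1 j))
  (fun j => i.1 j) i.2 x r kappa rad%:R) => //.
- by rewrite mulr_ge0.
- move=> j; rewrite -Kmesh ler_wpM2r ?(ltW mesh0) // ler_nat.
  by have := ltn_ord (i.1 j).
move=> j.
have xs : `|x 0 j| <= \sum_j `|x 0 j| by rewrite (bigD1 j) //= lerDl sumr_ge0.
have x0 := normr_ge0 (x 0 j).
rewrite -(real_normK (num_real (x 0 j))).
apply: (@le_trans _ _ (((rad%:R + 1 + `|x 0 j|) * n.+1%:R) ^+ 2)); last first.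
  rewrite ler_sqr ?nnegrE ?mulr_ge0 ?addr_ge0 ?sumr_ge0 // ler_wpM2r // /slope.
  by rewrite lerD2l.
move: (`|x 0 j|) x0 => z z0.
have n1 : (1 : R) <= n.+1%:R by rewrite ler1n.
rewrite -natr1 in rn n1 *.
set N : R := n%:R + 1 in rn n1 *.
have r2 : r ^+ 2 <= N ^+ 2 by rewrite ler_sqr ?nnegrE //; lra.
have h1 : rad%:R ^+ 2 * r ^+ 2 <= rad%:R ^+ 2 * N ^+ 2 :> R by rewrite ler_wpM2l ?sqr_ge0.
have NN : N <= N ^+ 2 by rewrite expr2 ler_peMl //; lra.
have h2 : z ^+ 2 <= z ^+ 2 * N ^+ 2 by rewrite ler_peMr ?sqr_ge0 //; lra.
have N20 : 0 <= N ^+ 2 by rewrite sqr_ge0.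
have r0' : 0 <= rad%:R :> R by [].
have h3 : 0 <= (rad%:R + z + rad%:R * z) * N ^+ 2 by rewrite mulr_ge0 // !addr_ge0 ?mulr_ge0.
rewrite exprMn.
have -> : (rad%:R + 1 + z) ^+ 2 * N ^+ 2 = rad%:R ^+ 2 * N ^+ 2 + z ^+ 2 * N ^+ 2 + N ^+ 2
  + 2 * ((rad%:R + z + rad%:R * z) * N ^+ 2) by ring.
lra.
Qed.

(** Each increment contributes its mean-square bound [eta], a product over coordinates, so summing
    over multi-indices gives the power in [mean_bound]. *)
Lemma mincr_sum_mean n :
  (\int[P (delta x)]_w (mincr_sum X grid_incr n%:R (n%:R + 1) w)%:E <= (mean_bound n)%:E)%E.
Proof.
have n0 : 0 <= n%:R :> R by [].
have b0 : 0 < slope * n.+1%:R by rewrite mulr_gt0 // (lt_le_trans ltr01).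
pose eta (i : grid_index * bool) := Num.sqrt (2 * alpha) * expR (- (beta - kappa) / 2 * n%:R) *
  \prod_j weight mesh (slope * n.+1%:R) (i.1 j).
have eta0 i : 0 < eta i.
  rewrite !mulr_gt0 ?sqrtr_gt0 ?mulr_gt0 ?expR_gt0 //.
  by apply: prodr_gt0 => j _; exact: weight_gt0.
have hi i : (\int[P (delta x)]_w (`|mincr X (grid_incr i) n%:R (n%:R + 1) w|)%:E <= (eta i)%:E)%E.
  apply: (mart_increment_norm alpha0' beta0 hX (harmonic_grid_incr i) n0 ler01 (eta0 i)
    (fun r => @rate_le n i r)).
  rewrite /eta !exprMn sqr_sqrtr ?mulr_ge0 // -expRM_natl.
  rewrite prodrXl mulr1 [2 * (alpha * _)]mulrA -mulrA.
  rewrite (_ : 2%:R * (- (beta - kappa) / 2 * n%:R) = - (beta - kappa) * n%:R); last by field.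
  by rewrite !mulrA.
rewrite /mincr_sum.
under eq_integral do rewrite -sumEFin.
rewrite ge0_integral_sum //; last first.
  move=> i; apply/measurable_EFinP; apply: measurableT_comp => //.
  by apply: (measurable_mincr alpha0' beta0 hX (delta x) (harmonic_grid_incr i)); rewrite ?addr_ge0.
apply: (@le_trans _ _ (\sum_i (eta i)%:E)%E); first by apply: lee_sum => i _; exact: hi.
rewrite sumEFin lee_fin /mean_bound.
rewrite -(pair_bigA _ (fun k (b : bool) => eta (k, b))) /=.
under eq_bigr do rewrite big_bool /= -mulr2n -mulr_natl.
rewrite -mulr_sumr -mulrA ler_wpM2l // /eta /= -mulr_sumr ler_wpM2l ?mulr_ge0 ?expR_ge0 //.
rewrite -(bigA_distr_bigA (fun (j : 'I_d) (k : 'I_K.+1) => weight mesh (slope * n.+1%:R) k)).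
rewrite prodr_const card_ord lerXn2r ?nnegrE //.
- by apply: sumr_ge0 => k _; exact: ltW (weight_gt0 _ _ _).
- by rewrite addr_ge0 ?mulr_ge0 // ltW // -(pmulr_lgt0 _ (ltr0Sn R n)).
rewrite big_ord_recl /= /weight /= lerD2l.
rewrite sumr_const card_ord -[_ *+ K]mulr_natl -Kmesh; set N : R := n.+1%:R.
by rewrite le_eqVlt; apply/orP; left; apply/eqP; ring.
Qed.

End grid_increments.

(** * Almost sure bounds at dyadic times and frequencies *)

Section borel_cantelli.
Context dT (T : measurableType dT) (R : realType) (P : probability T R).

Lemma geometric_sum_le (g : R) n : 0 <= g -> g < 1 -> \sum_(k < n) g ^+ k <= (1 - g)^-1.
Proof.
move=> g0 g1; have g1' : 0 < 1 - g by rewrite subr_gt0.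
rewrite -[leRHS]div1r ler_pdivlMr // mulrC -opprB mulNr -subrX1 opprB gerBl.
exact: exprn_ge0.
Qed.

(** The tail intersections increase with [m] and each lies in one [B m]; continuity from below keeps
    the bound [p]. No summability in [m] enters, which matters since the bounds are only uniform in
    the mesh. *)
Lemma probability_liminf_le (B : (set T)^nat) (p : \bar R) :
  (forall m, measurable (B m)) -> (forall m, P (B m) <= p)%E ->
  (P (\bigcup_m \bigcap_(i in [set i | (m <= i)%N]) B i) <= p)%E.
Proof.
move=> mB Bp; pose F m := \bigcap_(i in [set i | (m <= i)%N]) B i.
have mF m : measurable (F m) by apply: bigcap_measurableType => i _; exact: mB.
have c : (P \o F) n @[n --> \oo] --> P (\bigcup_m F m).
  apply: nondecreasing_cvg_mu => //; first exact: bigcup_measurable.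
  move=> n m nm; apply/subsetPset => w h i mi; apply: h.
  exact: leq_trans mi.
rewrite -[X in (X <= _)%E](cvg_lim _ c) //; apply: lime_le.
  by apply/cvg_ex; exists (P (\bigcup_m F m)).
apply: nearW => m /=; apply: le_trans (Bp m).
apply: le_measure; rewrite ?inE //.
by move=> w; apply => /=.
Qed.

Lemma geometric_borel_cantelli (A : (set T)^nat) (C g : R) :
  (forall n, measurable (A n)) -> 0 <= C -> 0 <= g -> g < 1 ->
  (forall n, P (A n) <= (C * g ^+ n)%:E)%E ->
  {ae P, forall w, exists N, forall n, (N <= n)%N -> ~ A n w}.
Proof.
move=> mA C0 g0 g1 hA.
have s : (\sum_(0 <= n <oo) P (A n) < +oo)%E.
  apply: (@le_lt_trans _ _ (C * (1 - g)^-1)%:E); last exact: ltry.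
  apply: lime_le; first exact: is_cvg_nneseries.
  apply: nearW => n; apply: (@le_trans _ _ (\sum_(0 <= k < n) (C * g ^+ k)%:E)%E).
    by apply: lee_sum => k _; exact: hA.
  rewrite sumEFin lee_fin big_mkord -mulr_sumr ler_wpM2l //.
  exact: geometric_sum_le.
exists (lim_sup_set A); split.
- by apply: bigcap_measurableType => n _; exact: bigcup_measurable.
- exact: lim_sup_set_cvg0.
move=> w /= hw n _; apply: contrapT => h; apply: hw; exists n => k nk Ak.
by apply: h; exists k.
Qed.

End borel_cantelli.

Section good_event.
Variables (R : realType) (d : nat) (alpha beta kappa : R).
Hypotheses (d0 : (0 < d)%N) (alpha0 : 0 < alpha) (beta0 : 0 <= beta).
Hypothesis kappa_beta : kappa < beta.
Context (dO : measure_display) (Omega : measurableType dO).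
Variables (P : MF R d -> probability Omega R) (X : R -> Omega -> MF R d).
Hypothesis hX : super_brownian_motion alpha beta P X.
Variables (x : 'rV[R]_d) (sg : 'I_d -> R).
Hypothesis sg1 : forall j, `|sg j| = 1.

(** Of the rate [(beta - kappa) / 2] in [mean_bound], one half becomes the size of admissible
    increments, a quarter absorbs the polynomial factor, and the last quarter makes the
    probabilities summable. *)
Definition decay : R := expR (- ((beta - kappa) / 4)).

Lemma decay_gt0 : 0 < decay. Proof. exact: expR_gt0. Qed.

Lemma decay_lt1 : decay < 1.
Proof. by rewrite expR_lt1 oppr_lt0 divr_gt0 // subr_gt0. Qed.

Lemma decayX n : decay ^+ n = expR (- ((beta - kappa) / 4) * n%:R).
Proof. by rewrite -expRM_natl mulrC. Qed.

Lemma mean_bound_decay rad : exists2 C, 0 <= C & exists g, [/\ 0 <= g, g < 1 &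
  forall n, mean_bound alpha beta kappa x rad n / decay ^+ n <= C * g ^+ n].
Proof.
set u : R := rad%:R * slope x rad.
have u0 : 0 <= u by rewrite mulr_ge0 // /slope !addr_ge0 // sumr_ge0.
(* Division by [d] makes the [d]-th power of [expR (q * n)] cost exactly
   [expR ((beta - kappa) / 8 * n)]. *)
pose q : R := (beta - kappa) / 8 / d%:R.
have q0 : 0 < q by rewrite !divr_gt0 ?subr_gt0 // ltr0n.
(* With this constant [1 + u * (n + 1) <= M * (1 + q * n)]: the term [u / q] times [q * n] pays for
   [u * n]. *)
pose M : R := 1 + u + u / q.
have M0 : 0 <= M by rewrite /M !addr_ge0 // divr_ge0 // ltW.
exists (2 * Num.sqrt (2 * alpha) * M ^+ d); first by rewrite !mulr_ge0 // exprn_ge0.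
exists (expR (- ((beta - kappa) / 8))); split; first exact: expR_ge0.
  by rewrite expR_lt1 oppr_lt0 divr_gt0 // subr_gt0.
move=> n; rewrite ler_pdivrMr ?exprn_gt0 ?decay_gt0 // decayX -expRM_natl.
have h : 1 + rad%:R * (slope x rad * n.+1%:R) <= M * expR (q * n%:R).
  apply: (@le_trans _ _ (M * (1 + q * n%:R))); last first.
    by rewrite ler_wpM2l // expR_ge1Dx.
  rewrite mulrA -/u -natr1 -subr_ge0.
  rewrite (_ : _ - _ = (1 + u) * (q * n%:R) + u / q); last first.
    by rewrite /M; field; rewrite gt_eqF.
  have q0' := ltW q0.
  apply: addr_ge0; last exact: divr_ge0.
  by apply: mulr_ge0; [exact: addr_ge0|exact: mulr_ge0].
have h' : (1 + rad%:R * (slope x rad * n.+1%:R)) ^+ d <=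
    M ^+ d * expR ((beta - kappa) / 8 * n%:R).
  rewrite (_ : expR _ = expR (q * n%:R) ^+ d); last first.
    rewrite -expRM_natl; congr expR; rewrite /q; field.
    by rewrite pnatr_eq0 -lt0n.
  rewrite -exprMn lerXn2r ?nnegrE ?mulr_ge0 ?expR_ge0 //.
  by rewrite mulrA -/u; apply: addr_ge0 => //; exact: mulr_ge0.
rewrite /mean_bound.
apply: (@le_trans _ _ (2 * (Num.sqrt (2 * alpha) * expR (- (beta - kappa) / 2 * n%:R)) *
    (M ^+ d * expR ((beta - kappa) / 8 * n%:R)))).
  by apply: ler_wpM2l h'; apply: mulr_ge0 => //; apply: mulr_ge0; rewrite ?expR_ge0 ?sqrtr_ge0.
rewrite le_eqVlt; apply/orP; left; apply/eqP.
set S := Num.sqrt _; set D := M ^+ d.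
transitivity (2 * S * D * (expR (- (beta - kappa) / 2 * n%:R) * expR ((beta - kappa) / 8 * n%:R))).
  by ring.
by rewrite -[RHS]mulrA -!expRD; congr (_ * expR _); field.
Qed.

(** One random [N] serves all meshes, dyadic times and admissible frequencies of the orthant [sg];
    this is possible because the probability bound on the bad event does not see [m]. *)
Lemma good_event_ae : {ae P (delta x), forall w, exists N, forall n m k (l : 'I_d -> nat) b,
  (N <= n)%N -> (k <= 2 ^ m)%N -> in_ball kappa m l ->
  `|mart X (wave beta (freq sg (2 ^ m)%:R^-1 l) (phase R b)) (n%:R + k%:R * (2 ^ m)%:R^-1) w -
    mart X (wave beta (freq sg (2 ^ m)%:R^-1 l) (phase R b)) n%:R w| <= decay ^+ n}.
Proof.
(* An integer side length for which the cube of grid indices contains the whole ball at every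
   mesh. *)
have [rad kr] : exists rad : nat, kappa <= rad%:R ^+ 2.
  exists (Num.truncn `|kappa|).+1.
  have h : `|kappa| < (Num.truncn `|kappa|).+1%:R by exact: truncnS_gt.
  apply: le_trans (ler_norm _) (le_trans (ltW h) _).
  by rewrite expr2 ler_peMl // ler1n.
pose H m := @grid_incr R d beta kappa rad sg m.
pose B n m := [set w | exists2 k, (k <= 2 ^ m)%N &
  decay ^+ n <= mincr_sum X (H m) n%:R (n%:R + k%:R * (2 ^ m)%:R^-1) w].
have hH m i : harmonic beta (H m i) by exact: harmonic_grid_incr.
have mesh0 m : 0 <= (2 ^ m)%:R^-1 :> R by rewrite invr_ge0.
have mB n m : measurable (B n m).
  rewrite (_ : B n m = \bigcup_(k in [set k | (k <= 2 ^ m)%N])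
    [set w | decay ^+ n <= mincr_sum X (H m) n%:R (n%:R + k%:R * (2 ^ m)%:R^-1) w]) //.
  apply: bigcup_measurable => k _.
  have mf := measurable_mincr_sum (ltW alpha0) beta0 hX (delta x) (hH m) (ler0n R n)
    (addr_ge0 (ler0n R n) (mulr_ge0 (ler0n R k) (mesh0 m))).
  rewrite -[X in measurable X]setTI.
  exact: (measurable_fun_le measurableT (measurable_cst _) mf).
have [C C0 [g [g0 g1 hC]]] := mean_bound_decay rad.
have PB n m : (P (delta x) (B n m) <= (C * g ^+ n)%:E)%E.
  have a0 : 0 < decay ^+ n by rewrite exprn_gt0 ?decay_gt0.
  have h := maximal_inequality (ltW alpha0) beta0 hX (delta x) (hH m) (2 ^ m)%N
    (ler0n R n) (mesh0 m) a0.
  rewrite mulfV ?pnatr_eq0 ?expn_eq0 // in h.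
  have {h} := le_trans h (mincr_sum_mean alpha0 beta0 (ltW kappa_beta) hX x rad sg1 m n).
  rewrite -lee_pdivlMl // => /le_trans; apply.
  by rewrite -EFinM lee_fin mulrC.
(* The grids are nested, so a large increment seen at mesh [2^-m] is seen at
   every finer mesh: the bad event lies in the liminf over [m]. *)
pose A n := \bigcup_m \bigcap_(i in [set i | (m <= i)%N]) B n i.
have mA n : measurable (A n).
  by apply: bigcup_measurable => m _; apply: bigcap_measurableType => i _; exact: mB.
have PA n : (P (delta x) (A n) <= (C * g ^+ n)%:E)%E by exact: probability_liminf_le.
apply: filterS (geometric_borel_cantelli mA C0 g0 g1 PA) => w [N hN].
exists N => n m k l b Nn km lb; rewrite leNgt; apply/negP => /ltW hlt.
apply: (hN n Nn); exists m => // i /= mi.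
(* Multiplying time and frequency indices by [c] names the same points on the finer grid. *)
pose c := (2 ^ (i - m))%N.
have ci : (2 ^ i = 2 ^ m * c)%N by rewrite -expnD subnKC.
have c0 : (c%:R : R) != 0 by rewrite pnatr_eq0 expn_eq0.
have cm (p : nat) : (p * c)%:R * (2 ^ i)%:R^-1 = p%:R * (2 ^ m)%:R^-1 :> R.
  by rewrite ci !natrM invfM [X in _ * X]mulrC mulrA mulfK.
have lb' : in_ball kappa i (fun j => (l j * c)%N).
  by rewrite /in_ball; under eq_bigr do rewrite cm.
have lK j : (l j * c < (rad * 2 ^ i).+1)%N.
  rewrite ltnS -(ler_nat R) [leRHS]natrM -ler_pdivrMr ?ltr0n ?expn_gt0 //.
  rewrite -(ler_pXn2r (n := 2)) ?nnegrE ?divr_ge0 //.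
  apply: le_trans kr; apply: le_trans lb'.
  by rewrite (bigD1 j) //= lerDl sumr_ge0 // => j' _; rewrite sqr_ge0.
exists (k * c)%N; first by rewrite ci leq_mul2r km orbT.
apply: le_trans hlt _; rewrite cm.
have -> : freq sg (2 ^ m)%:R^-1 l = freq sg (2 ^ i)%:R^-1 (fun j => Ordinal (lK j)).
  by apply/rowP => j; rewrite !mxE /= cm.
exact: wave_incr_le_sum.
Qed.

End good_event.

(** * Regularity in frequency and time *)

Section dyadic_approximation.
Variable R : realType.

Lemma inv_pow2_le m : (2 ^ m)%:R^-1 <= m.+1%:R^-1 :> R.
Proof. by rewrite lef_pV2 ?posrE ?ltr0n ?expn_gt0 // ler_nat ltn_expl. Qed.

Lemma truncn_mesh (y : R) m : 0 <= y ->
  let k := Num.truncn (y * (2 ^ m)%:R) in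
  k%:R * (2 ^ m)%:R^-1 <= y < k.+1%:R * (2 ^ m)%:R^-1.
Proof.
move=> y0 /=; have p0 : (0 : R) < (2 ^ m)%:R by rewrite ltr0n expn_gt0.
have /andP[h1 h2] := truncn_itv (mulr_ge0 y0 (ltW p0)).
by rewrite ler_pdivrMr // ltr_pdivlMr // h1 h2.
Qed.

Lemma truncn_mesh_dist (y : R) m : 0 <= y ->
  `|(Num.truncn (y * (2 ^ m)%:R))%:R * (2 ^ m)%:R^-1 - y| <= 1 * m.+1%:R^-1.
Proof.
move=> y0; have /= /andP[h1 h2] := truncn_mesh m y0.
rewrite ler0_norm ?subr_le0 // opprB mul1r; apply: le_trans (inv_pow2_le m).
by move: h2; rewrite -natr1 mulrDl mul1r; lra.
Qed.

Lemma truncnS_mesh_dist (y : R) m : 0 <= y ->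
  `|(Num.truncn (y * (2 ^ m)%:R)).+1%:R * (2 ^ m)%:R^-1 - y| <= 1 * m.+1%:R^-1.
Proof.
move=> y0; have /= /andP[h1 h2] := truncn_mesh m y0.
rewrite gtr0_norm ?subr_gt0 // mul1r; apply: le_trans (inv_pow2_le m).
by rewrite -natr1 mulrDl mul1r; lra.
Qed.

End dyadic_approximation.

Section wave_limits.
Variables (R : realType) (d : nat) (beta kappa : R).
Hypothesis beta0 : 0 <= beta.
Local Notation E := (euclidean R d).
Implicit Types (l y : 'rV[R]_d) (a t : R).

Lemma wave_cbdd l a t : cbdd (wave beta l a t).
Proof.
have [h _] := cos_inner_cbdd l a; split.
  move=> y; apply: (@cvgM _ _ (nbhs y) _ (fun=> expR _)); first exact: cvg_cst.
  exact: h.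
exists (expR (- rho beta l * t)) => y.
by rewrite normrM ger0_norm ?expR_ge0 // ler_piMr ?expR_ge0 // cos_norm_le1.
Qed.

Lemma wave_le l a t y : 0 <= t -> inner l l <= kappa ->
  `|wave beta l a t y| <= expR (kappa / 2 * t).
Proof.
move=> t0 lk; rewrite normrM ger0_norm ?expR_ge0 //.
apply: (@le_trans _ _ (expR (- rho beta l * t))).
  by rewrite ler_piMr ?expR_ge0 // cos_norm_le1.
rewrite ler_expR ler_wpM2r // /rho opprB (@le_trans _ _ (inner l l / 2)) // ?gerBl //.
by rewrite ler_wpM2r.
Qed.

(** Dominated convergence at a fixed time: inside the ball all waves share the bound
    [expR (kappa / 2 * t)], constant in space and integrable for the finite measure [mu]. *)
Lemma pairing_wave_cvg (mu : MF R d) (l_ : nat -> 'rV[R]_d) l a t : 0 <= t ->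
  (forall m, inner (l_ m) (l_ m) <= kappa) ->
  (forall j, l_ m 0 j @[m --> \oo] --> l 0 j) ->
  pairing mu (wave beta (l_ m) a t) @[m --> \oo] --> pairing mu (wave beta l a t).
Proof.
move=> t0 lk cl.
have cin (u_ : nat -> 'rV[R]_d) (u : 'rV[R]_d) : (forall j, u_ m 0 j @[m --> \oo] --> u 0 j) ->
    inner (l_ m) (u_ m) @[m --> \oo] --> inner l u.
  by move=> cu; apply: (cvg_big add_continuous) => j _; apply: cvgM.
have cw y : wave beta (l_ m) a t y @[m --> \oo] --> wave beta l a t y.
  apply: cvgM.
    apply: (@continuous_cvg _ _ _ _ _ _ _ _ (@continuous_expR R _)).
    apply: cvgMr_tmp; apply: cvgN; apply: cvgB; first exact: cvg_cst.
    by apply: cvgMr_tmp; exact: cin.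
  apply: (@continuous_cvg _ _ _ _ _ _ _ _ (@continuous_cos R _)).
  apply: cvgD; last exact: cvg_cst.
  by apply: cin => j; exact: cvg_cst.
have mw u : measurable_fun setT (EFin \o wave beta u a t : E -> \bar R).
  by apply/measurable_EFinP; exact: cbdd_measurable (wave_cbdd _ _ _).
rewrite /pairing /Rintegral; apply: fine_cvg.
rewrite fineK; last first.
  apply: integrable_fin_num => //; have [_ bw] := wave_cbdd l a t.
  exact: pairing_integrable (cbdd_measurable (wave_cbdd _ _ _)) bw.
apply: (@dominated_cvg _ E R mu setT measurableT _ _ (fun=> (expR (kappa / 2 * t))%:E)).
- by move=> m; exact: mw.
- move=> y _ /=; apply: cvg_EFin; first exact: nearW.
  exact: cw.
- by [].
- exact: (@finite_measure_integrable_cst _ E R mu).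
- by move=> m y _; rewrite lee_fin wave_le.
Qed.

End wave_limits.

Section path_estimates.
Variables (R : realType) (d : nat) (beta kappa : R).
Hypotheses (beta0 : 0 <= beta) (kappa_beta : kappa < beta).
Context (dO : measure_display) (Omega : measurableType dO) (X : R -> Omega -> MF R d) (w : Omega).
Hypothesis cadX : cadlag (X ^~ w).
Implicit Types (l : 'rV[R]_d) (a t : R) (b : bool).
Local Notation q := (decay beta kappa).

(** Time enters the wave only through a scalar exponential, so right-continuity of the
    measure-valued path against one fixed cosine suffices. *)
Lemma mart_wave_right l a t : 0 <= t ->
  mart X (wave beta l a) s w @[s --> t^'+] --> mart X (wave beta l a) t w.
Proof.
move=> t0.
have cc := cos_inner_cbdd l a.
have mE s : mart X (wave beta l a) s w =
    expR (- rho beta l * s) * pairing (X s w) (fun y => cos (inner l y + a)).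
  by rewrite /mart /wave pairingZ //; [exact: cbdd_measurable|case: cc].
rewrite (_ : (fun s => _) = fun s => expR (- rho beta l * s) *
    pairing (X s w) (fun y => cos (inner l y + a))); last exact/funext.
rewrite mE; apply: cvgM.
  apply: (@continuous_cvg _ _ _ _ _ _ _ _ (@continuous_expR R _)).
  apply: cvgMl_tmp; exact: cvg_at_right_filter.
have [c _] := cadX t0.
exact: (cvg_comp _ _ c (@pairing_continuous R d _ cc (X t w))).
Qed.

Variable N : nat.
Hypothesis good : forall (s : {ffun 'I_d -> bool}) n m k (l : 'I_d -> nat) b,
  (N <= n)%N -> (k <= 2 ^ m)%N -> in_ball kappa m l ->
  let L := freq (fun j => (-1) ^+ s j) (2 ^ m)%:R^-1 l in
  `|mart X (wave beta L (phase R b)) (n%:R + k%:R * (2 ^ m)%:R^-1) w -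
    mart X (wave beta L (phase R b)) n%:R w| <= q ^+ n.

Variables (l : 'rV[R]_d) (b : bool).
Hypothesis lk : inner l l <= kappa.
Local Notation f t := (mart X (wave beta l (phase R b)) t w).

Let mesh0 m : 0 <= (2 ^ m)%:R^-1 :> R. Proof. by rewrite invr_ge0. Qed.

(* Truncating the coordinates towards 0 keeps the frequency in the ball. *)
Lemma dyadic_time_bound n m0 k : (N <= n)%N -> (k <= 2 ^ m0)%N ->
  `|f (n%:R + k%:R * (2 ^ m0)%:R^-1) - f n%:R| <= q ^+ n.
Proof.
move=> Nn km.
(* Selects the orthant of [l]; the absolute values of its coordinates are then truncated on the
   grid. *)
pose s : {ffun 'I_d -> bool} := [ffun j => l 0 j < 0].
pose tr m (j : 'I_d) := Num.truncn (`|l 0 j| * (2 ^ m)%:R).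
pose l_ m : 'rV[R]_d := freq (fun j => (-1) ^+ s j) (2 ^ m)%:R^-1 (tr m).
have trb m : in_ball kappa m (tr m).
  apply: le_trans lk; apply: ler_sum => j _; rewrite -expr2 -(real_normK (num_real (l 0 j))).
  rewrite ler_sqr ?nnegrE ?mulr_ge0 //.
  by have /= /andP[] := truncn_mesh m (normr_ge0 (l 0 j)).
have l_k m : inner (l_ m) (l_ m) <= kappa.
  apply: le_trans (trb m); rewrite le_eqVlt; apply/orP; left; apply/eqP.
  by apply: eq_bigr => j _; rewrite !mxE -expr2 exprMn sqrr_sign mul1r.
have cl j : l_ m 0 j @[m --> \oo] --> l 0 j.
  apply: (@cvg_harmonic_bound _ _ _ 1) => m; rewrite mxE ffunE.
  have e : l 0 j = (-1) ^+ (l 0 j < 0)%R * `|l 0 j| := realEsign (num_real _).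
  rewrite [X in `|_ - X|]e.
  apply: le_trans (truncn_mesh_dist m (normr_ge0 (l 0 j))).
  by rewrite -(mulrBr ((-1) ^+ (l 0 j < 0)%R)) normrM normr_sign mul1r.
have tk0 : 0 <= n%:R + k%:R * (2 ^ m0)%:R^-1 :> R by rewrite addr_ge0 // mulr_ge0.
have c1 := @pairing_wave_cvg R d beta kappa beta0
  (X (n%:R + k%:R * (2 ^ m0)%:R^-1) w) l_ l (phase R b) _ tk0 l_k cl.
have c2 := @pairing_wave_cvg R d beta kappa beta0 (X n%:R w) l_ l (phase R b) _ (ler0n R n) l_k cl.
apply: (cvgr_to_le (cvg_norm (cvgB c1 c2))).
exists m0 => // m /= m0m.
have em : (2 ^ m = 2 ^ m0 * 2 ^ (m - m0))%N by rewrite -expnD subnKC.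
(* The time is fixed while the frequency mesh is refined, but [good] uses one mesh for both, so the
   time is rewritten on the finer mesh. *)
have e : k%:R * (2 ^ m0)%:R^-1 = (k * 2 ^ (m - m0))%:R * (2 ^ m)%:R^-1 :> R.
  by rewrite em !natrM invfM [X in _ = _ * X]mulrC mulrA mulfK // pnatr_eq0 expn_eq0.
rewrite e; apply: (good s b Nn _ (trb m)).
by rewrite em leq_mul2r km orbT.
Qed.

Lemma unit_interval_bound n t : (N <= n)%N -> n%:R <= t <= n%:R + 1 ->
  `|f t - f n%:R| <= q ^+ n.
Proof.
(* The endpoint [n + 1] is dyadic and treated directly: approximation from the right would leave the
   interval. *)
move=> Nn /andP[nt]; rewrite le_eqVlt => /predU1P[->|tn].
  by have := @dyadic_time_bound n 0 1 Nn isT; rewrite expn0 invr1 mulr1.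
have tn0 : 0 <= t - n%:R by rewrite subr_ge0.
have t0 : 0 <= t by exact: le_trans nt.
(* The successor puts the dyadic times strictly to the right of [t], as right-continuity requires;
   [t < n + 1] keeps them in the closed unit interval. *)
pose k m := (Num.truncn ((t - n%:R) * (2 ^ m)%:R)).+1.
pose u m : R := n%:R + (k m)%:R * (2 ^ m)%:R^-1.
have tu m : t < u m.
  by rewrite /u -ltrBlDl; have /= /andP[] := truncn_mesh m tn0.
have cu : u @ \oo --> t.
  apply: (@cvg_harmonic_bound _ _ _ 1) => m.
  rewrite (_ : u m - t = (k m)%:R * (2 ^ m)%:R^-1 - (t - n%:R)); last by rewrite /u; ring.
  exact: truncnS_mesh_dist.
have /cvg_at_rightP/(_ u (conj tu cu)) c := @mart_wave_right l (phase R b) t t0.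
apply: (cvgr_to_le (cvg_norm (cvgB c (cvg_cst (f n%:R))))).
apply: nearW => m; apply: dyadic_time_bound => //.
rewrite /k -(ltr_nat R).
have /= /andP[h _] := truncn_itv (mulr_ge0 tn0 (ler0n R (2 ^ m))).
apply: le_lt_trans h _; rewrite gtr_pMl ?ltr0n ?expn_gt0 //.
by rewrite ltrBlDl.
Qed.

(** Chain of the unit-interval bounds up to the integer part of [t], summed as a geometric
    series. *)
Lemma tail_bound n t : (N <= n)%N -> n%:R <= t ->
  `|f t - f n%:R| <= q ^+ n / (1 - q).
Proof.
move=> Nn nt.
have q0 := ltW (decay_gt0 beta kappa).
have q1 := decay_lt1 kappa_beta.
have step j : `|f (n + j)%:R - f n%:R| <= \sum_(i < j) q ^+ (n + i).
  elim: j => [|j IH]; first by rewrite addn0 subrr normr0 big_ord0.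
  rewrite big_ord_recr /= [leRHS]addrC.
  apply: le_trans (ler_distD (f (n + j)%:R) _ _) _; apply: lerD _ IH.
  apply: unit_interval_bound; first exact: leq_trans (leq_addr _ _).
  by rewrite addnS -natr1 lerDl ler01 lexx.
have tn0 : 0 <= t - n%:R by rewrite subr_ge0.
pose j := Num.truncn (t - n%:R).
have /andP[j1 j2] := truncn_itv tn0.
apply: (@le_trans _ _ (\sum_(i < j.+1) q ^+ (n + i))).
  rewrite big_ord_recr /= [leRHS]addrC.
  apply: le_trans (ler_distD (f (n + j)%:R) _ _) _; apply: lerD _ (step j).
  apply: unit_interval_bound; first exact: leq_trans (leq_addr _ _).
  rewrite natrD; apply/andP; split; first by rewrite addrC -lerBrDr.
  by move: j2; rewrite -/j -natr1 => j2; lra.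
under eq_bigr do rewrite exprD.
by rewrite -mulr_sumr ler_wpM2l ?exprn_ge0 // geometric_sum_le.
Qed.

(** The values at integers form a Cauchy sequence. The factor 2 is one tail bound from [t] to [n]
    and one from [n] to the limit; the rate is the same for all frequencies in the ball. *)
Lemma wave_limit : exists L, forall n t, (N <= n)%N -> n%:R <= t ->
  `|f t - L| <= q ^+ n / (1 - q) *+ 2.
Proof.
have q0 := ltW (decay_gt0 beta kappa).
have q1 := decay_lt1 kappa_beta.
have cq : q ^+ n / (1 - q) @[n --> \oo] --> (0 : R).
  rewrite -(mul0r (1 - q)^-1); apply: cvgMr_tmp.
  by apply: cvg_expr; rewrite ger0_norm.
have cv : cvg ((fun n : nat => f n%:R) @ \oo).
  apply/cauchy_cvgP/cauchy_exP => e e0.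
  have : \forall p \near \oo, q ^+ p / (1 - q) < e by apply: (cvgr_lt 0 cq).
  move=> [p1 _ hp]; exists (f (maxn N p1)%:R); exists (maxn N p1) => // n /= pn.
  rewrite -ball_normE /= distrC; apply: (@le_lt_trans _ _ (q ^+ maxn N p1 / (1 - q))).
    by apply: tail_bound; rewrite ?leq_maxl // ler_nat.
  by apply: hp => /=; exact: leq_maxr.
exists (lim ((fun n : nat => f n%:R) @ \oo)) => n t Nn nt.
rewrite mulr2n; apply: le_trans (ler_distD (f n%:R) _ _) _.
apply: lerD; first exact: tail_bound.
have c : `|f n%:R - f p%:R| @[p --> \oo] --> `|f n%:R - lim ((fun n : nat => f n%:R) @ \oo)|.
  by apply: cvg_norm; apply: cvgB; [exact: cvg_cst|exact: cv].
apply: (cvgr_to_le c); exists n => // p /= np.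
by rewrite distrC tail_bound // ler_nat.
Qed.

End path_estimates.

(** * From real waves to uniform convergence of the complex process *)

Section complex_martingale.
Variables (R : realType) (d : nat) (beta : R).
Context (dO : measure_display) (Omega : measurableType dO).
Variables (X : R -> Omega -> MF R d).
Local Open Scope complex_scope.

Lemma W_wave w t (l : 'rV[R]_d) : W beta X w t l =
  mart X (wave beta l (phase R false)) t w +i* mart X (wave beta l (phase R true)) t w.
Proof.
have pw b : mart X (wave beta l (phase R b)) t w =
    expR (- rho beta l * t) * pairing (X t w) (fun y => cos (inner l y + phase R b)).
  have cc := cos_inner_cbdd l (phase R b).
  by rewrite /mart /wave pairingZ //; [exact: cbdd_measurable|case: cc].
rewrite !pw /W /pairingC /phase /=.
apply/eqP; rewrite eq_complex /= !mul0r subr0 addr0; apply/andP; split; apply/eqP.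
  by congr (_ * pairing _ _); apply/funext => y; rewrite addr0.
by congr (_ * pairing _ _); apply/funext => y; rewrite cosDpihalf.
Qed.

Lemma norm_complex_le (z : R[i]) :
  `|z| <= (`|complex.Re z| + `|complex.Im z|)%:C.
Proof.
case: z => a b; rewrite normc_def /= lecR.
rewrite -[leRHS]ger0_norm ?addr_ge0 // -sqrtr_sqr ler_wsqrtr //.
rewrite sqrrD !real_normK ?num_real // -addrA [_ *+ 2 + _]addrC addrA lerDl.
by rewrite mulrn_wge0 // mulr_ge0.
Qed.

End complex_martingale.

Lemma uniform_cvg_bound (R : realType) (U : choiceType) (A : set U)
    (F : R -> U -> Cplx R) (L : U -> Cplx R) (a : R ^nat) (N : nat) :
  a @ \oo --> 0 ->
  (forall n t u, A u -> (N <= n)%N -> n%:R <= t ->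
     `|F t u - L u| <= ((a n)%:C)%C :> Cplx R) ->
  {uniform A, F t @[t --> +oo] --> L}.
Proof.
move=> a0 h Q /uniform_nbhs[E [entE EQ]].
(* Radii in [Cplx R] are complex numbers; positivity forces [e] to be real, so it can be compared
   with the real sequence [a]. *)
have [e /= e0 eE] : exists2 e : Cplx R, 0 < e & [set xy | ball xy.1 e xy.2] `<=` E.
  by move: entE; rewrite -entourage_from_ballE.
have er : (complex.Re e)%:C%C = e :> R[i] by exact/RRe_real/gtr0_real.
have re0 : 0 < complex.Re e by move: e0; rewrite -er ltcR.
have : \forall n \near \oo, a n < complex.Re e by exact: (cvgr_lt _ a0).
move=> [p _ hp]; exists (maxn N p)%:R; split; first exact: num_real.
move=> t /ltW Nt; apply: EQ => u Au; apply: eE; rewrite /= -ball_normE /= distrC.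
apply: le_lt_trans (h (maxn N p) t u Au (leq_maxl _ _) Nt) _.
by rewrite -er ltcR hp //= leq_maxr.
Qed.

Theorem proposition3p1 (R : realType) (d : nat) (hd : (1 <= d)%N)
    (alpha beta : R) (halpha : 0 < alpha) (hbeta : 0 < beta)
    (dO : measure_display) (Omega : measurableType dO)
    (P : MF R d -> probability Omega R) (X : R -> Omega -> MF R d)
    (hX : super_brownian_motion alpha beta P X)
    (eps : R) (heps : 0 < eps < beta) (x : 'rV[R]_d) :
  {ae P (delta x), forall w, exists Winf : 'rV[R]_d -> Cplx R,
    {uniform Lambda beta eps, W beta X w t @[t --> +oo] --> Winf}}.
Proof.
have /andP[eps0 _] := heps.
(* As [2 * rho beta l - beta] equals [beta - inner l l], the set [Lambda beta eps] is the ball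
   [inner l l <= kappa]. *)
set kappa := beta - eps.
have kb : kappa < beta by rewrite /kappa gtrBl.
have sg1 (s : {ffun 'I_d -> bool}) j : `|(-1) ^+ s j| = 1 :> R by rewrite normr_sign.
have h s := good_event_ae hd halpha (ltW hbeta) kb hX x (sg1 s).
(* There are finitely many sign vectors, so the almost sure bounds hold for all orthants at once,
   and the maximum of the thresholds works for each. *)
have {h} := filter_forall (ae_filter_ringOfSetsType _) h.
apply: filterS => w /choice[N_ hN].
pose N := (\max_s N_ s)%N.
have good (s : {ffun 'I_d -> bool}) n m k (l : 'I_d -> nat) b :
    (N <= n)%N -> (k <= 2 ^ m)%N -> in_ball kappa m l ->
    let L := freq (fun j => (-1) ^+ s j) (2 ^ m)%:R^-1 l in
    `|mart X (wave beta L (phase R b)) (n%:R + k%:R * (2 ^ m)%:R^-1) w -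
      mart X (wave beta L (phase R b)) n%:R w| <= decay beta kappa ^+ n.
  by move=> Nn km lb; apply: hN => //; apply: leq_trans Nn; exact: leq_bigmax.
have wl := wave_limit (ltW hbeta) kb (sbm_cadlag hX w) good.
(* Limits of both parts are chosen for every frequency, with the value 0 outside the ball, where
   nothing is claimed. *)
have /choice[L hL] : forall p : 'rV[R]_d * bool, exists L, inner p.1 p.1 <= kappa ->
    forall n t, (N <= n)%N -> n%:R <= t ->
    `|mart X (wave beta p.1 (phase R p.2)) t w - L| <=
      decay beta kappa ^+ n / (1 - decay beta kappa) *+ 2.
  move=> [l b]; have [lk|lk] := leP (inner l l) kappa.
    by have [L hL] := wl l b lk; exists L.
  by exists 0 => /= lk'.
exists (fun l => (L (l, false) +i* L (l, true))%C).
apply: (@uniform_cvg_bound _ _ _ _ _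
  (* The second doubling adds the errors of the real and imaginary parts. *)
  (fun n => decay beta kappa ^+ n / (1 - decay beta kappa) *+ 2 *+ 2) N).
  rewrite -(mul0rn R 2) -(mul0rn R 2); apply: cvgMn; apply: cvgMn.
  rewrite -(mul0r (1 - decay beta kappa)^-1); apply: cvgMr_tmp.
  by apply: cvg_expr; rewrite ger0_norm ?decay_lt1 // ltW // decay_gt0.
move=> n t l lL Nn nt; rewrite W_wave.
have lk : inner l l <= kappa by move: lL; rewrite /Lambda /= /rho /kappa; lra.
apply: le_trans (norm_complex_le _) _ => /=.
rewrite lecR mulr2n; apply: lerD; [exact: (hL (l, false))|exact: (hL (l, true))].
Qed.
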